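(* For $j=0,1$ let $H_j$ be a Jacobi operator in $\ell^2(\mathbb{Z})$ with coefficients $a_j,b_j$ and separated boundary conditions, let $\theta_j(z,n)$, $\phi_j(z,n)$ be real entire solutions of $\tau_ju=zu$ with $W_j(\theta_j,\phi_j)=1$ such that $\phi_j(z,\cdot)$ lies in the domain of $H_j$ near $-\infty$ for every $z\in\mathbb{C}$, and let $M_j(z)$ be the associated singular Weyl function. Let $\tilde n\in\mathbb{Z}$, suppose that $\theta_0(z,n)$, $\theta_1(z,n)$, $\phi_0(z,n)$, $\phi_1(z,n)$ are of growth order at most $s$ for some $s>0$, and that $\phi_0(z,\tilde n)\sim\phi_1(z,\tilde n)$ as $|z|\to\infty$ along some non-real rays dissecting the complex plane into sectors of opening angles less than $\pi/s$. Then the following properties are equivalent: (i) $a_0(n)=a_1(n)$ for $n<\tilde n$, $b_0(n)=b_1(n)$ for $n\le\tilde n$, and for every $z\in\mathbb{C}$ $$\lim_{n\to-\infty}a_0(n)\Big(\phi_0(z,n)\phi_1(z,n+1)-\phi_0(z,n+1)\phi_1(z,n)\Big)=0.$$ (ii) For each $\delta>0$ there is an entire function $f(z)$ of growth order at most $s$ such that $$M_1(z)-M_0(z)=f(z)+o\left(\frac{1}{\phi_0(z,\tilde n+1)^2}\right)$$ as $|z|\to\infty$ in the sector $|\mathrm{Im}(z)|\ge\delta\,|\mathrm{Re}(z)|$.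
   Context: For $j=0,1$, $a_j,b_j$ are real sequences on $\mathbb{Z}$ with $a_j(n)>0$ for all $n$; $(\tau_jf)(n)=a_j(n)f(n+1)+a_j(n-1)f(n-1)+b_j(n)f(n)$ and $W_j(f,g)(n)=a_j(n)\big(f(n)g(n+1)-f(n+1)g(n)\big)$ (independent of $n$ if $f,g$ solve $\tau_ju=zu$ for the same $z$). $\tau_j$ is limit circle at $\pm\infty$ if for some (equivalently all) $z\in\mathbb{C}$ all solutions of $\tau_ju=zu$ are square summable near $\pm\infty$, and limit point otherwise. At each limit circle endpoint a boundary condition is fixed: $f$ satisfies it if $\lim_{n\to\pm\infty}W_j(v_\pm,f)(n)=0$, where $v_\pm$ is a fixed nontrivial real solution of $\tau_jv=\lambda_0v$ for some $\lambda_0\in\mathbb{R}$ ($v_\pm$ may depend on $j$); at a limit point endpoint no condition is imposed. The Jacobi operator $H_j$ is the self-adjoint operator $f\mapsto\tau_jf$ in $\ell^2(\mathbb{Z})$ with domain all $f\in\ell^2(\mathbb{Z})$ such that $\tau_jf\in\ell^2(\mathbb{Z})$ and $f$ satisfies the boundary conditions (if any). A real entire solution $\phi(z,n)$ is a solution of $\tau_j\phi(z,\cdot)=z\phi(z,\cdot)$ for every $z\in\mathbb{C}$ such that for each $n$ the function $\phi(\cdot,n)$ is entire and real on $\mathbb{R}$. It is of growth order at most $s$ if the entire functions $\phi(\cdot,n)$ and $\phi(\cdot,n+1)$ are of growth order at most $s$ for one (and hence all) $n\in\mathbb{Z}$. A solution lies in the domain of $H_j$ near $\pm\infty$ if it is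 square summable near $\pm\infty$ and satisfies the boundary condition of $H_j$ at $\pm\infty$ (if any). For $z\in\mathbb{C}\setminus\mathbb{R}$ let $u_{j,+}(z,\cdot)$ be the (unique up to multiples) nontrivial solution of $\tau_ju=zu$ lying in the domain of $H_j$ near $+\infty$. The singular Weyl function is $M_j(z)=-W_j(\theta_j(z),u_{j,+}(z))/W_j(\phi_j(z),u_{j,+}(z))$, $z\in\mathbb{C}\setminus\mathbb{R}$. $\phi_0(z,n)\sim\phi_1(z,n)$ means $\phi_0(z,n)=\phi_1(z,n)(1+o(1))$ as $|z|\to\infty$ in the specified manner. A non-real ray is a ray from the origin not contained in the real axis. *)

(* Defs.v *)
From Stdlib Require Export Reals ZArith.
From Coquelicot Require Export Coquelicot.

Open Scope C_scope.

(** * Jacobi difference expressions on the integers *)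

Definition tau (a b : Z -> R) (f : Z -> C) (n : Z) : C :=
  a n * f (n + 1)%Z + a (n - 1)%Z * f (n - 1)%Z + b n * f n.

Definition solves (a b : Z -> R) (z : C) (u : Z -> C) : Prop :=
  forall n : Z, tau a b u n = z * u n.

Definition wronskian (a : Z -> R) (f g : Z -> C) (n : Z) : C :=
  a n * (f n * g (n + 1)%Z - f (n + 1)%Z * g n).

Definition nontrivial (u : Z -> C) : Prop := exists n : Z, u n <> 0.

Inductive endpoint := minus_infty | plus_infty.

(** The sequence of integers running towards an endpoint: limits as
    [n -> -oo] or [n -> +oo] are limits in [k] of [F (toward e k)]. *)
Definition toward (e : endpoint) (k : nat) : Z :=
  match e with
  | minus_infty => (- Z.of_nat k)%Z
  | plus_infty => Z.of_nat k
  end.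

Definition lim_at (e : endpoint) (F : Z -> C) (l : C) : Prop :=
  filterlim (fun k => F (toward e k)) eventually (locally l).

Definition square_summable_near (e : endpoint) (f : Z -> C) : Prop :=
  ex_series (fun k => (Cmod (f (toward e k)) ^ 2)%R).

Definition limit_circle (a b : Z -> R) (e : endpoint) : Prop :=
  exists z : C, forall u : Z -> C,
    solves a b z u -> square_summable_near e u.

(** The data of a Jacobi operator with separated boundary conditions.  The
    operator itself is the restriction of [tau (ja H) (jb H)] to
    [in_domain H] below.  The sequence [jv e] fixes the boundary condition at
    [e]; it is constrained, and used, only if [e] is a limit circle endpoint. *)
Record jacobi_operator := {
  ja : Z -> R;
  jb : Z -> R;
  ja_pos : forall n : Z, (0 < ja n)%R;
  jv : endpoint -> Z -> R;
  jv_spec : forall e : endpoint, limit_circle ja jb e ->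
    exists lambda : R,
      solves ja jb lambda (fun n => RtoC (jv e n)) /\
      nontrivial (fun n => RtoC (jv e n))
}.

Definition boundary_condition (H : jacobi_operator) (e : endpoint)
    (f : Z -> C) : Prop :=
  limit_circle (ja H) (jb H) e ->
  lim_at e (wronskian (ja H) (fun n => RtoC (jv H e n)) f) 0.

Definition in_domain_near (H : jacobi_operator) (e : endpoint)
    (f : Z -> C) : Prop :=
  square_summable_near e f /\ boundary_condition H e f.

Definition in_domain (H : jacobi_operator) (f : Z -> C) : Prop :=
  forall e : endpoint,
    in_domain_near H e f /\ square_summable_near e (tau (ja H) (jb H) f).

(** * Entire functions and growth order *)

Definition entire (f : C -> C) : Prop :=
  forall z : C, ex_derive (K := C_AbsRing) (V := C_NormedModule) f z.

(** The infimum of the exponents [m > 0] such that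
    [f(z) = O(exp(|z|^m))] as [|z| -> oo]; it is [p_infty] if there are none. *)
Definition growth_order (f : C -> C) : Rbar :=
  Glb_Rbar (fun m : R => (0 < m)%R /\
    exists A r : R, forall z : C, (r < Cmod z)%R ->
      (Cmod (f z) <= A * exp (Rpower (Cmod z) m))%R).

Definition growth_order_le (s : R) (f : C -> C) : Prop :=
  Rbar_le (growth_order f) s.

Definition real_entire_solution (a b : Z -> R) (phi : C -> Z -> C) : Prop :=
  (forall z : C, solves a b z (phi z)) /\
  (forall n : Z, entire (fun z => phi z n) /\
                 forall x : R, Im (phi (RtoC x) n) = 0%R).

Definition solution_growth_order_le (s : R) (phi : C -> Z -> C) : Prop :=
  exists n : Z, growth_order_le s (fun z => phi z n) /\
                growth_order_le s (fun z => phi z (n + 1)%Z).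

(** * Weyl solutions and the singular Weyl function *)

Definition weyl_solution (H : jacobi_operator) (u : C -> Z -> C) : Prop :=
  forall z : C, Im z <> 0%R ->
    solves (ja H) (jb H) z (u z) /\ nontrivial (u z) /\
    in_domain_near H plus_infty (u z).

(** Meaningful for non-real [z] only.  The Wronskians are those of solutions
    of the same equation, hence constant, and are evaluated at [0]. *)
Definition singular_weyl (H : jacobi_operator) (theta phi u : C -> Z -> C)
    (z : C) : C :=
  - wronskian (ja H) (theta z) (u z) 0%Z / wronskian (ja H) (phi z) (u z) 0%Z.

(** * Asymptotics *)

(** The filter of [|z| -> oo] with [z] in [S]. *)
Definition at_infty_in (S : C -> Prop) : (C -> Prop) -> Prop :=
  within S (fun P => exists r : R, forall z : C, (r < Cmod z)%R -> P z).

Definition ray (alpha : R) (z : C) : Prop :=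
  exists r : R, (0 <= r)%R /\ z = ((r * cos alpha)%R, (r * sin alpha)%R).

(** The non-real rays at the angles [alpha 0 < ... < alpha (m - 1)], listed
    once around the origin; [alpha m] is the first ray again, so that the
    differences below are the opening angles of all the sectors. *)
Definition dissecting_rays (angle : R) (m : nat) (alpha : nat -> R) : Prop :=
  alpha m = (alpha 0%nat + 2 * PI)%R /\
  forall i : nat, (i < m)%nat ->
    sin (alpha i) <> 0%R /\
    (0 < alpha (S i) - alpha i < angle)%R.

Definition sector (delta : R) (z : C) : Prop :=
  (delta * Rabs (Re z) <= Rabs (Im z))%R.

(** [f = g (1 + o(1))]; unfolds to [g - f = o(g)]. *)
Definition asymp_in (S : C -> Prop) (f g : C -> C) : Prop :=
  is_equiv (K := C_AbsRing) (V := C_NormedModule) (at_infty_in S) f g.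

(** [f = o(g)]: the dominating function comes first in [is_domin]. *)
Definition little_o_in (S : C -> Prop) (f g : C -> C) : Prop :=
  is_domin (Ku := C_AbsRing) (Kv := C_AbsRing)
    (U := C_NormedModule) (V := C_NormedModule) (at_infty_in S) g f.

(* Main.v *)
From Stdlib Require Import Lra Lia Psatz ClassicalEpsilon.
Require Import Defs.
Open Scope C_scope.

(** Both directions compare the Weyl solutions with their behaviour at one
    site.  If [z] is not real, the flux of a solution is monotone, and the
    condition at an endpoint fixes its sign there: at a limit circle endpoint
    the boundary condition makes the flux tend to [0], and at a limit point
    endpoint the wrong sign would make all solutions square summable
    ([flux_nonpos], [flux_nonneg]).  Two fluxes of opposite sign bound the
    diagonal [phi (theta + M phi)] of the Green function by [1 / |Im z|], so that
    [M = - theta(n)/phi(n) + O(1 / (|Im z| |phi(n)|^2))] for every [n]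
    ([singular_weyl_bound]), and in the same way
    [a(n) phi(n+1) / (z phi(n)) -> 1] off the real axis
    ([left_ratio_asymptotics]).

    If the coefficients agree on the left, the solutions [phi0] and [phi1] are
    proportional there.  The factor is a Wronskian, so it is entire of order at
    most [s], and it tends to [1] on the rays; hence it is [1].  Then
    [theta1 = theta0 - f phi0] on the left with another Wronskian [f], and the
    Weyl asymptotics at the site [nt + 1] give the second property
    ([weyl_difference]).

    Conversely, the Weyl asymptotics at [nt + 1] turn the second property into a
    statement about an entire function of order at most [s] that tends to [0] on
    the rays, so that it vanishes and
    [theta1/phi1 + f = theta0/phi0] at [nt + 1].  Since the Wronskian identities
    are Bezout relations, the quotients of the solutions that occur next are
    polynomials in the solutions and [f], and the same principle gives
    [a0 phi0 = a1 phi1] at [nt + 1] and [phi0 = phi1] at [nt]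
    ([left_solutions_agree]).  From there the three term recurrence and the
    asymptotics of [phi(n)/phi(n+1)] recover the coefficients one site after the
    other ([coefficients_agree_step]).

    The function-theoretic principle behind both directions is
    [entire_limit_on_rays].  Everything that it needs follows from Goursat's
    theorem for rectangles, applied in the logarithmic coordinate
    [z = w + e^zeta]: the mean value property, hence the maximum principle on
    rectangles, hence the theorem of Phragmen and Lindelof on a strip, whatever
    the opening angle of the sector, and hence Liouville's theorem. *)


(** * Complex derivatives and the exponential function *)

Definition Cderiv (f : C -> C) (z l : C) : Prop :=
  is_derive (K := C_AbsRing) (V := C_NormedModule) f z l.

Lemma Cderiv_iff (f : C -> C) (z l : C) :
  Cderiv f z l <->
  (forall eps, (0 < eps)%R -> exists del, (0 < del)%R /\ forall w,
     (Cmod (w - z) < del)%R -> (Cmod (f w - f z - l * (w - z)) <= eps * Cmod (w - z))%R).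
Proof.
  split.
  - intros [_ Hd] eps Heps.
    destruct (Hd z (fun P H => H) (mkposreal eps Heps)) as [del Hdel].
    exists del; split; [apply del | intros w Hw].
    specialize (Hdel w Hw). rewrite (Cmult_comm l). exact Hdel.
  - intros H; split; [apply is_linear_scal_l |].
    intros z' Hz' eps.
    replace z' with z.
    2:{ apply (is_filter_lim_locally_unique (K := C_AbsRing) (V := AbsRing_NormedModule
        C_AbsRing) z z' Hz'). }
    destruct (H eps (cond_pos eps)) as [del [Hdel Hd]].
    exists (mkposreal del Hdel). intros w Hw.
    specialize (Hd w Hw). rewrite (Cmult_comm l) in Hd. exact Hd.
Qed.

(** The product and chain rules are stated for the module structure that the
    field carries over itself. *)
Lemma Cderiv_self (f : C -> C) (z l : C) :
  Cderiv f z l <->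
  is_derive (K := C_AbsRing) (V := AbsRing_NormedModule C_AbsRing) f z l.
Proof.
  split; intros [_ H]; (split; [apply is_linear_scal_l |]);
    intros x Hx; exact (H x Hx).
Qed.

Lemma Cderiv_const (c z : C) : Cderiv (fun _ => c) z 0.
Proof. apply (is_derive_const (K := C_AbsRing) (V := C_NormedModule)). Qed.

Lemma Cderiv_id (z : C) : Cderiv (fun w => w) z 1.
Proof.
  apply Cderiv_iff. intros eps Heps. exists 1%R; split; [lra | intros w _].
  replace (w - z - 1 * (w - z)) with (RtoC 0) by ring.
  rewrite Cmod_0. apply Rmult_le_pos; [lra | apply Cmod_ge_0].
Qed.

Lemma Cderiv_plus f g z df dg :
  Cderiv f z df -> Cderiv g z dg -> Cderiv (fun w => f w + g w) z (df + dg).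
Proof. apply (is_derive_plus (K := C_AbsRing) (V := C_NormedModule)). Qed.

Lemma Cderiv_mult f g z df dg :
  Cderiv f z df -> Cderiv g z dg ->
  Cderiv (fun w => f w * g w) z (df * g z + f z * dg).
Proof.
  intros Hf%Cderiv_self Hg%Cderiv_self. apply Cderiv_self.
  apply (is_derive_mult (K := C_AbsRing) f g z df dg Hf Hg).
  intros; apply Cmult_comm.
Qed.

Lemma Cderiv_comp f g z df dg :
  Cderiv f (g z) df -> Cderiv g z dg -> Cderiv (fun w => f (g w)) z (dg * df).
Proof.
  intros Hf Hg%Cderiv_self.
  apply (is_derive_comp (K := C_AbsRing) (V := C_NormedModule) f g z df dg Hf Hg).
Qed.

Lemma entire_const (c : C) : entire (fun _ => c).
Proof. intros z; eexists; apply Cderiv_const. Qed.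

Lemma entire_id : entire (fun z => z).
Proof. intros z; eexists; apply Cderiv_id. Qed.

Lemma entire_plus f g : entire f -> entire g -> entire (fun z => f z + g z).
Proof.
  intros Hf Hg z; destruct (Hf z) as [df Hf'], (Hg z) as [dg Hg'].
  eexists; apply (Cderiv_plus _ _ _ _ _ Hf' Hg').
Qed.

Lemma entire_mult f g : entire f -> entire g -> entire (fun z => f z * g z).
Proof.
  intros Hf Hg z; destruct (Hf z) as [df Hf'], (Hg z) as [dg Hg'].
  eexists; apply (Cderiv_mult _ _ _ _ _ Hf' Hg').
Qed.

Lemma entire_comp f g : entire f -> entire g -> entire (fun z => f (g z)).
Proof.
  intros Hf Hg z; destruct (Hf (g z)) as [df Hf'], (Hg z) as [dg Hg'].
  eexists; apply (Cderiv_comp _ _ _ _ _ Hf' Hg').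
Qed.

Lemma entire_ext f g : (forall z, f z = g z) -> entire f -> entire g.
Proof.
  intros Hfg Hf z. apply (ex_derive_ext f g z Hfg), Hf.
Qed.

Lemma entire_opp f : entire f -> entire (fun z => - f z).
Proof.
  intros Hf. apply (entire_ext (fun z => (- (1)) * f z)).
  - intros z; ring.
  - apply entire_mult; [apply entire_const | exact Hf].
Qed.

Lemma entire_minus f g : entire f -> entire g -> entire (fun z => f z - g z).
Proof. intros Hf Hg. apply entire_plus; [exact Hf | apply entire_opp, Hg]. Qed.

Definition Cexp (z : C) : C :=
  ((exp (Re z) * cos (Im z))%R, (exp (Re z) * sin (Im z))%R).

Lemma Cexp_0 : Cexp 0 = 1.
Proof.
  unfold Cexp; simpl. rewrite exp_0, cos_0, sin_0.
  apply injective_projections; simpl; ring.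
Qed.

Lemma Cexp_plus z w : Cexp (z + w) = Cexp z * Cexp w.
Proof.
  unfold Cexp. destruct z as [x y], w as [u v]; simpl.
  rewrite exp_plus, cos_plus, sin_plus.
  apply injective_projections; simpl; ring.
Qed.

Lemma Cmod_Cexp z : Cmod (Cexp z) = exp (Re z).
Proof.
  unfold Cexp, Cmod; simpl fst; simpl snd.
  replace ((exp (Re z) * cos (Im z)) ^ 2 + (exp (Re z) * sin (Im z)) ^ 2)%R
    with (Rsqr (exp (Re z)) * (Rsqr (sin (Im z)) + Rsqr (cos (Im z))))%R
    by (unfold Rsqr; ring).
  rewrite sin2_cos2, Rmult_1_r. apply sqrt_Rsqr, Rlt_le, exp_pos.
Qed.

Lemma Cmod_le_abs (z : C) : (Cmod z <= Rabs (Re z) + Rabs (Im z))%R.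
Proof.
  assert (H : z = RtoC (Re z) + Ci * RtoC (Im z)).
  { destruct z; apply injective_projections; simpl; ring. }
  rewrite H at 1. eapply Rle_trans; [apply Cmod_triangle |].
  rewrite Cmod_mult, Cmod_Ci, !Cmod_R. lra.
Qed.

Lemma im_le_Cmod (c : C) : (Rabs (Im c) <= Cmod c)%R.
Proof.
  pose proof (Rmax_Cmod c). eapply Rle_trans; [apply Rmax_r | exact H].
Qed.

Lemma Rderiv_eps (f : R -> R) (l : R) :
  derivable_pt_lim f 0 l -> forall eps, (0 < eps)%R -> exists del, (0 < del)%R /\
  forall h, (Rabs h < del)%R -> (Rabs (f h - f 0 - l * h) <= eps * Rabs h)%R.
Proof.
  intros H eps Heps. destruct (H eps Heps) as [del Hd].
  exists del; split; [apply del |]. intros h Hh.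
  destruct (Req_dec h 0) as [->|Hne].
  - replace (f 0 - f 0 - l * 0)%R with 0%R by ring. rewrite !Rabs_R0; lra.
  - specialize (Hd h Hne Hh). rewrite Rplus_0_l in Hd.
    replace (f h - f 0 - l * h)%R with (((f h - f 0) / h - l) * h)%R by (field; auto).
    rewrite Rabs_mult. apply Rmult_le_compat_r; [apply Rabs_pos | lra].
Qed.

(** Only the expansion at [0] needs an estimate; the functional equation
    carries it to every other point. *)
Lemma Cderiv_Cexp (z : C) : Cderiv Cexp z (Cexp z).
Proof.
  apply Cderiv_iff. intros eps Heps.
  pose proof (exp_pos (Re z)) as HE.
  set (e := Rmin 1 (eps / (exp (Re z) * 9))).
  assert (He : (0 < e)%R).
  { apply Rmin_pos; [lra |]. apply Rdiv_lt_0_compat; lra. }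
  assert (He1 : (e <= 1)%R) by apply Rmin_l.
  assert (He2 : (e * 9 * exp (Re z) <= eps)%R).
  { apply Rle_trans with (eps / (exp (Re z) * 9) * 9 * exp (Re z))%R.
    - apply Rmult_le_compat_r; [lra |]. apply Rmult_le_compat_r; [lra |]. apply Rmin_r.
    - right; field; lra. }
  pose proof (derivable_pt_lim_exp 0) as De. rewrite exp_0 in De.
  pose proof (derivable_pt_lim_cos 0) as Dc. rewrite sin_0, Ropp_0 in Dc.
  pose proof (derivable_pt_lim_sin 0) as Ds. rewrite cos_0 in Ds.
  destruct (Rderiv_eps _ _ De e He) as [d1 [Hd1 H1]].
  destruct (Rderiv_eps _ _ Dc e He) as [d2 [Hd2 H2]].
  destruct (Rderiv_eps _ _ Ds e He) as [d3 [Hd3 H3]].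
  rewrite exp_0 in H1. rewrite cos_0 in H2. rewrite sin_0 in H3.
  set (d := Rmin (Rmin d1 d2) (Rmin d3 e)).
  exists d; split.
  { unfold d; apply Rmin_pos; apply Rmin_pos; assumption. }
  intros w Hw.
  assert (Hdd : (d <= d1 /\ d <= d2 /\ d <= d3 /\ d <= e)%R).
  { unfold d; pose proof (Rmin_l (Rmin d1 d2) (Rmin d3 e));
    pose proof (Rmin_r (Rmin d1 d2) (Rmin d3 e));
    pose proof (Rmin_l d1 d2); pose proof (Rmin_r d1 d2);
    pose proof (Rmin_l d3 e); pose proof (Rmin_r d3 e); lra. }
  set (h := w - z) in *.
  replace w with (z + h) by (unfold h; ring).
  rewrite Cexp_plus.
  replace (Cexp z * Cexp h - Cexp z - Cexp z * h) with (Cexp z * (Cexp h - 1 - h)) by ring.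
  rewrite Cmod_mult, Cmod_Cexp.
  pose proof (re_le_Cmod h) as Hx. pose proof (im_le_Cmod h) as Hy.
  destruct h as [x y]; cbn [Re Im fst snd] in *.
  set (r := Cmod (x, y)) in *.
  specialize (H1 x ltac:(lra)). specialize (H2 y ltac:(lra)). specialize (H3 y ltac:(lra)).
  apply Rle_trans with (exp (Re z) * (9 * e * r))%R.
  2:{ replace (exp (Re z) * (9 * e * r))%R with (e * 9 * exp (Re z) * r)%R by ring.
      apply Rmult_le_compat_r; [unfold r; apply Cmod_ge_0 | exact He2]. }
  apply Rmult_le_compat_l; [lra |].
  eapply Rle_trans; [apply Cmod_le_abs |].
  cbn [Re Im fst snd Cexp Cminus Cplus Copp RtoC].
  set (A := (exp x - 1 - 1 * x)%R) in *.
  set (B := (cos y - 1 - 0 * y)%R) in *.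
  set (D := (sin y - 0 - 1 * y)%R) in *.
  replace (exp x * cos y + - (1) + - x)%R with (A + B * (1 + x + A))%R
    by (unfold A, B; ring).
  replace (exp x * sin y + - 0 + - y)%R with (D + (y + D) * (x + A))%R
    by (unfold A, D; ring).
  assert (Hr : (0 <= r)%R) by apply Cmod_ge_0.
  assert (HA : (Rabs A <= e * r)%R) by (eapply Rle_trans; [apply H1 | apply Rmult_le_compat_l;
      lra]).
  assert (HB : (Rabs B <= e * r)%R) by (eapply Rle_trans; [apply H2 | apply Rmult_le_compat_l;
      lra]).
  assert (HD : (Rabs D <= e * r)%R) by (eapply Rle_trans; [apply H3 | apply Rmult_le_compat_l;
      lra]).
  assert (HrA : (Rabs A <= r)%R) by (eapply Rle_trans; [apply HA|]; nra).
  assert (HrD : (Rabs D <= r)%R) by (eapply Rle_trans; [apply HD|]; nra).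
  assert (Hx2 : (Rabs (1 + x + A) <= 3)%R).
  { apply Rabs_le_between. apply Rabs_le_between in HrA. apply Rabs_le_between in Hx. lra. }
  assert (Hx3 : (Rabs (x + A) <= 2 * e)%R).
  { apply Rabs_le_between. apply Rabs_le_between in HrA. apply Rabs_le_between in Hx. lra. }
  assert (Hy3 : (Rabs (y + D) <= 2 * r)%R).
  { apply Rabs_le_between. apply Rabs_le_between in HrD. apply Rabs_le_between in Hy. lra. }
  assert (Her : (0 <= e * r)%R) by nra.
  assert (T1 : (Rabs (B * (1 + x + A)) <= (e * r) * 3)%R).
  { rewrite Rabs_mult. apply Rmult_le_compat; auto using Rabs_pos. }
  assert (T2 : (Rabs ((y + D) * (x + A)) <= (2 * r) * (2 * e))%R).
  { rewrite Rabs_mult. apply Rmult_le_compat; auto using Rabs_pos. }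
  pose proof (Rabs_triang A (B * (1 + x + A))).
  pose proof (Rabs_triang D ((y + D) * (x + A))).
  lra.
Qed.

Lemma entire_Cexp : entire Cexp.
Proof. intros z; eexists; apply Cderiv_Cexp. Qed.

(** * Bisection of rectangles *)

Lemma nested_halving (l r : nat -> R) :
  (forall n, (l n <= l (S n) /\ r (S n) <= r n /\ l n <= r n)%R) ->
  (forall n, (r (S n) - l (S n) = (r n - l n) / 2)%R) ->
  exists p, (forall n, (l n <= p <= r n)%R) /\
    forall eps, (0 < eps)%R -> exists N, forall n, (N <= n)%nat -> (r n - l n < eps)%R.
Proof.
  intros Hn Hh.
  assert (Hl : forall n k, (l n <= l (n + k)%nat)%R).
  { intros n k; induction k as [|k IH]; [rewrite Nat.add_0_r; lra |].
    rewrite Nat.add_succ_r. pose proof (Hn (n + k)%nat); lra. }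
  assert (Hr : forall n k, (r (n + k)%nat <= r n)%R).
  { intros n k; induction k as [|k IH]; [rewrite Nat.add_0_r; lra |].
    rewrite Nat.add_succ_r. pose proof (Hn (n + k)%nat); lra. }
  assert (Hlr : forall n k, (l n <= r k)%R).
  { intros n k. pose proof (Hl n k). pose proof (Hr k n). rewrite (Nat.add_comm k n) in H0.
    pose proof (Hn (n + k)%nat); lra. }
  destruct (completeness (fun x => exists n, x = l n)) as [p [Hub Hlub]].
  - exists (r 0%nat); intros x [n ->]; apply Hlr.
  - exists (l 0%nat), 0%nat; reflexivity.
  - exists p; split.
    + intros n; split; [apply Hub; exists n; reflexivity |].
      apply Hlub; intros x [k ->]; apply Hlr.
    + assert (Hw : forall n, (r n - l n = (r 0%nat - l 0%nat) * (/ 2) ^ n)%R).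
      { induction n as [|n IH]; simpl; [ring | rewrite Hh, IH; field]. }
      intros eps Heps.
      destruct (pow_lt_1_zero (/ 2) ltac:(rewrite Rabs_pos_eq; lra)
        (eps / (r 0%nat - l 0%nat + 1))) as [N HN].
      { apply Rdiv_lt_0_compat; [lra | pose proof (Hn 0%nat); lra]. }
      exists N; intros n Hnn. rewrite Hw. specialize (HN n Hnn).
      assert (H0 : (0 <= (/ 2) ^ n)%R) by (apply pow_le; lra).
      rewrite Rabs_pos_eq in HN by exact H0.
      pose proof (Hn 0%nat) as [_ [_ H3]].
      apply Rle_lt_trans with ((r 0%nat - l 0%nat + 1) * (/ 2) ^ n)%R; [nra |].
      apply (Rmult_lt_compat_l (r 0%nat - l 0%nat + 1)) in HN; [|lra].
      replace ((r 0%nat - l 0%nat + 1) * (eps / (r 0%nat - l 0%nat + 1)))%R with eps in HN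
        by (field; lra). exact HN.
Qed.

(** Repeated quartering of a bad rectangle produces bad rectangles shrinking
    to a point, all of one shape: this is Goursat's argument, and it also
    serves as the compactness of a rectangle. *)
Lemma rectangle_bisection (P : R -> R -> R -> R -> Prop) (a b c d : R) :
  (forall x1 x2 y1 y2, (x1 <= x2)%R -> (y1 <= y2)%R ->
     P x1 ((x1 + x2) / 2)%R y1 ((y1 + y2) / 2)%R ->
     P x1 ((x1 + x2) / 2)%R ((y1 + y2) / 2)%R y2 ->
     P ((x1 + x2) / 2)%R x2 y1 ((y1 + y2) / 2)%R ->
     P ((x1 + x2) / 2)%R x2 ((y1 + y2) / 2)%R y2 -> P x1 x2 y1 y2) ->
  (a <= b)%R -> (c <= d)%R ->
  (forall p q, (a <= p <= b)%R -> (c <= q <= d)%R -> exists eps, (0 < eps)%R /\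
     forall x1 x2 y1 y2, (x1 <= p <= x2)%R -> (y1 <= q <= y2)%R ->
       (x2 - x1 < eps)%R -> (y2 - y1 < eps)%R -> P x1 x2 y1 y2) ->
  P a b c d.
Proof.
  intros Hquart Hab Hcd Hloc. apply NNPP; intros Hbad.
  set (rect := (R * R * R * R)%type).
  set (Q := fun r : rect => let '(x1, x2, y1, y2) := r in P x1 x2 y1 y2).
  set (wf := fun r : rect => let '(x1, x2, y1, y2) := r in (x1 <= x2 /\ y1 <= y2)%R).
  set (child := fun r s : rect => let '(x1, x2, y1, y2) := r in
    let '(u1, u2, v1, v2) := s in
    ((u1 = x1 /\ u2 = (x1 + x2) / 2 \/ u1 = (x1 + x2) / 2 /\ u2 = x2) /\
     (v1 = y1 /\ v2 = (y1 + y2) / 2 \/ v1 = (y1 + y2) / 2 /\ v2 = y2))%R).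
  assert (Hstep : forall r : {r | wf r /\ ~ Q r}, exists s : {r | wf r /\ ~ Q r},
    child (proj1_sig r) (proj1_sig s)).
  { intros [[[[x1 x2] y1] y2] [[Hx Hy] Hb]]; simpl in Hb.
    assert (Hex : exists s, wf s /\ ~ Q s /\ child (x1, x2, y1, y2) s).
    { apply NNPP; intros Hno. apply Hb, Hquart; auto; apply NNPP; intros Hp; apply Hno;
      (match type of Hp with ~ P ?u1 ?u2 ?v1 ?v2 => exists (u1, u2, v1, v2) end);
      (split; [| split; [exact Hp |]]); simpl; repeat split; try lra; auto. }
    destruct Hex as [s [H1 [H2 H3]]]. exists (exist _ s (conj H1 H2)); exact H3. }
  pose (next r := proj1_sig (constructive_indefinite_description _ (Hstep r))).
  assert (Hnext : forall r, child (proj1_sig r) (proj1_sig (next r))).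
  { intros r; apply (proj2_sig (constructive_indefinite_description _ (Hstep r))). }
  pose (s0 := exist (fun r => wf r /\ ~ Q r) (a, b, c, d)
    (conj (conj Hab Hcd) Hbad) : {r | wf r /\ ~ Q r}).
  pose (sq := fun n => Nat.iter n next s0).
  set (X1 := fun n => fst (fst (fst (proj1_sig (sq n))))).
  set (X2 := fun n => snd (fst (fst (proj1_sig (sq n))))).
  set (Y1 := fun n => snd (fst (proj1_sig (sq n)))).
  set (Y2 := fun n => snd (proj1_sig (sq n))).
  assert (HP : forall n, (X1 n <= X2 n)%R /\ (Y1 n <= Y2 n)%R /\ ~ P (X1 n) (X2 n) (Y1 n) (Y2
      n)).
  { intros n. unfold X1, X2, Y1, Y2. destruct (sq n) as [[[[x1 x2] y1] y2] [[h1 h2] h3]].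
    simpl in *. auto. }
  assert (HS : forall n, child (X1 n, X2 n, Y1 n, Y2 n) (X1 (S n), X2 (S n), Y1 (S n), Y2 (S
      n))).
  { intros n. pose proof (Hnext (sq n)) as H. unfold X1, X2, Y1, Y2.
    change (sq (S n)) with (next (sq n)).
    destruct (proj1_sig (sq n)) as [[[x1 x2] y1] y2].
    destruct (proj1_sig (next (sq n))) as [[[u1 u2] v1] v2]. exact H. }
  destruct (nested_halving X1 X2) as [p [Hp Hpe]].
  { intros n. pose proof (HS n) as [H _]. pose proof (HP n). lra. }
  { intros n. pose proof (HS n) as [H _]. pose proof (HP n). lra. }
  destruct (nested_halving Y1 Y2) as [q [Hq Hqe]].
  { intros n. pose proof (HS n) as [_ H]. pose proof (HP n). lra. }
  { intros n. pose proof (HS n) as [_ H]. pose proof (HP n). lra. }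
  destruct (Hloc p q (Hp 0%nat) (Hq 0%nat)) as [eps [Heps Hgood]].
  destruct (Hpe eps Heps) as [N HN], (Hqe eps Heps) as [N' HN'].
  apply (proj2 (proj2 (HP (N + N')%nat))), Hgood; auto.
  - apply HN; lia.
  - apply HN'; lia.
Qed.

Definition continuous_2d (phi : R -> R -> R) : Prop :=
  forall p q eps, (0 < eps)%R -> exists del, (0 < del)%R /\ forall x y,
    (Rabs (x - p) < del)%R -> (Rabs (y - q) < del)%R -> (Rabs (phi x y - phi p q) < eps)%R.

(** The set [s] of admissible bounds is everything for boundedness, and
    the open half-line below the supremum for its attainment. *)
Lemma rectangle_upper_bound (phi : R -> R -> R) (s : R -> Prop) (a b c d : R) :
  (forall u v, s u -> s v -> s (Rmax u v)) ->
  (a <= b)%R -> (c <= d)%R ->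
  (forall p q, (a <= p <= b)%R -> (c <= q <= d)%R -> exists eps B, (0 < eps)%R /\ s B /\
     forall x y, (Rabs (x - p) < eps)%R -> (Rabs (y - q) < eps)%R -> (phi x y <= B)%R) ->
  exists B, s B /\ forall x y, (a <= x <= b)%R -> (c <= y <= d)%R -> (phi x y <= B)%R.
Proof.
  intros Hmax Hab Hcd Hloc.
  apply (rectangle_bisection (fun x1 x2 y1 y2 => exists B, s B /\
    forall x y, (x1 <= x <= x2)%R -> (y1 <= y <= y2)%R -> (phi x y <= B)%R)); auto.
  - intros x1 x2 y1 y2 Hx Hy [B1 [S1 H1]] [B2 [S2 H2]] [B3 [S3 H3]] [B4 [S4 H4]].
    exists (Rmax (Rmax B1 B2) (Rmax B3 B4)); split; [auto |]. intros x y Hxx Hyy.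
    pose proof (Rmax_l (Rmax B1 B2) (Rmax B3 B4)); pose proof (Rmax_r (Rmax B1 B2) (Rmax B3
        B4)).
    pose proof (Rmax_l B1 B2); pose proof (Rmax_r B1 B2).
    pose proof (Rmax_l B3 B4); pose proof (Rmax_r B3 B4).
    destruct (Rle_dec x ((x1 + x2) / 2)), (Rle_dec y ((y1 + y2) / 2)).
    + specialize (H1 x y); lra.
    + specialize (H2 x y); lra.
    + specialize (H3 x y); lra.
    + specialize (H4 x y); lra.
  - intros p q Hp Hq. destruct (Hloc p q Hp Hq) as [eps [B [Heps [HB H]]]].
    exists eps; split; [exact Heps |]. intros x1 x2 y1 y2 Hx Hy Hex Hey.
    exists B; split; [exact HB |]. intros x y Hxx Hyy.
    apply H; apply Rabs_def1; lra.
Qed.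

Lemma rectangle_attains_max (phi : R -> R -> R) (a b c d : R) :
  continuous_2d phi -> (a <= b)%R -> (c <= d)%R ->
  exists x0 y0, (a <= x0 <= b)%R /\ (c <= y0 <= d)%R /\
    forall x y, (a <= x <= b)%R -> (c <= y <= d)%R -> (phi x y <= phi x0 y0)%R.
Proof.
  intros Hc Hab Hcd.
  destruct (rectangle_upper_bound phi (fun _ => True) a b c d) as [B [_ HB]]; auto.
  { intros p q _ _. destruct (Hc p q 1%R ltac:(lra)) as [del [Hdel H]].
    exists del, (phi p q + 1)%R; split; [exact Hdel | split; [exact I |]].
    intros x y Hx Hy. specialize (H x y Hx Hy). apply Rabs_def2 in H; lra. }
  destruct (completeness (fun v => exists x y, (a <= x <= b)%R /\ (c <= y <= d)%R /\ v = phi x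
      y))
    as [M [Hub Hlub]].
  { exists B. intros v [x [y [Hx [Hy ->]]]]; auto. }
  { exists (phi a c), a, c; repeat split; lra. }
  apply NNPP; intros Hno.
  destruct (rectangle_upper_bound phi (fun v => (v < M)%R) a b c d) as [B' [HB' H']]; auto.
  { intros u v; apply Rmax_lub_lt. }
  { intros p q Hp Hq.
    assert (Hlt : (phi p q < M)%R).
    { apply Rnot_le_lt; intros Hge. apply Hno. exists p, q; split; [exact Hp | split; [exact Hq
        |]].
      intros x y Hx Hy. apply Rle_trans with M; [|exact Hge]. apply Hub. exists x, y; auto. }
    destruct (Hc p q ((M - phi p q) / 2)%R ltac:(lra)) as [del [Hdel H]].
    exists del, ((M + phi p q) / 2)%R; split; [exact Hdel | split; [lra |]].
    intros x y Hx Hy. specialize (H x y Hx Hy). apply Rabs_def2 in H; lra. }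
  assert (M <= B')%R; [|lra].
  apply Hlub. intros v [x [y [Hx [Hy ->]]]]; auto.
Qed.

(** * Goursat's theorem for rectangles *)

Definition Ccontinuous (f : C -> C) : Prop :=
  forall z eps, (0 < eps)%R -> exists del, (0 < del)%R /\
    forall w, (Cmod (w - z) < del)%R -> (Cmod (f w - f z) < eps)%R.

Lemma Cderiv_continuous (f : C -> C) :
  (forall z, exists l, Cderiv f z l) -> Ccontinuous f.
Proof.
  intros Hf z eps Heps. destruct (Hf z) as [l Hl].
  destruct (proj1 (Cderiv_iff f z l) Hl 1%R ltac:(lra)) as [d [Hd H]].
  pose proof (Cmod_ge_0 l) as Hl0.
  exists (Rmin d (eps / (Cmod l + 2))). split.
  { apply Rmin_pos; [exact Hd | apply Rdiv_lt_0_compat; lra]. }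
  intros w Hw.
  specialize (H w (Rlt_le_trans _ _ _ Hw (Rmin_l _ _))).
  assert (Hw2 : (Cmod (w - z) < eps / (Cmod l + 2))%R)
    by (eapply Rlt_le_trans; [exact Hw | apply Rmin_r]).
  replace (f w - f z) with ((f w - f z - l * (w - z)) + l * (w - z)) by ring.
  eapply Rle_lt_trans; [apply Cmod_triangle |]. rewrite Cmod_mult.
  apply (Rmult_lt_compat_l (Cmod l + 2)) in Hw2; [|lra].
  replace ((Cmod l + 2) * (eps / (Cmod l + 2)))%R with eps in Hw2 by (field; lra).
  pose proof (Cmod_ge_0 (w - z)). nra.
Qed.

Lemma entire_continuous f : entire f -> Ccontinuous f.
Proof. intros Hf; apply Cderiv_continuous, Hf. Qed.

Definition path_integral (g : R -> C) (a b : R) : C :=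
  RInt (V := C_R_CompleteNormedModule) g a b.

Definition hline (f : C -> C) (y a b : R) : C := path_integral (fun x => f (x, y)) a b.
Definition vline (f : C -> C) (x a b : R) : C := path_integral (fun y => f (x, y)) a b.

Lemma Cmod_h (x x' y : R) : Cmod ((x, y) - (x', y)) = Rabs (x - x').
Proof.
  rewrite <- Cmod_R. f_equal. apply injective_projections; simpl; ring.
Qed.

Lemma Cmod_v (x y y' : R) : Cmod ((x, y) - (x, y')) = Rabs (y - y').
Proof.
  replace ((x, y) - (x, y')) with (Ci * RtoC (y - y'))
    by (apply injective_projections; simpl; ring).
  rewrite Cmod_mult, Cmod_Ci, Cmod_R; ring.
Qed.

Lemma continuous_of_eps (g : R -> C) (t : R) :
  (forall eps, (0 < eps)%R -> exists del, (0 < del)%R /\ forall u, (Rabs (u - t) < del)%R ->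
     (Cmod (g u - g t) < eps)%R) ->
  continuous (U := C_R_CompleteNormedModule) g t.
Proof.
  intros H. apply (filterlim_locally (U := C_UniformSpace)). intros eps.
  destruct (H eps (cond_pos eps)) as [del [Hdel Hd]].
  exists (mkposreal del Hdel). intros u Hu.
  apply (C_NormedModule_mixin_compat1 (g t) (g u)). apply Hd. exact Hu.
Qed.

Lemma ex_RInt_hline f y a b : Ccontinuous f ->
  ex_RInt (V := C_R_CompleteNormedModule) (fun x => f (x, y)) a b.
Proof.
  intros Hf. apply (ex_RInt_continuous (V := C_R_CompleteNormedModule)). intros t _.
  apply continuous_of_eps. intros eps Heps.
  destruct (Hf (t, y) eps Heps) as [del [Hdel H]]. exists del; split; [exact Hdel |].
  intros u Hu. apply H. rewrite Cmod_h. exact Hu.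
Qed.

Lemma ex_RInt_vline f x a b : Ccontinuous f ->
  ex_RInt (V := C_R_CompleteNormedModule) (fun y => f (x, y)) a b.
Proof.
  intros Hf. apply (ex_RInt_continuous (V := C_R_CompleteNormedModule)). intros t _.
  apply continuous_of_eps. intros eps Heps.
  destruct (Hf (x, t) eps Heps) as [del [Hdel H]]. exists del; split; [exact Hdel |].
  intros u Hu. apply H. rewrite Cmod_v. exact Hu.
Qed.

Lemma path_integral_bound (g : R -> C) (a b M : R) :
  ex_RInt (V := C_R_CompleteNormedModule) g a b -> (a <= b)%R ->
  (forall t, (a <= t <= b)%R -> (Cmod (g t) <= M)%R) ->
  (Cmod (path_integral g a b) <= (b - a) * M)%R.
Proof.
  intros Hex Hab HM. rewrite Cmod_norm.
  apply (norm_RInt_le_const (V := C_R_NormedModule) g a b); [exact Hab | |].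
  - intros t Ht. rewrite <- Cmod_norm. apply HM, Ht.
  - apply (RInt_correct (V := C_R_CompleteNormedModule)), Hex.
Qed.

Definition boundary_integral (f : C -> C) (x1 x2 y1 y2 : R) : C :=
  hline f y1 x1 x2 + Ci * vline f x2 y1 y2 - hline f y2 x1 x2 - Ci * vline f x1 y1 y2.

Lemma hline_Chasles f y a b c : Ccontinuous f -> hline f y a c = hline f y a b + hline f y b c.
Proof.
  intros Hf; symmetry.
  apply (RInt_Chasles (V := C_R_CompleteNormedModule)); apply ex_RInt_hline, Hf.
Qed.

Lemma vline_Chasles f x a b c : Ccontinuous f -> vline f x a c = vline f x a b + vline f x b c.
Proof.
  intros Hf; symmetry.
  apply (RInt_Chasles (V := C_R_CompleteNormedModule)); apply ex_RInt_vline, Hf.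
Qed.

Lemma boundary_integral_minus f g x1 x2 y1 y2 : Ccontinuous f -> Ccontinuous g ->
  boundary_integral (fun z => f z - g z) x1 x2 y1 y2 =
  boundary_integral f x1 x2 y1 y2 - boundary_integral g x1 x2 y1 y2.
Proof.
  intros Hf Hg.
  assert (Hh : forall y a b, hline (fun z => f z - g z) y a b = hline f y a b - hline g y a b).
  { intros; apply (RInt_minus (V := C_R_CompleteNormedModule)); apply ex_RInt_hline; auto. }
  assert (Hv : forall x a b, vline (fun z => f z - g z) x a b = vline f x a b - vline g x a b).
  { intros; apply (RInt_minus (V := C_R_CompleteNormedModule)); apply ex_RInt_vline; auto. }
  unfold boundary_integral. rewrite !Hh, !Hv. ring.
Qed.

Lemma boundary_integral_bound f x1 x2 y1 y2 M : Ccontinuous f ->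
  (x1 <= x2)%R -> (y1 <= y2)%R ->
  (forall x y, (x1 <= x <= x2)%R -> (y1 <= y <= y2)%R -> (Cmod (f (x, y)) <= M)%R) ->
  (Cmod (boundary_integral f x1 x2 y1 y2) <= 2 * ((x2 - x1) + (y2 - y1)) * M)%R.
Proof.
  intros Hf Hx Hy HM.
  assert (Hh : forall y, (y1 <= y <= y2)%R -> (Cmod (hline f y x1 x2) <= (x2 - x1) * M)%R).
  { intros y Hyy. apply path_integral_bound; [apply ex_RInt_hline, Hf | exact Hx |]. auto. }
  assert (Hv : forall x, (x1 <= x <= x2)%R -> (Cmod (vline f x y1 y2) <= (y2 - y1) * M)%R).
  { intros x Hxx. apply path_integral_bound; [apply ex_RInt_vline, Hf | exact Hy |]. auto. }
  unfold boundary_integral, Cminus.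
  pose proof (Hh y1 ltac:(lra)). pose proof (Hh y2 ltac:(lra)).
  pose proof (Hv x1 ltac:(lra)). pose proof (Hv x2 ltac:(lra)).
  eapply Rle_trans; [apply Cmod_triangle |]. rewrite Cmod_opp, Cmod_mult, Cmod_Ci, Rmult_1_l.
  eapply Rle_trans; [apply Rplus_le_compat_r, Cmod_triangle |]. rewrite Cmod_opp.
  eapply Rle_trans; [apply Rplus_le_compat_r, Rplus_le_compat_r, Cmod_triangle |].
  rewrite Cmod_mult, Cmod_Ci, Rmult_1_l. lra.
Qed.

Lemma is_derive_of_eps (g : R -> C) (t : R) (l : C) :
  (forall eps, (0 < eps)%R -> exists del, (0 < del)%R /\ forall u, (Rabs (u - t) < del)%R ->
     (Cmod (g u - g t - RtoC (u - t) * l) <= eps * Rabs (u - t))%R) ->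
  is_derive (K := R_AbsRing) (V := C_R_CompleteNormedModule) g t l.
Proof.
  intros H. split; [apply is_linear_scal_l |].
  intros t' Ht' eps.
  replace t' with t by apply (is_filter_lim_locally_unique (K := R_AbsRing) (V :=
      R_NormedModule) t t' Ht').
  destruct (H eps (cond_pos eps)) as [del [Hdel Hd]].
  exists (mkposreal del Hdel). intros u Hu. specialize (Hd u Hu).
  rewrite Cmod_norm in Hd.
  replace (RtoC (u - t) * l) with (scal (V := C_R_NormedModule) (u - t)%R l) in Hd.
  2:{ destruct l as [l1 l2]; apply injective_projections;
      [change ((u - t) * l1 = (u - t) * l1 - 0 * l2)%R |
       change ((u - t) * l2 = (u - t) * l2 + 0 * l1)%R]; ring. }
  exact Hd.
Qed.

Lemma boundary_integral_derivative F f x1 x2 y1 y2 :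
  (forall z, Cderiv F z (f z)) -> Ccontinuous f -> boundary_integral f x1 x2 y1 y2 = 0.
Proof.
  intros HF Hf.
  assert (Hh : forall y a b, hline f y a b = F (b, y) - F (a, y)).
  { intros y a b. apply (is_RInt_unique (V := C_R_CompleteNormedModule)).
    apply (is_RInt_derive (V := C_R_CompleteNormedModule) (fun x => F (x, y))).
    - intros t _. apply is_derive_of_eps. intros eps Heps.
      destruct (proj1 (Cderiv_iff _ _ _) (HF (t, y)) eps Heps) as [del [Hdel H]].
      exists del; split; [exact Hdel |]. intros u Hu.
      rewrite <- (Cmod_h u t y) in Hu |- *. specialize (H _ Hu).
      replace (RtoC (u - t) * f (t, y)) with (f (t, y) * ((u, y) - (t, y))); [exact H |].
      rewrite Cmult_comm; f_equal; apply injective_projections; simpl; ring.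
    - intros t _. apply continuous_of_eps. intros eps Heps.
      destruct (Hf (t, y) eps Heps) as [del [Hdel H]]. exists del; split; [exact Hdel |].
      intros u Hu. apply H. rewrite Cmod_h. exact Hu. }
  assert (Hv : forall x a b, Ci * vline f x a b = F (x, b) - F (x, a)).
  { intros x a b.
    assert (E : vline f x a b = (- Ci * F (x, b)) - (- Ci * F (x, a))).
    { apply (is_RInt_unique (V := C_R_CompleteNormedModule)).
      apply (is_RInt_derive (V := C_R_CompleteNormedModule) (fun y => - Ci * F (x, y))).
    - intros t _. apply is_derive_of_eps. intros eps Heps.
      destruct (proj1 (Cderiv_iff _ _ _) (HF (x, t)) eps Heps) as [del [Hdel H]].
      exists del; split; [exact Hdel |]. intros u Hu.
      rewrite <- (Cmod_v x u t) in Hu |- *. specialize (H _ Hu).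
      replace (- Ci * F (x, u) - - Ci * F (x, t) - RtoC (u - t) * f (x, t)) with
        (- Ci * (F (x, u) - F (x, t) - f (x, t) * ((x, u) - (x, t)))).
      { rewrite Cmod_mult, Cmod_opp, Cmod_Ci, Rmult_1_l. exact H. }
      replace ((x, u) - (x, t)) with (Ci * RtoC (u - t))
        by (apply injective_projections; simpl; ring).
      replace (RtoC (u - t) * f (x, t)) with (- (Ci * Ci) * (RtoC (u - t) * f (x, t))).
      { ring. }
      replace (Ci * Ci) with (- (1)) by (apply injective_projections; simpl; ring). ring.
    - intros t _. apply continuous_of_eps. intros eps Heps.
      destruct (Hf (x, t) eps Heps) as [del [Hdel H]]. exists del; split; [exact Hdel |].
      intros u Hu. apply H. rewrite Cmod_v. exact Hu. }
    rewrite E.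
    replace (Ci * (- Ci * F (x, b) - - Ci * F (x, a))) with ((- (Ci * Ci)) * (F (x, b) - F (x,
        a))) by ring.
    replace (Ci * Ci) with (- (1)) by (apply injective_projections; simpl; ring). ring. }
  unfold boundary_integral. rewrite !Hh, !Hv. ring.
Qed.

Lemma boundary_integral_affine (c l p : C) x1 x2 y1 y2 :
  boundary_integral (fun z => c + l * (z - p)) x1 x2 y1 y2 = 0.
Proof.
  apply (boundary_integral_derivative (fun z => (c - l * p) * z + (l / 2) * (z * z))).
  - intros z.
    replace (c + l * (z - p)) with
      ((0 * z + (c - l * p) * 1) + (0 * (z * z) + (l / 2) * (1 * z + z * 1))) by field.
    apply (Cderiv_plus (fun z => (c - l * p) * z) (fun z => (l / 2) * (z * z))).
    + apply (Cderiv_mult (fun _ => c - l * p) (fun z => z));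
        [apply Cderiv_const | apply Cderiv_id].
    + apply (Cderiv_mult (fun _ => l / 2) (fun z => z * z)); [apply Cderiv_const |].
      apply (Cderiv_mult (fun z => z) (fun z => z)); apply Cderiv_id.
  - apply entire_continuous, entire_plus; [apply entire_const |].
    apply entire_mult; [apply entire_const |].
    apply entire_minus; [apply entire_id | apply entire_const].
Qed.

(** Goursat's theorem: near a point [f] is affine up to a relative error, so
    the boundary integral is small compared with the square of the size, and
    the sum of the squares of the sizes is preserved by quartering. *)
Lemma goursat_rectangle f x1 x2 y1 y2 : entire f -> (x1 <= x2)%R -> (y1 <= y2)%R ->
  boundary_integral f x1 x2 y1 y2 = 0.
Proof.
  intros Hf Hx Hy. pose proof (entire_continuous f Hf) as Hc.
  apply Cmod_eq_0, Rle_antisym; [| apply Cmod_ge_0].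
  set (s := (2 * ((x2 - x1) + (y2 - y1)) ^ 2)%R).
  assert (Hall : forall eps, (0 < eps)%R ->
    (Cmod (boundary_integral f x1 x2 y1 y2) <= eps * s)%R).
  { intros eps Heps. unfold s.
    apply (rectangle_bisection (fun x1 x2 y1 y2 =>
      Cmod (boundary_integral f x1 x2 y1 y2) <= eps * (2 * ((x2 - x1) + (y2 - y1)) ^ 2))%R);
          auto.
    - clear -Hc; intros x1 x2 y1 y2 _ _ H1 H2 H3 H4.
      set (xm := ((x1 + x2) / 2)%R) in *. set (ym := ((y1 + y2) / 2)%R) in *.
      replace (boundary_integral f x1 x2 y1 y2) with
        (boundary_integral f x1 xm y1 ym + boundary_integral f x1 xm ym y2 +
         boundary_integral f xm x2 y1 ym + boundary_integral f xm x2 ym y2).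
      2:{ unfold boundary_integral.
          rewrite (hline_Chasles f y1 x1 xm x2), (hline_Chasles f y2 x1 xm x2) by exact Hc.
          rewrite (vline_Chasles f x1 y1 ym y2), (vline_Chasles f x2 y1 ym y2) by exact Hc.
              ring. }
      eapply Rle_trans; [apply Cmod_triangle |].
      eapply Rle_trans; [apply Rplus_le_compat_r, Cmod_triangle |].
      eapply Rle_trans; [apply Rplus_le_compat_r, Rplus_le_compat_r, Cmod_triangle |].
      unfold xm, ym in *.
      replace (eps * (2 * (x2 - x1 + (y2 - y1)) ^ 2))%R with
       (4 * (eps * (2 * ((x2 - x1 + (y2 - y1)) / 2) ^ 2)))%R by field.
      replace ((x1 + x2) / 2 - x1 + ((y1 + y2) / 2 - y1))%R with ((x2 - x1 + (y2 - y1)) / 2)%R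
          in H1 by field.
      replace ((x1 + x2) / 2 - x1 + (y2 - (y1 + y2) / 2))%R with ((x2 - x1 + (y2 - y1)) / 2)%R
          in H2 by field.
      replace (x2 - (x1 + x2) / 2 + ((y1 + y2) / 2 - y1))%R with ((x2 - x1 + (y2 - y1)) / 2)%R
          in H3 by field.
      replace (x2 - (x1 + x2) / 2 + (y2 - (y1 + y2) / 2))%R with ((x2 - x1 + (y2 - y1)) / 2)%R
          in H4 by field.
      lra.
    - intros p q _ _. destruct (Hf (p, q)) as [l Hl].
      destruct (proj1 (Cderiv_iff _ _ _) Hl eps Heps) as [del [Hdel H]].
      exists (del / 2)%R; split; [lra |].
      intros u1 u2 v1 v2 Hp Hq Hu Hv.
      set (g := fun z => f (p, q) + l * (z - (p, q))).
      assert (Hg : Ccontinuous g).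
      { apply entire_continuous, entire_plus; [apply entire_const |].
        apply entire_mult; [apply entire_const |].
        apply entire_minus; [apply entire_id | apply entire_const]. }
      replace (boundary_integral f u1 u2 v1 v2) with
        (boundary_integral (fun z => f z - g z) u1 u2 v1 v2).
      2:{ rewrite boundary_integral_minus by assumption.
          unfold g at 1; rewrite boundary_integral_affine. ring. }
      eapply Rle_trans.
      + apply (boundary_integral_bound _ _ _ _ _ (eps * ((u2 - u1) + (v2 - v1)))%R); try lra.
        * apply entire_continuous. apply entire_minus; [exact Hf |].
          apply entire_plus; [apply entire_const |].
          apply entire_mult; [apply entire_const |].
          apply entire_minus; [apply entire_id | apply entire_const].
        * intros x y Hxx Hyy.
          assert (Hm : (Cmod ((x, y) - (p, q)) <= (u2 - u1) + (v2 - v1))%R).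
          { eapply Rle_trans; [apply Cmod_le_abs |]. simpl.
            apply Rplus_le_compat; apply Rabs_le; lra. }
          unfold g. replace (f (x, y) - (f (p, q) + l * ((x, y) - (p, q)))) with
            (f (x, y) - f (p, q) - l * ((x, y) - (p, q))) by ring.
          eapply Rle_trans; [apply H; lra |]. apply Rmult_le_compat_l; lra.
      + right; ring. }
  apply le_epsilon. intros eps Heps. rewrite Rplus_0_l.
  assert (Hs : (0 <= s)%R) by (unfold s; pose proof (pow2_ge_0 ((x2 - x1) + (y2 - y1))); lra).
  eapply Rle_trans; [apply (Hall (eps / (s + 1))%R); apply Rdiv_lt_0_compat; lra |].
  apply Rle_trans with (eps / (s + 1) * (s + 1))%R.
  - apply Rmult_le_compat_l; [apply Rlt_le, Rdiv_lt_0_compat; lra | lra].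
  - right; field; lra.
Qed.

(** * The mean value property and the maximum principle *)

Lemma exp_monotone (x y : R) : (x <= y)%R -> (exp x <= exp y)%R.
Proof.
  intros [H | ->]; [apply Rlt_le, exp_increasing, H | apply Rle_refl].
Qed.

Lemma Cexp_period (z : C) : Cexp (z + (0, 2 * PI)%R) = Cexp z.
Proof.
  unfold Cexp. destruct z as [x y]; simpl. rewrite Rplus_0_r, cos_plus, sin_plus, cos_2PI,
      sin_2PI.
  apply injective_projections; simpl; ring.
Qed.

(** In the coordinate [zeta] with [z = w + e^zeta] a circle around [w] is a
    vertical segment of length [2 PI], and the horizontal sides of a rectangle
    of that height cancel by periodicity: the integral over the circle does
    not depend on the radius, which may shrink to [0]. *)
Lemma mean_value (f : C -> C) (w : C) (x : R) : entire f ->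
  path_integral (fun t => f (w + Cexp (x, t))) 0 (2 * PI) = RtoC (2 * PI) * f w.
Proof.
  intros Hf. pose proof PI_RGT_0 as HPI.
  set (k := fun z => f (w + Cexp z)).
  assert (Hk : entire k).
  { apply (entire_comp f (fun z => w + Cexp z)); [exact Hf |]. apply entire_plus; [apply
      entire_const | apply entire_Cexp]. }
  pose proof (entire_continuous k Hk) as Hkc.
  change (vline k x 0 (2 * PI) = RtoC (2 * PI) * f w).
  assert (Hindep : forall x0, (x0 <= x)%R -> vline k x 0 (2 * PI) = vline k x0 0 (2 * PI)).
  { intros x0 Hx0. pose proof (goursat_rectangle k x0 x 0 (2 * PI) Hk Hx0 ltac:(lra)) as G.
    unfold boundary_integral in G.
    replace (hline k (2 * PI) x0 x) with (hline k 0 x0 x) in G.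
    2:{ apply (RInt_ext (V := C_R_CompleteNormedModule)). intros t _. unfold k.
        rewrite <- (Cexp_period (t, 0%R)). f_equal. f_equal. f_equal.
        apply injective_projections; simpl; ring. }
    assert (G' : Ci * (vline k x 0 (2 * PI) - vline k x0 0 (2 * PI)) = 0)
      by (rewrite <- G; ring).
    replace (vline k x 0 (2 * PI)) with
      (- Ci * (Ci * (vline k x 0 (2 * PI) - vline k x0 0 (2 * PI))) + vline k x0 0 (2 * PI)).
    - rewrite G'; ring.
    - replace (- Ci * (Ci * (vline k x 0 (2 * PI) - vline k x0 0 (2 * PI)))) with
        ((- (Ci * Ci)) * (vline k x 0 (2 * PI) - vline k x0 0 (2 * PI))) by ring.
      replace (Ci * Ci) with (- (1)) by (apply injective_projections; simpl; ring). ring. }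
  replace (vline k x 0 (2 * PI)) with
    ((vline k x 0 (2 * PI) - RtoC (2 * PI) * f w) + RtoC (2 * PI) * f w) by ring.
  replace (vline k x 0 (2 * PI) - RtoC (2 * PI) * f w) with (RtoC 0); [ring |].
  symmetry; apply Cmod_eq_0, Rle_antisym; [| apply Cmod_ge_0].
  apply le_epsilon. intros eps Heps. rewrite Rplus_0_l.
  destruct (entire_continuous f Hf w (eps / (2 * PI))%R) as [del [Hdel H]].
  { apply Rdiv_lt_0_compat; lra. }
  set (x0 := Rmin x (ln (del / 2))).
  rewrite (Hindep x0) by apply Rmin_l.
  replace (vline k x0 0 (2 * PI) - RtoC (2 * PI) * f w) with
    (path_integral (fun t => k (x0, t) - f w) 0 (2 * PI)).
  2:{ unfold path_integral.
      rewrite (RInt_minus (V := C_R_CompleteNormedModule) (fun t => k (x0, t)) (fun _ => f w)).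
      - rewrite (RInt_const (V := C_R_CompleteNormedModule)). unfold vline, path_integral.
        unfold minus. change plus with Cplus. change opp with Copp. unfold Cminus. f_equal.
            f_equal.
        destruct (f w) as [l1 l2]; apply injective_projections;
          [change ((2 * PI - 0) * l1 = (2 * PI) * l1 - 0 * l2)%R |
           change ((2 * PI - 0) * l2 = (2 * PI) * l2 + 0 * l1)%R]; ring.
      - apply ex_RInt_vline, Hkc.
      - apply (ex_RInt_const (V := C_R_CompleteNormedModule)). }
  replace eps with ((2 * PI - 0) * (eps / (2 * PI)))%R by (field; lra).
  apply path_integral_bound; [| lra |].
  - apply (ex_RInt_vline (fun z => k z - f w)). apply entire_continuous.
    apply entire_minus; [exact Hk | apply entire_const].
  - intros t _. apply Rlt_le, H.
    replace (w + Cexp (x0, t) - w) with (Cexp (x0, t)) by ring.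
    rewrite Cmod_Cexp; simpl. apply Rle_lt_trans with (del / 2)%R; [|lra].
    rewrite <- (exp_ln (del / 2)) by lra. apply exp_monotone, Rmin_r.
Qed.

Lemma continuous_2d_Cmod (f : C -> C) :
  Ccontinuous f -> continuous_2d (fun x y => Cmod (f (x, y))).
Proof.
  intros Hf p q eps Heps. destruct (Hf (p, q) eps Heps) as [del [Hdel H]].
  exists (del / 2)%R; split; [lra |]. intros x y Hx Hy.
  apply Rle_lt_trans with (Cmod (f (x, y) - f (p, q))).
  - apply Rabs_le.
    pose proof (Cmod_triangle (f (x, y) - f (p, q)) (f (p, q))) as T1.
    pose proof (Cmod_triangle (f (p, q) - f (x, y)) (f (x, y))) as T2.
    replace (f (x, y) - f (p, q) + f (p, q)) with (f (x, y)) in T1 by ring.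
    replace (f (p, q) - f (x, y) + f (x, y)) with (f (p, q)) in T2 by ring.
    assert (E : Cmod (f (p, q) - f (x, y)) = Cmod (f (x, y) - f (p, q))).
    { rewrite <- Cmod_opp. f_equal; ring. }
    rewrite E in T2. lra.
  - apply H. eapply Rle_lt_trans; [apply Cmod_le_abs |].
    simpl. unfold Rminus in *. lra.
Qed.

Lemma Cmod_square (x y : R) : Cmod ((x, y) * (x, y)) = (x * x + y * y)%R.
Proof.
  rewrite Cmod_mult. pose proof (Cmod2_alt (x, y)) as H. simpl in H.
  rewrite !Rmult_1_r in H. exact H.
Qed.

Lemma is_RInt_trig (A B D : R) :
  is_RInt (fun t => A + B * cos t + D * sin t)%R 0 (2 * PI) (2 * PI * A)%R.
Proof.
  replace (2 * PI * A)%R with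
    (minus (A * (2 * PI) + B * sin (2 * PI) - D * cos (2 * PI))%R
           (A * 0 + B * sin 0 - D * cos 0)%R).
  - apply (is_RInt_derive (fun t => A * t + B * sin t - D * cos t)%R).
    + intros t _. auto_derive; [exact I | ring].
    + intros t _. apply (ex_derive_continuous (K := R_AbsRing) (V := R_NormedModule)).
      auto_derive; exact I.
  - rewrite sin_2PI, cos_2PI, sin_0, cos_0. unfold minus, plus, opp; simpl. ring.
Qed.

(** The average of [|f| + eps |z|^2] over a circle exceeds its value at the
    centre, so this function has no interior maximum. *)
Lemma max_modulus_rectangle (f : C -> C) (a b c d M : R) :
  entire f -> (a <= b)%R -> (c <= d)%R ->
  (forall x y, (a <= x <= b)%R -> (c <= y <= d)%R ->
     x = a \/ x = b \/ y = c \/ y = d -> (Cmod (f (x, y)) <= M)%R) ->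
  forall x y, (a <= x <= b)%R -> (c <= y <= d)%R -> (Cmod (f (x, y)) <= M)%R.
Proof.
  intros Hf Hab Hcd HM x y Hx Hy.
  destruct (rectangle_attains_max (fun x y => Cmod ((x, y) * (x, y))) a b c d)
    as [p [q [_ [_ HD]]]]; auto.
  { apply (continuous_2d_Cmod (fun z => z * z)), entire_continuous.
    apply entire_mult; apply entire_id. }
  set (D := Cmod ((p, q) * (p, q))) in *.
  assert (HD0 : (0 <= D)%R) by apply Cmod_ge_0.
  assert (Hall : forall eps, (0 < eps)%R -> (Cmod (f (x, y)) <= M + eps * D)%R).
  { intros eps Heps.
    set (phi := fun x y : R => (Cmod (f (x, y)) + Cmod (RtoC eps * ((x, y) * (x, y))))%R).
    assert (Hphi : forall x y, phi x y = (Cmod (f (x, y)) + eps * Cmod ((x, y) * (x, y)))%R).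
    { intros x1 y1. unfold phi. rewrite (Cmod_mult eps), Cmod_R, (Rabs_pos_eq eps) by lra.
        reflexivity. }
    assert (Hcphi : continuous_2d phi).
    { intros p1 q1 e He.
      destruct (continuous_2d_Cmod f (entire_continuous f Hf) p1 q1 (e / 2)%R ltac:(lra)) as
          [d1 [Hd1 H1]].
      destruct (continuous_2d_Cmod (fun z => RtoC eps * (z * z))
        ltac:(apply entire_continuous, entire_mult; [apply entire_const | apply entire_mult;
            apply entire_id])
        p1 q1 (e / 2)%R ltac:(lra)) as [d2 [Hd2 H2]].
      exists (Rmin d1 d2); split; [apply Rmin_pos; assumption |]. intros x1 y1 Hx1 Hy1.
      specialize (H1 x1 y1 (Rlt_le_trans _ _ _ Hx1 (Rmin_l _ _)) (Rlt_le_trans _ _ _ Hy1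
          (Rmin_l _ _))).
      specialize (H2 x1 y1 (Rlt_le_trans _ _ _ Hx1 (Rmin_r _ _)) (Rlt_le_trans _ _ _ Hy1
          (Rmin_r _ _))).
      unfold phi. apply Rabs_def2 in H1. apply Rabs_def2 in H2. apply Rabs_def1; lra. }
    destruct (rectangle_attains_max phi a b c d Hcphi Hab Hcd) as [x0 [y0 [Hx0 [Hy0 Hm]]]].
    assert (Hb : x0 = a \/ x0 = b \/ y0 = c \/ y0 = d).
    { apply NNPP; intros Hint.
      assert (Hx0' : (a < x0 < b)%R).
      { split; apply Rnot_le_lt; intros Hle; apply Hint; [left | right; left]; lra. }
      assert (Hy0' : (c < y0 < d)%R).
      { split; apply Rnot_le_lt; intros Hle; apply Hint; right; right; [left | right]; lra. }
      set (r := Rmin (Rmin (x0 - a) (b - x0)) (Rmin (y0 - c) (d - y0))).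
      assert (Hr : (0 < r)%R) by (unfold r; apply Rmin_pos; apply Rmin_pos; lra).
      assert (Hr' : (r <= x0 - a /\ r <= b - x0 /\ r <= y0 - c /\ r <= d - y0)%R).
      { unfold r; pose proof (Rmin_l (Rmin (x0 - a) (b - x0)) (Rmin (y0 - c) (d - y0)));
        pose proof (Rmin_r (Rmin (x0 - a) (b - x0)) (Rmin (y0 - c) (d - y0)));
        pose proof (Rmin_l (x0 - a) (b - x0)); pose proof (Rmin_r (x0 - a) (b - x0));
        pose proof (Rmin_l (y0 - c) (d - y0)); pose proof (Rmin_r (y0 - c) (d - y0)); lra. }
      pose proof PI_RGT_0 as HPI.
      set (A := (Cmod (f (x0, y0)) - eps * r * r)%R).
      assert (HI : (Cmod (path_integral (fun t => f ((x0, y0) + Cexp (ln r, t))%C) 0 (2 * PI))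
        <= 2 * PI * A)%R).
      { rewrite Cmod_norm.
        apply (norm_RInt_le (V := C_R_NormedModule) (fun t => f ((x0, y0) + Cexp (ln r, t)))
          (fun t => A + (- 2 * eps * r * x0) * cos t + (- 2 * eps * r * y0) * sin t)%R
          0 (2 * PI)); [lra | | | apply is_RInt_trig].
        - intros t _. rewrite <- Cmod_norm.
          unfold Cexp; simpl Re; simpl Im. rewrite exp_ln by exact Hr.
          change (((x0, y0) : C) + (((r * cos t)%R, (r * sin t)%R) : C))%C with ((x0 + r * cos
              t)%R, (y0 + r * sin t)%R).
          pose proof (COS_bound t). pose proof (SIN_bound t).
          assert (Hc1 : (- r <= r * cos t <= r)%R) by nra.
          assert (Hs1 : (- r <= r * sin t <= r)%R) by nra.
          specialize (Hm (x0 + r * cos t)%R (y0 + r * sin t)%R ltac:(lra) ltac:(lra)).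
          rewrite !Hphi, !Cmod_square in Hm. unfold A.
          pose proof (sin2_cos2 t) as Hsc. unfold Rsqr in Hsc.
          assert (E : (eps * ((x0 + r * cos t) * (x0 + r * cos t) + (y0 + r * sin t) * (y0 + r
              * sin t)) =
            eps * (x0 * x0 + y0 * y0) + eps * r * r * (sin t * sin t + cos t * cos t)
            + 2 * eps * r * x0 * cos t + 2 * eps * r * y0 * sin t)%R) by ring.
          rewrite Hsc in E. lra.
        - apply (RInt_correct (V := C_R_CompleteNormedModule)).
          apply (ex_RInt_vline (fun z => f ((x0, y0) + Cexp z))). apply entire_continuous.
          apply (entire_comp f (fun z => (x0, y0) + Cexp z)); [exact Hf |].
          apply entire_plus; [apply entire_const | apply entire_Cexp]. }
      rewrite mean_value in HI by exact Hf.
      rewrite Cmod_mult, Cmod_R, Rabs_pos_eq in HI by lra.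
      apply Rmult_le_reg_l in HI; [|lra]. unfold A in HI.
      assert (0 < eps * r * r)%R by (repeat apply Rmult_lt_0_compat; assumption). lra. }
    specialize (HM x0 y0 Hx0 Hy0 Hb).
    specialize (Hm x y Hx Hy). rewrite !Hphi in Hm.
    pose proof (HD x0 y0 Hx0 Hy0). pose proof (Cmod_ge_0 ((x, y) * (x, y))).
    assert (eps * Cmod ((x0, y0) * (x0, y0)) <= eps * D)%R by (apply Rmult_le_compat_l; lra).
    assert (0 <= eps * Cmod ((x, y) * (x, y)))%R by (apply Rmult_le_pos; lra). lra. }
  apply le_epsilon. intros eps Heps.
  eapply Rle_trans; [apply (Hall (eps / (D + 1))%R); apply Rdiv_lt_0_compat; lra |].
  apply Rplus_le_compat_l. apply Rle_trans with (eps / (D + 1) * (D + 1))%R.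
  - apply Rmult_le_compat_l; [apply Rlt_le, Rdiv_lt_0_compat; lra | lra].
  - right; field; lra.
Qed.

(** * The theorems of Phragmen and Lindelof and of Liouville *)

(** Removes a regularising factor in the limit [eps -> 0]. *)
Lemma le_of_exp_factor (u B E : R) : (0 < B)%R -> (0 <= E)%R ->
  (forall eps, (0 < eps)%R -> (u <= B * exp (eps * E))%R) -> (u <= B)%R.
Proof.
  intros HB HE H. apply Rnot_lt_le; intros Hlt.
  set (L := ln (u / B)).
  assert (HL : (0 < L)%R).
  { unfold L. rewrite <- ln_1. apply ln_increasing; [lra |].
    apply (Rmult_lt_reg_r B); [lra |]. unfold Rdiv. rewrite Rmult_assoc, Rinv_l; lra. }
  assert (Hu : u = (B * exp L)%R).
  { unfold L. rewrite exp_ln; [field; lra | apply Rdiv_lt_0_compat; lra]. }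
  specialize (H (L / (2 * (E + 1)))%R ltac:(apply Rdiv_lt_0_compat; lra)).
  rewrite Hu in H. apply Rmult_le_reg_l in H; [|lra].
  assert (exp (L / (2 * (E + 1)) * E) < exp L)%R; [|lra].
  apply exp_increasing.
  assert (L / (2 * (E + 1)) * (2 * (E + 1)) = L)%R by (field; lra).
  assert (0 < L / (2 * (E + 1)))%R by (apply Rdiv_lt_0_compat; lra). nra.
Qed.

Lemma exp_ge_self (x : R) : (x <= exp x)%R.
Proof. pose proof (exp_ineq1_le x). lra. Qed.

(** Phragmen and Lindelof: the factor [exp(-eps e^(rho zeta))], centred in the
    strip, beats the growth of [h] because [m < rho], and stays below [1]
    because [rho (d - c) < PI] keeps the real part of [e^(rho zeta)] positive. *)
Lemma phragmen_lindelof_strip (h : C -> C) (c d m A B X0 : R) :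
  entire h -> (c < d)%R -> (0 < m)%R -> (m * (d - c) < PI)%R -> (0 < B)%R ->
  (forall x y, (X0 <= x)%R -> (c <= y <= d)%R -> (Cmod (h (x, y)) <= A * exp (exp (m * x)))%R)
      ->
  (forall x y, (X0 <= x)%R -> (c <= y <= d)%R -> x = X0 \/ y = c \/ y = d ->
     (Cmod (h (x, y)) <= B)%R) ->
  forall x y, (X0 <= x)%R -> (c <= y <= d)%R -> (Cmod (h (x, y)) <= B)%R.
Proof.
  intros Hh Hcd Hm Hmd HB Hgrow Hbd x y Hx Hy.
  set (rho := ((m + PI / (d - c)) / 2)%R).
  assert (Hq : (PI / (d - c) * (d - c) = PI)%R) by (field; lra).
  assert (Hm2 : (m < PI / (d - c))%R).
  { apply (Rmult_lt_reg_r (d - c)); lra. }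
  assert (Hrho : (m < rho)%R) by (unfold rho; lra).
  assert (Hrho2 : (rho * (d - c) < PI)%R) by (unfold rho; nra).
  set (y0 := ((c + d) / 2)%R).
  set (kap := cos (rho * (d - c) / 2)).
  assert (Hkap : (0 < kap)%R).
  { apply cos_gt_0; [| lra]. assert (0 < rho * (d - c))%R by (apply Rmult_lt_0_compat; lra).
      lra. }
  assert (Hcos : forall v, (c <= v <= d)%R -> (kap <= cos (rho * (v - y0)))%R).
  { intros v Hv. unfold kap.
    assert (Hv' : (Rabs (rho * (v - y0)) <= rho * (d - c) / 2)%R).
    { rewrite Rabs_mult, (Rabs_pos_eq rho) by lra.
      replace (rho * (d - c) / 2)%R with (rho * ((d - c) / 2))%R by field.
      apply Rmult_le_compat_l; [lra |]. apply Rabs_le; unfold y0; lra. }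
    assert (E : cos (rho * (v - y0)) = cos (Rabs (rho * (v - y0)))).
    { unfold Rabs; destruct (Rcase_abs _); [rewrite cos_neg |]; reflexivity. }
    rewrite E. pose proof (Rabs_pos (rho * (v - y0))).
    destruct (Req_dec (Rabs (rho * (v - y0))) (rho * (d - c) / 2)) as [<-|Hne]; [lra |].
    apply Rlt_le, cos_decreasing_1; lra. }
  apply (le_of_exp_factor _ B (exp (rho * x))); [exact HB | apply Rlt_le, exp_pos |].
  intros eps Heps.
  set (g := fun z => h z * Cexp (- RtoC eps * Cexp (RtoC rho * (z - (0, y0)%R)))).
  assert (Hg : entire g).
  { apply entire_mult; [exact Hh |].
    apply (entire_comp Cexp (fun z => - RtoC eps * Cexp (RtoC rho * (z - (0, y0)%R)))); [apply
        entire_Cexp |].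
    apply entire_mult; [apply entire_const |].
    apply (entire_comp Cexp (fun z => RtoC rho * (z - (0, y0)%R))); [apply entire_Cexp |].
    apply entire_mult; [apply entire_const |].
    apply entire_minus; [apply entire_id | apply entire_const]. }
  assert (Hgm : forall u v, Cmod (g (u, v)) =
    (Cmod (h (u, v)) * exp (- (eps * (exp (rho * u) * cos (rho * (v - y0))))))%R).
  { intros u v. unfold g. rewrite Cmod_mult, Cmod_Cexp. f_equal. f_equal.
    replace (RtoC rho * ((u, v) - (0, y0)%R)) with ((rho * u)%R, (rho * (v - y0))%R)
      by (apply injective_projections; simpl; ring).
    unfold Cexp; simpl. ring. }
  assert (Hg1 : forall u v, (c <= v <= d)%R ->
    (Cmod (g (u, v)) <= Cmod (h (u, v)) * exp (- (eps * kap * exp (rho * u))))%R).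
  { intros u v Hv. rewrite Hgm. apply Rmult_le_compat_l; [apply Cmod_ge_0 |].
    apply exp_monotone. specialize (Hcos v Hv). pose proof (exp_pos (rho * u)).
    assert (eps * kap * exp (rho * u) <= eps * (exp (rho * u) * cos (rho * (v - y0))))%R;
        [|lra].
    replace (eps * kap * exp (rho * u))%R with (eps * exp (rho * u) * kap)%R by ring.
    replace (eps * (exp (rho * u) * cos (rho * (v - y0))))%R with
      (eps * exp (rho * u) * cos (rho * (v - y0)))%R by ring.
    apply Rmult_le_compat_l; [|lra]. apply Rmult_le_pos; lra. }
  assert (Hg2 : forall u v, (c <= v <= d)%R -> (Cmod (g (u, v)) <= Cmod (h (u, v)))%R).
  { intros u v Hv. eapply Rle_trans; [apply Hg1, Hv |].
    rewrite <- Rmult_1_r. apply Rmult_le_compat_l; [apply Cmod_ge_0 |].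
    rewrite <- exp_0. apply exp_monotone.
    assert (0 < eps * kap * exp (rho * u))%R; [|lra].
    repeat apply Rmult_lt_0_compat; auto using exp_pos. }
  assert (Hek : (0 < eps * kap * (rho - m))%R) by (repeat apply Rmult_lt_0_compat; lra).
  set (X := Rmax x (Rmax (2 / (eps * kap * (rho - m))) (A / (B * m)))).
  assert (HX : (x <= X)%R) by apply Rmax_l.
  assert (HX1 : (2 / (eps * kap * (rho - m)) <= X)%R)
    by (eapply Rle_trans; [apply Rmax_l | apply Rmax_r]).
  assert (HX2 : (A / (B * m) <= X)%R)
    by (eapply Rle_trans; [apply Rmax_r | apply Rmax_r]).
  assert (HgB : (Cmod (g (x, y)) <= B)%R).
  { apply (max_modulus_rectangle g X0 X c d B Hg); try lra.
    intros u v Hu Hv Hside.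
    destruct (Req_dec u X) as [->|HuX].
    2:{ eapply Rle_trans; [apply Hg2, Hv |]. apply Hbd; tauto. }
    eapply Rle_trans; [apply Hg1, Hv |].
    eapply Rle_trans; [apply Rmult_le_compat_r; [apply Rlt_le, exp_pos | apply Hgrow; tauto] |].
    rewrite Rmult_assoc, <- exp_plus.
    set (T := exp (m * X)).
    assert (HT : (0 < T)%R) by apply exp_pos.
    assert (H2T : (2 * T <= eps * kap * exp (rho * X))%R).
    { replace (rho * X)%R with ((rho - m) * X + m * X)%R by ring. rewrite exp_plus. fold T.
      assert (2 <= eps * kap * exp ((rho - m) * X))%R; [|nra].
      pose proof (exp_ge_self ((rho - m) * X)).
      assert (0 < eps * kap)%R by (apply Rmult_lt_0_compat; lra).
      apply Rle_trans with (eps * kap * ((rho - m) * X))%R; [|apply Rmult_le_compat_l; lra].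
      apply (Rmult_le_compat_l (eps * kap * (rho - m))) in HX1; [|lra].
      replace (eps * kap * (rho - m) * (2 / (eps * kap * (rho - m))))%R with 2%R in HX1 by
          (field; lra).
      lra. }
    assert (HAB : (A <= B * exp T)%R).
    { apply (Rmult_le_compat_l (B * m)) in HX2; [|apply Rmult_le_pos; lra].
      replace (B * m * (A / (B * m)))%R with A in HX2 by (field; lra).
      eapply Rle_trans; [apply HX2 |]. rewrite Rmult_assoc. apply Rmult_le_compat_l; [lra |].
      eapply Rle_trans; [apply exp_ge_self |]. apply exp_ge_self. }
    destruct (Rle_dec A 0) as [HA|HA].
    { apply Rle_trans with 0%R; [|lra].
      pose proof (exp_pos (T + - (eps * kap * exp (rho * X)))). nra. }
    apply Rle_trans with (A * exp (- T))%R.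
    { apply Rmult_le_compat_l; [lra |]. apply exp_monotone; lra. }
    apply Rle_trans with (B * exp T * exp (- T))%R.
    { apply Rmult_le_compat_r; [apply Rlt_le, exp_pos | exact HAB]. }
    rewrite Rmult_assoc, <- exp_plus, Rplus_opp_r, exp_0. lra. }
  rewrite Hgm in HgB.
  set (E1 := (eps * (exp (rho * x) * cos (rho * (y - y0))))%R) in *.
  assert (HE1 : (E1 <= eps * exp (rho * x))%R).
  { unfold E1. apply Rmult_le_compat_l; [lra |].
    pose proof (COS_bound (rho * (y - y0))). pose proof (exp_pos (rho * x)). nra. }
  apply Rle_trans with (B * exp E1)%R.
  2:{ apply Rmult_le_compat_l; [lra | apply exp_monotone, HE1]. }
  apply (Rmult_le_compat_r (exp E1)) in HgB; [|apply Rlt_le, exp_pos].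
  rewrite Rmult_assoc, <- exp_plus, Rplus_opp_l, exp_0, Rmult_1_r in HgB. exact HgB.
Qed.

Lemma polar_form (z : C) (a : R) : z <> 0 ->
  exists y, (a <= y <= a + 2 * PI)%R /\ z = Cexp (ln (Cmod z), y).
Proof.
  intros Hz. pose proof (proj1 (Cmod_gt_0 z) Hz) as Hr. pose proof PI_RGT_0 as HPI.
  (* rotating by -(a + PI) brings the argument into [-PI, PI], where acos finds it *)
  set (w := z * Cexp (0, - (a + PI))%R).
  assert (Hw : Cmod w = Cmod z).
  { unfold w. rewrite Cmod_mult, Cmod_Cexp; simpl. rewrite exp_0; ring. }
  assert (Hw2 : (Re w * Re w + Im w * Im w = Cmod z * Cmod z)%R).
  { pose proof (Cmod2_alt w) as E. rewrite Hw in E. lra. }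
  set (r := Cmod z) in *.
  set (q := (Re w / r)%R).
  assert (Hq : (-1 <= q <= 1)%R).
  { assert (Hre : (Rabs (Re w) <= r)%R) by (rewrite <- Hw; apply re_le_Cmod).
    apply Rabs_le_between in Hre. unfold q.
    split; apply (Rmult_le_reg_r r); try lra; unfold Rdiv; rewrite Rmult_assoc, Rinv_l; lra. }
  pose proof (acos_bound q) as Hac.
  assert (Hcs : exists t, (- PI <= t <= PI)%R /\ (r * cos t = Re w)%R /\ (r * sin t = Im w)%R).
  { assert (Hc : (r * cos (acos q) = Re w)%R) by (rewrite cos_acos by exact Hq; unfold q;
      field; lra).
    assert (Hs : (r * sin (acos q) = Rabs (Im w))%R).
    { rewrite sin_acos by exact Hq. rewrite <- (sqrt_Rsqr r) at 1 by lra.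
      rewrite <- sqrt_mult; [| apply Rle_0_sqr | unfold Rsqr; nra].
      rewrite <- sqrt_Rsqr_abs. f_equal. unfold Rsqr, q.
      replace (r * r * (1 - Re w / r * (Re w / r)))%R with (r * r - Re w * Re w)%R by (field;
          lra).
      lra. }
    destruct (Rle_dec 0 (Im w)) as [Hi|Hi].
    - exists (acos q); rewrite (Rabs_pos_eq _ Hi) in Hs; repeat split; lra.
    - exists (- acos q)%R; rewrite Rabs_left in Hs by lra. rewrite cos_neg, sin_neg.
      repeat split; lra. }
  destruct Hcs as [t [Ht [Hc Hs]]].
  exists (t + (a + PI))%R; split; [lra |].
  replace z with (w * Cexp (0, a + PI)%R).
  - replace (ln r, t + (a + PI))%R with (((ln r, t) : C) + ((0, a + PI)%R : C))%C
      by (apply injective_projections; simpl; ring).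
    rewrite Cexp_plus. f_equal. symmetry. unfold Cexp; simpl. rewrite exp_ln by exact Hr.
    apply injective_projections; [exact Hc | exact Hs].
  - unfold w. rewrite <- Cmult_assoc, <- Cexp_plus.
    replace (((0, - (a + PI))%R : C) + ((0, a + PI)%R : C))%C with (RtoC 0)
      by (apply injective_projections; simpl; ring).
    rewrite Cexp_0; ring.
Qed.

Lemma entire_bounded_on_disc (f : C -> C) (r : R) : entire f ->
  exists B, forall z, (Cmod z <= r)%R -> (Cmod (f z) <= B)%R.
Proof.
  intros Hf. destruct (Rle_dec 0 r) as [Hr|Hr].
  - destruct (rectangle_attains_max (fun x y => Cmod (f (x, y))) (- r) r (- r) r)
      as [p [q [_ [_ H]]]]; try lra.
    { apply continuous_2d_Cmod, entire_continuous, Hf. }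
    exists (Cmod (f (p, q))). intros [x y] Hz.
    pose proof (re_le_Cmod (x, y)) as Hx. pose proof (im_le_Cmod (x, y)) as Hy. simpl in Hx, Hy.
    apply Rabs_le_between in Hx. apply Rabs_le_between in Hy. apply H; lra.
  - exists 0%R. intros z Hz. pose proof (Cmod_ge_0 z). lra.
Qed.

(** Liouville.  In the coordinate [zeta] with [z = e^zeta] the function
    [(f z - f 0) / sqrt z] becomes entire; it tends to [0] at both ends
    [Re zeta -> -oo] and [Re zeta -> +oo], and the factor [exp(eps zeta^2)]
    makes it small at the other two sides of a rectangle. *)
Lemma liouville (f : C -> C) (r B : R) : entire f ->
  (forall z, (r < Cmod z)%R -> (Cmod (f z) <= B)%R) -> forall z, f z = f 0.
Proof.
  intros Hf Hout.
  assert (Hbd : exists B', (0 < B')%R /\ forall z, (Cmod (f z) <= B')%R).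
  { destruct (entire_bounded_on_disc f r Hf) as [B1 HB1].
    exists (Rmax 1 (Rmax B B1)). split.
    - eapply Rlt_le_trans; [|apply Rmax_l]; lra.
    - intros z. destruct (Rle_dec (Cmod z) r) as [Hz|Hz].
      + eapply Rle_trans; [apply HB1, Hz |]. eapply Rle_trans; [apply Rmax_r | apply Rmax_r].
      + eapply Rle_trans; [apply Hout; lra |]. eapply Rle_trans; [apply Rmax_l | apply Rmax_r].
          }
  clear B r Hout. destruct Hbd as [B [HB Hall]].
  set (k := fun z => (f (Cexp z) - f 0) * Cexp (- RtoC (/ 2) * z)).
  assert (Hk : entire k).
  { apply entire_mult.
    - apply entire_minus; [apply (entire_comp f Cexp Hf entire_Cexp) | apply entire_const].
    - apply (entire_comp Cexp (fun z => - RtoC (/ 2) * z)); [apply entire_Cexp |].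
      apply entire_mult; [apply entire_const | apply entire_id]. }
  assert (Hkm : forall x y, Cmod (k (x, y)) = (Cmod (f (Cexp (x, y)) - f 0) * exp (- (x /
      2)))%R).
  { intros x y. unfold k. rewrite Cmod_mult, Cmod_Cexp. f_equal. f_equal. simpl. field. }
  assert (Hd : forall z, (Cmod (f z - f 0) <= 2 * B)%R).
  { intros z. unfold Cminus. eapply Rle_trans; [apply Cmod_triangle |]. rewrite Cmod_opp.
    pose proof (Hall z). pose proof (Hall 0). lra. }
  assert (Hends : forall eta, (0 < eta)%R -> exists X1, forall X, (X1 <= X)%R ->
    forall y, (Cmod (k (X, y)) <= eta)%R /\ (Cmod (k ((- X)%R, y)) <= eta)%R).
  { intros eta Heta. destruct (Hf 0) as [l Hl].
    destruct (proj1 (Cderiv_iff f 0 l) Hl 1%R ltac:(lra)) as [del [Hdel H]].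
    pose proof (Cmod_ge_0 l) as Hl0.
    assert (Hsmall : forall C0 X, (0 <= C0)%R -> (2 * C0 / eta <= X)%R -> (C0 * exp (- (X / 2))
        <= eta)%R).
    { intros C0 X HC0 HX.
      apply (Rmult_le_reg_r (exp (X / 2))); [apply exp_pos |].
      rewrite Rmult_assoc, <- exp_plus, Rplus_opp_l, exp_0, Rmult_1_r.
      apply (Rmult_le_compat_l (eta / 2)) in HX; [|lra].
      replace (eta / 2 * (2 * C0 / eta))%R with C0 in HX by (field; lra).
      pose proof (exp_ge_self (X / 2)). nra. }
    exists (Rmax (2 * (2 * B) / eta) (Rmax (2 * (Cmod l + 1) / eta) (- ln (del / 2)))).
    intros X HX y.
    assert (HX' := Rle_trans _ _ _ (Rmax_r _ _) HX).
    assert (HX1 := Rle_trans _ _ _ (Rmax_l _ _) HX).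
    assert (HX2 := Rle_trans _ _ _ (Rmax_l _ _) HX').
    assert (HX3 := Rle_trans _ _ _ (Rmax_r _ _) HX').
    split; rewrite Hkm.
    - eapply Rle_trans; [apply Rmult_le_compat_r; [apply Rlt_le, exp_pos | apply Hd] |].
      apply Hsmall; lra.
    - assert (HC : (Cmod (Cexp ((- X)%R, y)) < del)%R).
      { rewrite Cmod_Cexp. simpl. apply Rle_lt_trans with (del / 2)%R; [|lra].
        rewrite <- (exp_ln (del / 2)) by lra. apply exp_monotone; lra. }
      set (w := Cexp ((- X)%R, y)) in *.
      assert (E0 : w - 0 = w) by ring.
      specialize (H w). rewrite E0 in H. specialize (H HC).
      assert (Hw : (Cmod (f w - f 0) <= (Cmod l + 1) * Cmod w)%R).
      { replace (f w - f 0) with ((f w - f 0 - l * w) + l * w) by ring.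
        eapply Rle_trans; [apply Cmod_triangle |]. rewrite Cmod_mult. lra. }
      unfold w in Hw at 2. rewrite Cmod_Cexp in Hw. simpl in Hw.
      eapply Rle_trans; [apply Rmult_le_compat_r; [apply Rlt_le, exp_pos | apply Hw] |].
      rewrite Rmult_assoc, <- exp_plus. replace (- X + - (- X / 2))%R with (- (X / 2))%R by
          field.
      apply Hsmall; lra. }
  assert (Hk0 : forall x y, k (x, y) = 0).
  { intros x y. apply Cmod_eq_0, Rle_antisym; [| apply Cmod_ge_0].
    apply le_epsilon. intros eta Heta. rewrite Rplus_0_l.
    destruct (Hends eta Heta) as [X1 HX1].
    set (X := Rmax X1 (Rabs x)).
    specialize (HX1 X ltac:(apply Rmax_l)).
    assert (HxX : (- X <= x <= X)%R).
    { apply Rabs_le_between. apply Rmax_r. }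
    apply (le_of_exp_factor _ eta (X * X - x * x + y * y)); [exact Heta | nra |].
    intros eps Heps.
    set (g := fun z => k z * Cexp (RtoC eps * (z * z))).
    assert (Hg : entire g).
    { apply entire_mult; [exact Hk |].
      apply (entire_comp Cexp (fun z => RtoC eps * (z * z))); [apply entire_Cexp |].
      apply entire_mult; [apply entire_const | apply entire_mult; apply entire_id]. }
    assert (Hgm : forall u v, Cmod (g (u, v)) = (Cmod (k (u, v)) * exp (eps * (u * u - v *
        v)))%R).
    { intros u v. unfold g. rewrite Cmod_mult, Cmod_Cexp. f_equal. f_equal. simpl. ring. }
    set (C0 := (2 * B * exp (X / 2))%R).
    assert (HC0 : (0 < C0)%R) by (unfold C0; pose proof (exp_pos (X / 2)); nra).
    set (Y := Rmax (Rabs y) (Rmax 1 (/ eps * (C0 / eta)))).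
    assert (HyY : (- Y <= y <= Y)%R) by (apply Rabs_le_between, Rmax_l).
    assert (HY1 : (1 <= Y)%R) by (eapply Rle_trans; [apply Rmax_l | apply Rmax_r]).
    assert (HY2 : (C0 <= eta * exp (eps * (Y * Y)))%R).
    { assert (HY2 : (/ eps * (C0 / eta) <= Y)%R) by (eapply Rle_trans; [apply Rmax_r | apply
        Rmax_r]).
      apply (Rmult_le_compat_l (eps * eta)) in HY2; [|apply Rmult_le_pos; lra].
      replace (eps * eta * (/ eps * (C0 / eta)))%R with C0 in HY2 by (field; lra).
      eapply Rle_trans; [apply HY2 |]. replace (eps * eta * Y)%R with (eta * (eps * Y))%R by
          ring.
      apply Rmult_le_compat_l; [lra |]. eapply Rle_trans; [|apply exp_ge_self].
      apply Rmult_le_compat_l; [lra | nra]. }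
    assert (HgB : (Cmod (g (x, y)) <= eta * exp (eps * (X * X)))%R).
    { apply (max_modulus_rectangle g (- X) X (- Y) Y); try lra; auto.
      intros u v Hu Hv Hside. rewrite Hgm.
      assert (Hvert : (u = X \/ u = - X)%R -> (Cmod (k (u, v)) * exp (eps * (u * u - v * v)) <=
        eta * exp (eps * (X * X)))%R).
      { intros Hux. apply Rmult_le_compat; [apply Cmod_ge_0 | apply Rlt_le, exp_pos | |].
        - destruct Hux as [-> | ->]; apply HX1.
        - apply exp_monotone, Rmult_le_compat_l; [lra |]. destruct Hux as [-> | ->]; nra. }
      assert (Hhor : (v * v = Y * Y)%R -> (Cmod (k (u, v)) * exp (eps * (u * u - v * v)) <=
        eta * exp (eps * (X * X)))%R).
      { intros Hvy. rewrite Hvy.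
        assert (HkC : (Cmod (k (u, v)) <= C0)%R).
        { rewrite Hkm. unfold C0. apply Rmult_le_compat; [apply Cmod_ge_0 | apply Rlt_le,
            exp_pos | apply Hd |].
          apply exp_monotone; lra. }
        apply Rle_trans with (eta * exp (eps * (Y * Y)) * exp (eps * (X * X - Y * Y)))%R.
        - apply Rmult_le_compat; [apply Cmod_ge_0 | apply Rlt_le, exp_pos | lra |].
          apply exp_monotone, Rmult_le_compat_l; [lra | nra].
        - rewrite Rmult_assoc, <- exp_plus. right; f_equal; f_equal; ring. }
      destruct Hside as [-> | [-> | [-> | ->]]]; auto; apply Hhor; ring. }
    rewrite Hgm in HgB.
    apply (Rmult_le_compat_r (exp (- (eps * (x * x - y * y))))) in HgB; [|apply Rlt_le,
        exp_pos].
    rewrite !Rmult_assoc, <- !exp_plus, Rplus_opp_r, exp_0, Rmult_1_r in HgB.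
    replace (eps * (X * X - x * x + y * y))%R with (eps * (X * X) + - (eps * (x * x - y *
        y)))%R by ring.
    exact HgB. }
  intros z. destruct (classic (z = 0)) as [->|Hz]; [reflexivity |].
  destruct (polar_form z 0 Hz) as [y [_ Ey]].
  pose proof (Hk0 (ln (Cmod z)) y) as E. apply (f_equal Cmod) in E.
  rewrite Hkm, <- Ey, Cmod_0 in E.
  apply Rmult_integral in E as [E|E]; [| pose proof (exp_pos (- (ln (Cmod z) / 2))); lra].
  apply Cmod_eq_0 in E. replace (f z) with (f z - f 0 + f 0) by ring. rewrite E; ring.
Qed.

(** * Growth order and limits along rays *)

(** The normalisation of the constants makes sums and products of two such
    bounds immediate. *)
Lemma growth_order_le_iff (s : R) (f : C -> C) : (0 < s)%R ->
  (growth_order_le s f <->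
   forall m, (s < m)%R -> exists A r, (0 <= A)%R /\ (1 <= r)%R /\ forall z, (r < Cmod z)%R ->
     (Cmod (f z) <= A * exp (Rpower (Cmod z) m))%R).
Proof.
  intros Hs. unfold growth_order_le, growth_order.
  set (E := fun m : R => (0 < m)%R /\ exists A r : R, forall z : C, (r < Cmod z)%R ->
      (Cmod (f z) <= A * exp (Rpower (Cmod z) m))%R).
  destruct (Glb_Rbar_correct E) as [Hlb Hglb]. split.
  - intros Hle m Hm.
    assert (Hex : exists m', E m' /\ (m' < m)%R).
    { apply NNPP; intros Hno.
      assert (Hm' : Rbar_le m (Glb_Rbar E)).
      { apply Hglb. intros x Hx. simpl. apply Rnot_lt_le; intros Hlt. apply Hno; exists x;
          auto. }
      pose proof (Rbar_le_trans _ _ _ Hm' Hle) as H. simpl in H. lra. }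
    destruct Hex as [m' [[Hm'0 [A [r H]]] Hm'm]].
    exists (Rmax A 0), (Rmax r 1). repeat split; [apply Rmax_r | apply Rmax_r |].
    intros z Hz.
    assert (Hz1 : (1 < Cmod z)%R) by (eapply Rle_lt_trans; [apply Rmax_r | exact Hz]).
    eapply Rle_trans; [apply H; eapply Rle_lt_trans; [apply Rmax_l | exact Hz] |].
    apply Rle_trans with (Rmax A 0 * exp (Rpower (Cmod z) m'))%R.
    + apply Rmult_le_compat_r; [apply Rlt_le, exp_pos | apply Rmax_l].
    + apply Rmult_le_compat_l; [apply Rmax_r |]. apply exp_monotone, Rle_Rpower; lra.
  - intros H. change (Rbar_le (Glb_Rbar E) s).
    assert (Hall : forall m, (s < m)%R -> Rbar_le (Glb_Rbar E) m).
    { intros m Hm. apply Hlb. split; [lra |].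
      destruct (H m Hm) as [A [r [_ [_ HA]]]]. exists A, r; exact HA. }
    destruct (Glb_Rbar E) as [g| |]; simpl in *; auto.
    + apply le_epsilon. intros eps Heps. apply Hall; lra.
    + apply (Hall (s + 1)%R); lra.
Qed.

(** A larger exponent absorbs the doubling of the exponent in a product. *)
Lemma Rpower_gap (m m' : R) : (0 < m)%R -> (m < m')%R ->
  exists r, (1 <= r)%R /\ forall x, (r < x)%R -> (2 * Rpower x m <= Rpower x m')%R.
Proof.
  intros Hm Hmm.
  exists (exp (/ (m' - m))). split.
  { rewrite <- exp_0. apply exp_monotone, Rlt_le, Rinv_0_lt_compat; lra. }
  intros x Hx.
  assert (Hx0 : (0 < x)%R) by (eapply Rlt_trans; [apply exp_pos | exact Hx]).
  replace m' with (m + (m' - m))%R by ring. rewrite Rpower_plus.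
  rewrite Rmult_comm. apply Rmult_le_compat_l; [apply Rlt_le, exp_pos |].
  unfold Rpower.
  apply Rle_trans with (exp 1); [apply exp_ineq1_le |]. apply exp_monotone.
  apply ln_increasing in Hx; [|apply exp_pos]. rewrite ln_exp in Hx.
  apply (Rmult_lt_compat_l (m' - m)) in Hx; [|lra]. rewrite Rinv_r in Hx; lra.
Qed.

Lemma growth_order_le_ext s f g : (forall z, f z = g z) -> growth_order_le s f ->
    growth_order_le s g.
Proof.
  intros Hfg. unfold growth_order_le, growth_order. intros H.
  rewrite <- (Glb_Rbar_eqset (fun m : R => (0 < m)%R /\
    exists A r : R, forall z : C, (r < Cmod z)%R ->
      (Cmod (f z) <= A * exp (Rpower (Cmod z) m))%R)); [exact H |].
  intros m; split; intros [Hm [A [r Hr]]]; (split; [exact Hm |]); exists A, r; intros z Hz;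
    [rewrite <- Hfg | rewrite Hfg]; auto.
Qed.

Lemma growth_order_le_const s c : (0 < s)%R -> growth_order_le s (fun _ => c).
Proof.
  intros Hs. apply growth_order_le_iff; [exact Hs |]. intros m Hm.
  exists (Cmod c), 1%R. repeat split; [apply Cmod_ge_0 | lra |]. intros z _.
  pose proof (exp_ineq1_le (Rpower (Cmod z) m)). pose proof (exp_pos (m * ln (Cmod z))) as H0.
  fold (Rpower (Cmod z) m) in H0. pose proof (Cmod_ge_0 c). nra.
Qed.

Lemma growth_order_le_plus s f g : (0 < s)%R ->
  growth_order_le s f -> growth_order_le s g -> growth_order_le s (fun z => f z + g z).
Proof.
  intros Hs Hf Hg. apply growth_order_le_iff; [exact Hs |]. intros m Hm.
  destruct (proj1 (growth_order_le_iff s f Hs) Hf m Hm) as [A [r [HA [Hr Hfb]]]].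
  destruct (proj1 (growth_order_le_iff s g Hs) Hg m Hm) as [B [t [HB [Ht Hgb]]]].
  exists (A + B)%R, (Rmax r t). split; [lra | split; [eapply Rle_trans; [apply Hr | apply
      Rmax_l] |]].
  intros z Hz. eapply Rle_trans; [apply Cmod_triangle |].
  specialize (Hfb z (Rle_lt_trans _ _ _ (Rmax_l _ _) Hz)).
  specialize (Hgb z (Rle_lt_trans _ _ _ (Rmax_r _ _) Hz)). lra.
Qed.

Lemma growth_order_le_mult s f g : (0 < s)%R ->
  growth_order_le s f -> growth_order_le s g -> growth_order_le s (fun z => f z * g z).
Proof.
  intros Hs Hf Hg. apply growth_order_le_iff; [exact Hs |]. intros m Hm.
  set (m1 := ((s + m) / 2)%R).
  destruct (proj1 (growth_order_le_iff s f Hs) Hf m1 ltac:(unfold m1; lra)) as [A [r [HA [Hr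
      Hfb]]]].
  destruct (proj1 (growth_order_le_iff s g Hs) Hg m1 ltac:(unfold m1; lra)) as [B [t [HB [Ht
      Hgb]]]].
  destruct (Rpower_gap m1 m ltac:(unfold m1; lra) ltac:(unfold m1; lra)) as [q [Hq Hgap]].
  exists (A * B)%R, (Rmax q (Rmax r t)).
  split; [apply Rmult_le_pos; assumption | split; [eapply Rle_trans; [apply Hq | apply Rmax_l]
      |]].
  intros z Hz. rewrite Cmod_mult.
  specialize (Hgap _ (Rle_lt_trans _ _ _ (Rmax_l _ _) Hz)).
  apply (Rle_lt_trans _ _ _ (Rmax_r _ _)) in Hz.
  specialize (Hfb z (Rle_lt_trans _ _ _ (Rmax_l _ _) Hz)).
  specialize (Hgb z (Rle_lt_trans _ _ _ (Rmax_r _ _) Hz)).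
  set (T := Rpower (Cmod z) m1) in *.
  apply Rle_trans with ((A * exp T) * (B * exp T))%R.
  - apply Rmult_le_compat; auto using Cmod_ge_0.
  - replace ((A * exp T) * (B * exp T))%R with (A * B * exp (2 * T))%R.
    + apply Rmult_le_compat_l; [apply Rmult_le_pos; assumption | apply exp_monotone, Hgap].
    + replace (2 * T)%R with (T + T)%R by ring. rewrite exp_plus; ring.
Qed.

Lemma growth_order_le_id s : (0 < s)%R -> growth_order_le s (fun z => z).
Proof.
  intros Hs. apply growth_order_le_iff; [exact Hs |]. intros m Hm.
  exists (exp (/ m * / m))%R, 1%R. split; [apply Rlt_le, exp_pos | split; [lra |]]. intros z Hz.
  rewrite <- exp_plus. rewrite <- (exp_ln (Cmod z)) at 1 by lra. apply exp_monotone.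
  (* with t = m ln |z|, this is t/m <= t^2/4 + 1/m^2 and t^2/4 <= e^t *)
  unfold Rpower. set (t := (m * ln (Cmod z))%R).
  assert (Ht : (0 < t)%R).
  { unfold t. apply Rmult_lt_0_compat; [lra |]. rewrite <- ln_1. apply ln_increasing; lra. }
  replace (ln (Cmod z)) with (/ m * t)%R by (unfold t; field; lra).
  assert (He : (t * t / 4 <= exp t)%R).
  { replace t with (t / 2 + t / 2)%R at 3 by field. rewrite exp_plus.
    pose proof (exp_ge_self (t / 2)). nra. }
  pose proof (pow2_ge_0 (t / 2 - / m)). nra.
Qed.

Lemma growth_order_le_opp s f : (0 < s)%R ->
  growth_order_le s f -> growth_order_le s (fun z => - f z).
Proof.
  intros Hs Hf. apply (growth_order_le_ext s (fun z => (- (1)) * f z)); [intros; ring |].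
  apply growth_order_le_mult; [exact Hs | apply growth_order_le_const, Hs | exact Hf].
Qed.

Lemma growth_order_le_minus s f g : (0 < s)%R ->
  growth_order_le s f -> growth_order_le s g -> growth_order_le s (fun z => f z - g z).
Proof.
  intros Hs Hf Hg. apply growth_order_le_plus; [exact Hs | exact Hf |].
  apply growth_order_le_opp; assumption.
Qed.

Definition tends_in (S : C -> Prop) (f : C -> C) (l : C) : Prop :=
  forall eps, (0 < eps)%R -> exists r, forall z, S z -> (r < Cmod z)%R ->
    (Cmod (f z - l) < eps)%R.

Lemma ray_Cexp (alpha x : R) : ray alpha (Cexp (x, alpha)).
Proof. exists (exp x); split; [apply Rlt_le, exp_pos | reflexivity]. Qed.

(** In the logarithmic coordinate the sector is a strip of width less than
    [PI / s], which leaves room for a growth exponent above [s]. *)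
Lemma bounded_in_sector (f : C -> C) (s c d B R0 : R) :
  (0 < s)%R -> entire f -> growth_order_le s f -> (c < d)%R -> (d - c < PI / s)%R ->
  (forall z, ray c z \/ ray d z -> (R0 < Cmod z)%R -> (Cmod (f z) <= B)%R) ->
  exists B' X, forall x y, (X <= x)%R -> (c <= y <= d)%R -> (Cmod (f (Cexp (x, y))) <= B')%R.
Proof.
  intros Hs Hf Hg Hcd Hdc HB. pose proof PI_RGT_0 as HPI.
  assert (Hs2 : (s < PI / (d - c))%R).
  { apply (Rmult_lt_reg_r (d - c)); [lra |].
    replace (PI / (d - c) * (d - c))%R with PI by (field; lra).
    apply (Rmult_lt_compat_l s) in Hdc; [|lra].
    replace (s * (PI / s))%R with PI in Hdc by (field; lra). exact Hdc. }
  set (m := ((s + PI / (d - c)) / 2)%R).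
  assert (Hm : (s < m)%R) by (unfold m; lra).
  assert (Hm2 : (m * (d - c) < PI)%R).
  { apply Rlt_le_trans with (PI / (d - c) * (d - c))%R; [|right; field; lra].
    apply Rmult_lt_compat_r; unfold m; lra. }
  destruct (proj1 (growth_order_le_iff s f Hs) Hg m Hm) as [A [r [HA [Hr Hfb]]]].
  set (X0 := (ln (Rmax 1 (Rmax r R0)) + 1)%R).
  assert (HX0 : forall x, (X0 <= x)%R -> (r < exp x)%R /\ (R0 < exp x)%R).
  { intros x Hx.
    assert (H1 : (Rmax 1 (Rmax r R0) < exp x)%R).
    { rewrite <- (exp_ln (Rmax 1 (Rmax r R0))).
      - apply exp_increasing. unfold X0 in Hx; lra.
      - eapply Rlt_le_trans; [|apply Rmax_l]; lra. }
    split; (eapply Rle_lt_trans; [|exact H1]).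
    - eapply Rle_trans; [apply Rmax_l | apply Rmax_r].
    - eapply Rle_trans; [apply Rmax_r | apply Rmax_r]. }
  destruct (entire_bounded_on_disc f (exp X0) Hf) as [B1 HB1].
  set (B' := Rmax 1 (Rmax B B1)).
  exists B', X0.
  apply (phragmen_lindelof_strip (fun z => f (Cexp z)) c d m A B' X0); try assumption; try lra.
  - apply (entire_comp f Cexp); [exact Hf | apply entire_Cexp].
  - eapply Rlt_le_trans; [|apply Rmax_l]; lra.
  - intros x y Hx Hy. destruct (HX0 x Hx) as [Hrx _].
    assert (E : Cmod (Cexp (x, y)) = exp x) by apply Cmod_Cexp.
    eapply Rle_trans; [apply Hfb; rewrite E; exact Hrx |].
    rewrite E. unfold Rpower. rewrite ln_exp. apply Rle_refl.
  - intros x y Hx Hy [-> | Hside].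
    + eapply Rle_trans; [apply HB1; rewrite Cmod_Cexp; apply Rle_refl |].
      eapply Rle_trans; [apply Rmax_r | apply Rmax_r].
    + eapply Rle_trans; [apply HB |].
      * destruct Hside as [-> | ->]; [left | right]; apply ray_Cexp.
      * rewrite Cmod_Cexp. apply HX0, Hx.
      * eapply Rle_trans; [apply Rmax_l | apply Rmax_r].
Qed.

(** The function is bounded in each sector by the theorem of Phragmen and
    Lindelof, so that Liouville's theorem applies. *)
Lemma entire_limit_on_rays (f : C -> C) (l : C) (s : R) (m : nat) (alpha : nat -> R) :
  (0 < s)%R -> entire f -> growth_order_le s f -> dissecting_rays (PI / s) m alpha ->
  (forall i, (i < m)%nat -> tends_in (ray (alpha i)) f l) ->
  forall z, f z = l.
Proof.
  intros Hs Hf Hg [Hlast Hrays] Hlim.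
  assert (Hm : (0 < m)%nat).
  { destruct m; [| lia]. pose proof PI_RGT_0. lra. }
  assert (HR : exists R0, forall i, (i <= m)%nat -> forall z, ray (alpha i) z -> (R0 < Cmod
      z)%R ->
    (Cmod (f z) <= Cmod l + 1)%R).
  { assert (H1 : forall k, (k <= m)%nat -> exists R0, forall i, (i < k)%nat -> forall z,
      ray (alpha i) z -> (R0 < Cmod z)%R -> (Cmod (f z) <= Cmod l + 1)%R).
    { induction k as [|k IH]; intros Hk; [exists 0%R; lia |].
      destruct (IH ltac:(lia)) as [R1 HR1]. destruct (Hlim k ltac:(lia) 1%R ltac:(lra)) as [R2
          HR2].
      exists (Rmax R1 R2). intros i Hi z Hz Hzr.
      destruct (Nat.eq_dec i k) as [-> | Hne].
      - specialize (HR2 z Hz (Rle_lt_trans _ _ _ (Rmax_r _ _) Hzr)).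
        replace (f z) with ((f z - l) + l) by ring.
        eapply Rle_trans; [apply Cmod_triangle |]. lra.
      - apply (HR1 i ltac:(lia) z Hz). exact (Rle_lt_trans _ _ _ (Rmax_l _ _) Hzr). }
    destruct (H1 m (le_n m)) as [R0 HR0]. exists R0. intros i Hi z Hz.
    destruct (Nat.eq_dec i m) as [-> | Hne]; [| apply (HR0 i); [lia | exact Hz]].
    apply (HR0 0%nat Hm). destruct Hz as [t [Ht ->]]. exists t; split; [exact Ht |].
    rewrite Hlast, cos_plus, sin_plus, cos_2PI, sin_2PI. f_equal; ring. }
  destruct HR as [R0 HR0].
  assert (Hsec : forall k, (k <= m)%nat -> exists B X, forall x y, (X <= x)%R ->
    (alpha 0%nat <= y <= alpha k)%R -> (Cmod (f (Cexp (x, y))) <= B)%R).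
  { induction k as [|k IH]; intros Hk.
    - exists (Cmod l + 1)%R, (ln (Rmax 1 R0) + 1)%R. intros x y Hx Hy.
      replace y with (alpha 0%nat) by lra.
      apply (HR0 0%nat ltac:(lia)); [apply ray_Cexp |]. rewrite Cmod_Cexp. simpl.
      apply Rle_lt_trans with (Rmax 1 R0); [apply Rmax_r |].
      rewrite <- (exp_ln (Rmax 1 R0)) at 1 by (eapply Rlt_le_trans; [|apply Rmax_l]; lra).
      apply exp_increasing; lra.
    - destruct (IH ltac:(lia)) as [B1 [X1 H1]].
      destruct (Hrays k ltac:(lia)) as [_ Hk2].
      destruct (bounded_in_sector f s (alpha k) (alpha (S k)) (Cmod l + 1) R0) as [B2 [X2 H2]];
        try assumption; try lra.
      { intros z [Hz | Hz]; [apply (HR0 k) | apply (HR0 (S k))]; (lia || exact Hz). }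
      exists (Rmax B1 B2), (Rmax X1 X2). intros x y Hx Hy.
      destruct (Rle_dec y (alpha k)) as [Hyk | Hyk].
      + eapply Rle_trans; [apply H1 |apply Rmax_l]; [|lra]. eapply Rle_trans; [apply Rmax_l |
          exact Hx].
      + eapply Rle_trans; [apply H2 |apply Rmax_r]; [|lra]. eapply Rle_trans; [apply Rmax_r |
          exact Hx]. }
  destruct (Hsec m (le_n m)) as [B [X HB]].
  assert (Hconst : forall z, f z = f 0).
  { apply (liouville f (exp X) B Hf). intros z Hz.
    assert (Hz0 : z <> 0).
    { apply Cmod_gt_0. eapply Rlt_trans; [apply exp_pos | exact Hz]. }
    destruct (polar_form z (alpha 0%nat) Hz0) as [y [Hy Ey]].
    apply ln_increasing in Hz; [|apply exp_pos]. rewrite ln_exp in Hz. rewrite Ey.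
    apply HB; [lra | rewrite Hlast; exact Hy]. }
  assert (Hl : f 0 = l).
  { replace (f 0) with ((f 0 - l) + l) by ring.
    replace (f 0 - l) with (RtoC 0); [ring |]. symmetry.
    apply Cmod_eq_0, Rle_antisym; [| apply Cmod_ge_0].
    apply le_epsilon. intros eps Heps. rewrite Rplus_0_l.
    destruct (Hlim 0%nat Hm eps Heps) as [R1 HR1].
    rewrite <- (Hconst (Cexp (ln (Rmax 1 R1) + 1, alpha 0%nat)%R)).
    apply Rlt_le, HR1; [apply ray_Cexp |]. rewrite Cmod_Cexp; simpl.
    apply Rle_lt_trans with (Rmax 1 R1); [apply Rmax_r |].
    rewrite <- (exp_ln (Rmax 1 R1)) at 1 by (eapply Rlt_le_trans; [|apply Rmax_l]; lra).
    apply exp_increasing; lra. }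
  intros z. rewrite Hconst; exact Hl.
Qed.

(** * Wronskians, fluxes and the limit point case *)

Lemma Z_constant {A : Type} (F : Z -> A) : (forall n, F n = F (n - 1)%Z) -> forall n m, F n = F
    m.
Proof.
  intros H.
  assert (H0 : forall n, F n = F 0%Z).
  { apply Z.bi_induction; [intros ? ? ->; reflexivity | reflexivity |].
    intros n. rewrite (H (Z.succ n)). replace (Z.succ n - 1)%Z with n by lia. reflexivity. }
  intros n m. rewrite (H0 n), (H0 m). reflexivity.
Qed.

(** Green's identity at one site. *)
Lemma wronskian_step a b z w f g n : solves a b z f -> solves a b w g ->
  wronskian a f g n = wronskian a f g (n - 1)%Z + (w - z) * (f n * g n).
Proof.
  intros Hf Hg. specialize (Hf n). specialize (Hg n). unfold tau in Hf, Hg. unfold wronskian.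
  replace (n - 1 + 1)%Z with n by lia.
  replace (a n * (f n * g (n + 1)%Z - f (n + 1)%Z * g n)) with
    (f n * (w * g n) - g n * (z * f n)
     - f n * (a (n - 1)%Z * g (n - 1)%Z + b n * g n) + g n * (a (n - 1)%Z * f (n - 1)%Z + b n *
         f n)).
  - ring.
  - rewrite <- Hf, <- Hg. ring.
Qed.

Lemma wronskian_constant a b z f g n m : solves a b z f -> solves a b z g ->
  wronskian a f g n = wronskian a f g m.
Proof.
  intros Hf Hg. apply (Z_constant (wronskian a f g)). intros k.
  rewrite (wronskian_step a b z z f g k Hf Hg). ring.
Qed.

Lemma wronskian_antisym a f g n : wronskian a f g n = - wronskian a g f n.
Proof. unfold wronskian; ring. Qed.

(** Cramer's rule in the fundamental system [t], [p]. *)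
Lemma wronskian_expand a t p h n : wronskian a t p n = 1 ->
  h n = wronskian a t h n * p n - wronskian a p h n * t n /\
  h (n + 1)%Z = wronskian a t h n * p (n + 1)%Z - wronskian a p h n * t (n + 1)%Z.
Proof.
  intros HW. split.
  - transitivity (h n * wronskian a t p n); [rewrite HW; ring | unfold wronskian; ring].
  - transitivity (h (n + 1)%Z * wronskian a t p n); [rewrite HW; ring | unfold wronskian; ring].
Qed.

Lemma wronskian_plucker a f g h k n :
  wronskian a f g n * wronskian a h k n =
  wronskian a f k n * wronskian a h g n + wronskian a f h n * wronskian a g k n.
Proof. unfold wronskian; ring. Qed.

Definition conj_seq (u : Z -> C) (n : Z) : C := Cconj (u n).

Lemma Cconj_R (r : R) : Cconj (RtoC r) = RtoC r.
Proof. apply injective_projections; simpl; ring. Qed.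

Lemma solves_conj a b z u : solves a b z u -> solves a b (Cconj z) (conj_seq u).
Proof.
  intros H n. specialize (H n). apply (f_equal Cconj) in H. unfold tau, conj_seq in *.
  rewrite !Cplus_conj, !Cmult_conj, !Cconj_R in H. exact H.
Qed.

Lemma wronskian_conj a f g n :
  wronskian a (conj_seq f) (conj_seq g) n = Cconj (wronskian a f g n).
Proof.
  unfold wronskian, conj_seq. rewrite Cmult_conj, Cminus_conj, !Cmult_conj, Cconj_R.
      reflexivity.
Qed.

(** This is [1 / (2 i)] times the Wronskian of the conjugate of [u] with [u],
    the boundary term in Green's identity for [Im z |u|^2]. *)
Definition flux (a : Z -> R) (u : Z -> C) (n : Z) : R :=
  (a n * Im (Cconj (u n) * u (n + 1)%Z))%R.

Lemma wronskian_conj_self a u n : wronskian a (conj_seq u) u n = 2 * Ci * RtoC (flux a u n).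
Proof.
  unfold wronskian, conj_seq, flux. destruct (u n) as [x y], (u (n + 1)%Z) as [v w].
  apply injective_projections; simpl; ring.
Qed.

Lemma Cmod_sqr_conj (c : C) : Cconj c * c = RtoC (Cmod c ^ 2).
Proof. rewrite Cmod2_conj. ring. Qed.

Lemma flux_step a b z u n : solves a b z u ->
  flux a u n = (flux a u (n - 1)%Z + Im z * Cmod (u n) ^ 2)%R.
Proof.
  intros H.
  pose proof (wronskian_step a b (Cconj z) z (conj_seq u) u n (solves_conj _ _ _ _ H) H) as E.
  rewrite !wronskian_conj_self in E.
  unfold conj_seq in E at 1. rewrite Cmod_sqr_conj in E.
  assert (E2 : z - Cconj z = 2 * Ci * RtoC (Im z)) by apply im_alt'.
  rewrite E2 in E. apply (f_equal Im) in E. simpl in E. simpl. lra.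
Qed.

Lemma flux_sum a b z u (N : nat) : solves a b z u ->
  flux a u (Z.of_nat N) =
  (flux a u (-1)%Z + Im z * sum_n (fun k => Cmod (u (Z.of_nat k)) ^ 2) N)%R.
Proof.
  intros H. induction N as [|N IH].
  - rewrite sum_O. rewrite (flux_step a b z u _ H). reflexivity.
  - rewrite sum_Sn. rewrite (flux_step a b z u _ H).
    replace (Z.of_nat (S N) - 1)%Z with (Z.of_nat N) by lia. rewrite IH.
    unfold plus; simpl. ring.
Qed.

Lemma flux_monotone a b z u n m : solves a b z u -> (n <= m)%Z ->
  (Im z * flux a u n <= Im z * flux a u m)%R.
Proof.
  intros H Hnm. replace m with (n + Z.of_nat (Z.to_nat (m - n)))%Z by lia.
  induction (Z.to_nat (m - n)) as [|k IH].
  - rewrite Z.add_0_r; lra.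
  - eapply Rle_trans; [apply IH |].
    rewrite (flux_step a b z u (n + Z.of_nat (S k)) H).
    replace (n + Z.of_nat (S k) - 1)%Z with (n + Z.of_nat k)%Z by lia.
    pose proof (pow2_ge_0 (Im z)). pose proof (pow2_ge_0 (Cmod (u (n + Z.of_nat (S k))%Z))).
        nra.
Qed.

Lemma flux_bound a u n : (0 < a n)%R ->
  (Rabs (flux a u n) <= a n * (Cmod (u n) * Cmod (u (n + 1)%Z)))%R.
Proof.
  intros Ha. unfold flux. rewrite Rabs_mult, (Rabs_pos_eq (a n)) by lra.
  apply Rmult_le_compat_l; [lra |].
  pose proof (Rmax_Cmod (Cconj (u n) * u (n + 1)%Z)) as H.
  eapply Rle_trans; [eapply Rle_trans; [apply Rmax_r | exact H] |].
  rewrite Cmod_mult, Cmod_conj. apply Rle_refl.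
Qed.

Lemma ex_series_nonneg_iff (F : nat -> R) : (forall k, (0 <= F k)%R) ->
  (ex_series F <-> exists G, forall N, (sum_n F N <= G)%R).
Proof.
  intros HF.
  assert (Hinc : forall N, (sum_n F N <= sum_n F (S N))%R).
  { intros N. rewrite sum_Sn. unfold plus; simpl. pose proof (HF (S N)). lra. }
  split.
  - intros [l Hl]. exists l. intros N.
    apply (is_lim_seq_incr_compare (sum_n F) l); [exact Hl | exact Hinc].
  - intros [G HG]. destruct (ex_finite_lim_seq_incr (sum_n F) G Hinc HG) as [l Hl].
    exists l. exact Hl.
Qed.

Lemma sum_n_le_combination (f g h : nat -> R) (p q : R) (N : nat) :
  (forall k, (f k <= p * g k + q * h k)%R) ->
  (sum_n f N <= p * sum_n g N + q * sum_n h N)%R.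
Proof.
  intros H. induction N as [|N IH].
  - rewrite !sum_O. apply H.
  - rewrite !sum_Sn. unfold plus; simpl. specialize (H (S N)). lra.
Qed.

Lemma square_summable_iff (u : Z -> C) :
  square_summable_near plus_infty u <->
  exists G, forall N, (sum_n (fun k => Cmod (u (Z.of_nat k)) ^ 2)%R N <= G)%R.
Proof. apply ex_series_nonneg_iff. intros k; apply pow2_ge_0. Qed.

(** Weyl's limit point argument.  If a square summable [u] had flux of the
    wrong sign, then every other solution [v] would be square summable: adding
    to [v] the multiple of [u] which is orthogonal to it for the indefinite
    form at [N] makes the flux at [N] have the other sign, and this bounds the
    sum up to [N]. *)
Lemma square_summable_of_flux a b z u v n0 : (forall n, (0 < a n)%R) -> Im z <> 0%R ->
  solves a b z u -> solves a b z v -> square_summable_near plus_infty u ->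
  (0 < Im z * flux a u n0)%R -> square_summable_near plus_infty v.
Proof.
  intros Ha Hz Hu Hv Hsu Hpos.
  apply square_summable_iff in Hsu as [Gu HGu]. apply square_summable_iff.
  assert (Hy2 : (0 < Im z * Im z)%R) by nra.
  set (y := Im z) in *.
  set (w := fun (c : C) n => v n + c * u n).
  assert (Hw : forall c, solves a b z (w c)).
  { intros c n. specialize (Hu n). specialize (Hv n). unfold tau, w in *.
    transitivity (z * v n + c * (z * u n)); [rewrite <- Hu, <- Hv |]; ring. }
  (* the flux of v + c u at n0 is a quadratic in |c| with leading coefficient flux u *)
  set (K1 := (Rabs y * (a n0 * (Cmod (v n0) * Cmod (u (n0 + 1)%Z) + Cmod (u n0) * Cmod (v (n0 +
      1)%Z))))%R).
  set (K2 := (Rabs y * Rabs (flux a v n0))%R).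
  set (kap := (y * flux a u n0)%R) in *.
  assert (HK1 : (0 <= K1)%R).
  { apply Rmult_le_pos; [apply Rabs_pos |]. apply Rmult_le_pos; [apply Rlt_le, Ha |].
    apply Rplus_le_le_0_compat; apply Rmult_le_pos; apply Cmod_ge_0. }
  assert (HK2 : (0 <= K2)%R) by (apply Rmult_le_pos; apply Rabs_pos).
  assert (Hquad : forall c, (kap * Cmod c ^ 2 - K1 * Cmod c - K2 <= y * flux a (w c) n0)%R).
  { intros c.
    set (X := (Im (Cconj (v n0) * (c * u (n0 + 1)%Z) + Cconj (c * u n0) * v (n0 + 1)%Z))%C).
    assert (E : flux a (w c) n0 = (flux a v n0 + Cmod c ^ 2 * flux a u n0 + a n0 * X)%R).
    { unfold flux, w, X. rewrite Cmod2_alt.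
      destruct c as [c1 c2], (v n0) as [v1 v2], (u n0) as [u1 u2], (v (n0 + 1)%Z) as [v3 v4],
        (u (n0 + 1)%Z) as [u3 u4]. simpl. ring. }
    rewrite E.
    assert (HX : (Rabs X <= Cmod c * (Cmod (v n0) * Cmod (u (n0 + 1)%Z) + Cmod (u n0) * Cmod (v
        (n0 + 1)%Z)))%R).
    { unfold X. eapply Rle_trans; [eapply Rle_trans; [apply Rmax_r | apply Rmax_Cmod] |].
      eapply Rle_trans; [apply Cmod_triangle |]. rewrite !Cmod_mult, !Cmod_conj, !Cmod_mult.
          right; ring. }
    assert (H1 : (- (K1 * Cmod c) <= y * (a n0 * X))%R).
    { apply Ropp_le_cancel. rewrite Ropp_involutive. eapply Rle_trans; [apply Rle_abs |].
      rewrite Rabs_Ropp, !Rabs_mult, (Rabs_pos_eq (a n0)) by apply Rlt_le, Ha.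
      unfold K1. rewrite !Rmult_assoc. apply Rmult_le_compat_l; [apply Rabs_pos |].
      apply Rmult_le_compat_l; [apply Rlt_le, Ha |]. rewrite Rmult_comm. rewrite Rmult_comm in
          HX.
      rewrite Rmult_comm. exact HX. }
    assert (H2 : (- K2 <= y * flux a v n0)%R).
    { unfold K2. rewrite <- Rabs_mult. pose proof (Rle_abs (- (y * flux a v n0))).
      rewrite Rabs_Ropp in H. lra. }
    unfold kap. nra. }
  set (C0 := ((K1 + K2) / kap + 1)%R).
  assert (HC0 : (1 <= C0)%R).
  { unfold C0. assert (0 <= (K1 + K2) / kap)%R; [|lra].
    apply Rmult_le_pos; [lra | apply Rlt_le, Rinv_0_lt_compat, Hpos]. }
  assert (Hcb : forall c, (y * flux a (w c) n0 <= 0)%R -> (Cmod c <= C0)%R).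
  { intros c Hc. apply Rnot_lt_le; intros Hlt. specialize (Hquad c).
    assert (H1 : (kap * C0 = K1 + K2 + kap)%R) by (unfold C0; field; lra).
    assert (1 < Cmod c)%R by lra.
    assert (kap * C0 < kap * Cmod c)%R by (apply Rmult_lt_compat_l; lra). nra. }
  set (K3 := (Rabs y * (a (-1)%Z * ((Cmod (v (-1)%Z) + C0 * Cmod (u (-1)%Z)) *
    (Cmod (v 0%Z) + C0 * Cmod (u 0%Z)))))%R).
  assert (Hlow : forall c, (Cmod c <= C0)%R -> (- K3 <= y * flux a (w c) (-1)%Z)%R).
  { intros c Hc. apply Ropp_le_cancel. rewrite Ropp_involutive. eapply Rle_trans; [apply
      Rle_abs |].
    rewrite Rabs_Ropp, Rabs_mult. apply Rmult_le_compat_l; [apply Rabs_pos |].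
    eapply Rle_trans; [apply flux_bound, Ha |]. apply Rmult_le_compat_l; [apply Rlt_le, Ha |].
    assert (Hwc : forall n, (Cmod (w c n) <= Cmod (v n) + C0 * Cmod (u n))%R).
    { intros n. unfold w. eapply Rle_trans; [apply Cmod_triangle |]. rewrite Cmod_mult.
      apply Rplus_le_compat_l, Rmult_le_compat_r; [apply Cmod_ge_0 | exact Hc]. }
    apply Rmult_le_compat; try apply Cmod_ge_0; apply Hwc. }
  (* the partial sums increase, so it suffices to bound them beyond n0, where
     the flux of u has a fixed sign *)
  assert (Hbig : forall N, (n0 <= Z.of_nat N)%Z ->
    (sum_n (fun k => Cmod (v (Z.of_nat k)) ^ 2)%R N <= 2 * (K3 / (y * y)) + 2 * (C0 * C0) *
        Gu)%R).
  { intros N HN.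
    assert (HuN : (0 < y * flux a u (Z.of_nat N))%R).
    { eapply Rlt_le_trans; [apply Hpos | apply (flux_monotone a b z u _ _ Hu HN)]. }
    assert (HuN0 : flux a u (Z.of_nat N) <> 0%R).
    { intros E. rewrite E in HuN. lra. }
    set (n := Z.of_nat N) in *.
    set (c := - wronskian a (conj_seq u) v n / (2 * Ci * RtoC (flux a u n))).
    assert (Hne : 2 * Ci * RtoC (flux a u n) <> 0).
    { intros E. apply (f_equal Im) in E. simpl in E. lra. }
    assert (Horth : wronskian a (conj_seq u) (w c) n = 0).
    { transitivity (wronskian a (conj_seq u) v n + c * wronskian a (conj_seq u) u n).
      - unfold wronskian, w; ring.
      - rewrite wronskian_conj_self. unfold c.
        set (D := 2 * Ci * RtoC (flux a u n)) in *. field. exact Hne. }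
    assert (Hsign : (y * flux a (w c) n <= 0)%R).
    { pose proof (wronskian_plucker a (conj_seq u) u (conj_seq (w c)) (w c) n) as P.
      rewrite Horth, !wronskian_conj_self, wronskian_conj in P.
      rewrite Cmult_0_l, Cplus_0_l, Cmod_sqr_conj in P.
      apply (f_equal Re) in P. simpl in P.
      pose proof (pow2_ge_0 (Cmod (wronskian a u (w c) n))) as Hsq. simpl in Hsq.
      assert (Hp : (flux a u n * flux a (w c) n <= 0)%R) by lra.
      apply Rnot_lt_le; intros Hlt.
      assert (0 < (y * flux a u n) * (y * flux a (w c) n))%R by (apply Rmult_lt_0_compat;
          assumption).
      nra. }
    assert (Hc : (Cmod c <= C0)%R).
    { apply Hcb. eapply Rle_trans; [apply (flux_monotone a b z (w c) _ _ (Hw c) HN) | exact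
        Hsign]. }
    specialize (Hlow c Hc).
    assert (Hsw : (sum_n (fun k => Cmod (w c (Z.of_nat k)) ^ 2)%R N <= K3 / (y * y))%R).
    { pose proof (flux_sum a b z (w c) N (Hw c)) as E. fold n in E. rewrite E in Hsign. fold y
        in Hsign.
      apply (Rmult_le_reg_l (y * y)); [exact Hy2 |].
      replace (y * y * (K3 / (y * y)))%R with K3 by (field; intros E0; rewrite E0 in Hy2; lra).
          nra. }
    eapply Rle_trans.
    { apply (sum_n_le_combination _ (fun k => Cmod (w c (Z.of_nat k)) ^ 2)%R
         (fun k => Cmod (u (Z.of_nat k)) ^ 2)%R 2 (2 * (C0 * C0))).
      intros k.
      assert (Hk : (Cmod (v (Z.of_nat k)) <= Cmod (w c (Z.of_nat k)) + C0 * Cmod (u (Z.of_nat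
          k)))%R).
      { replace (v (Z.of_nat k)) with (w c (Z.of_nat k) + - (c * u (Z.of_nat k))) by (unfold w;
          ring).
        eapply Rle_trans; [apply Cmod_triangle |]. rewrite Cmod_opp, Cmod_mult.
        apply Rplus_le_compat_l, Rmult_le_compat_r; [apply Cmod_ge_0 | exact Hc]. }
      pose proof (Cmod_ge_0 (v (Z.of_nat k))). pose proof (Cmod_ge_0 (w c (Z.of_nat k))).
      pose proof (Cmod_ge_0 (u (Z.of_nat k))).
      set (p := Cmod (v (Z.of_nat k))) in *. set (q := Cmod (w c (Z.of_nat k))) in *.
      set (r := (C0 * Cmod (u (Z.of_nat k)))%R) in *.
      replace (2 * (C0 * C0) * Cmod (u (Z.of_nat k)) ^ 2)%R
        with (2 * (r * r))%R by (unfold r; ring).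
      pose proof (pow2_ge_0 (q - r)). nra. }
    specialize (HGu N).
    apply Rplus_le_compat; [apply Rmult_le_compat_l; [lra | exact Hsw] |].
    apply Rmult_le_compat_l; [nra | exact HGu]. }
  exists (2 * (K3 / (y * y)) + 2 * (C0 * C0) * Gu)%R. intros N.
  set (N' := (N + Z.to_nat n0)%nat).
  eapply Rle_trans; [| apply (Hbig N'); unfold N'; lia].
  unfold N'. induction (Z.to_nat n0) as [|k IH].
  - rewrite Nat.add_0_r. apply Rle_refl.
  - eapply Rle_trans; [apply IH |]. rewrite Nat.add_succ_r, sum_Sn. unfold plus; simpl.
    pose proof (pow2_ge_0 (Cmod (v (Z.of_nat (S (N + k)))))). simpl in H. lra.
Qed.

(** * The limit circle case and reflection *)

Definition fundamental_system (a b : Z -> R) (theta phi : C -> Z -> C) : Prop :=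
  (forall z, solves a b z (theta z)) /\ (forall z, solves a b z (phi z)) /\
  (forall z n, wronskian a (theta z) (phi z) n = 1).

(** Variation of constants: the coordinates of [w] in a square summable
    fundamental system at another spectral parameter satisfy a discrete
    Gronwall inequality with summable coefficients. *)
Lemma square_summable_all (a b : Z -> R) (z z0 : C) (t p w : Z -> C) :
  solves a b z0 t -> solves a b z0 p -> (forall n, wronskian a t p n = 1) ->
  square_summable_near plus_infty t -> square_summable_near plus_infty p ->
  solves a b z w -> square_summable_near plus_infty w.
Proof.
  intros Ht Hp HW Hst Hsp Hw.
  apply square_summable_iff in Hst as [Gt HGt]. apply square_summable_iff in Hsp as [Gp HGp].
  apply square_summable_iff.
  set (g := fun n => (Cmod (t n) + Cmod (p n))%R).
  set (sz := fun n => (Cmod (wronskian a t w n) + Cmod (wronskian a p w n))%R).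
  set (L := Cmod (z - z0)).
  assert (Hg0 : forall n, (0 <= g n)%R).
  { intros n; unfold g; pose proof (Cmod_ge_0 (t n)); pose proof (Cmod_ge_0 (p n)); lra. }
  assert (HS0 : forall n, (0 <= sz n)%R).
  { intros n; unfold sz; pose proof (Cmod_ge_0 (wronskian a t w n));
    pose proof (Cmod_ge_0 (wronskian a p w n)); lra. }
  assert (HL : (0 <= L)%R) by apply Cmod_ge_0.
  assert (Hwn : forall n, (Cmod (w n) <= sz (n - 1)%Z * g n)%R).
  { intros n. destruct (wronskian_expand a t p w (n - 1) (HW _)) as [_ E].
    replace (n - 1 + 1)%Z with n in E by lia. rewrite E. unfold Cminus.
    eapply Rle_trans; [apply Cmod_triangle |]. rewrite Cmod_opp, !Cmod_mult.
    unfold sz, g.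
    pose proof (Cmod_ge_0 (wronskian a t w (n - 1))). pose proof (Cmod_ge_0 (wronskian a p w (n
        - 1))).
    pose proof (Cmod_ge_0 (t n)). pose proof (Cmod_ge_0 (p n)). nra. }
  assert (Hstep : forall n, (sz n <= sz (n - 1)%Z * exp (L * (g n * g n)))%R).
  { intros n.
    assert (H1 : (sz n <= sz (n - 1)%Z + L * g n * Cmod (w n))%R).
    { unfold sz. rewrite (wronskian_step a b z0 z t w n Ht Hw), (wronskian_step a b z0 z p w n
        Hp Hw).
      pose proof (Cmod_triangle (wronskian a t w (n - 1)) ((z - z0) * (t n * w n))).
      pose proof (Cmod_triangle (wronskian a p w (n - 1)) ((z - z0) * (p n * w n))).
      rewrite !Cmod_mult in H, H0. fold L in H, H0. unfold g. lra. }
    eapply Rle_trans; [exact H1 |].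
    apply Rle_trans with (sz (n - 1)%Z * (1 + L * (g n * g n)))%R.
    - specialize (Hwn n).
      assert (L * g n * Cmod (w n) <= L * g n * (sz (n - 1)%Z * g n))%R; [|lra].
      apply Rmult_le_compat_l; [apply Rmult_le_pos; auto | exact Hwn].
    - apply Rmult_le_compat_l; [apply HS0 |]. apply exp_ineq1_le. }
  assert (HGg : forall N, (sum_n (fun k => g (Z.of_nat k) * g (Z.of_nat k))%R N <= 2 * Gt + 2 *
      Gp)%R).
  { intros N. eapply Rle_trans.
    - apply (sum_n_le_combination _ (fun k => Cmod (t (Z.of_nat k)) ^ 2)%R
        (fun k => Cmod (p (Z.of_nat k)) ^ 2)%R 2 2).
      intros k. unfold g. pose proof (pow2_ge_0 (Cmod (t (Z.of_nat k)) - Cmod (p (Z.of_nat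
          k)))). nra.
    - specialize (HGt N). specialize (HGp N). lra. }
  assert (HS : forall N, (sz (Z.of_nat N) <=
    sz (-1)%Z * exp (L * sum_n (fun k => g (Z.of_nat k) * g (Z.of_nat k))%R N))%R).
  { induction N as [|N IH].
    - rewrite sum_O. apply Hstep.
    - eapply Rle_trans; [apply Hstep |].
      replace (Z.of_nat (S N) - 1)%Z with (Z.of_nat N) by lia.
      rewrite sum_Sn. unfold plus; cbn [AbelianMonoid.plus].
      match goal with |- (_ <= _ * exp (L * ?s))%R =>
        change s with (sum_n (fun k => g (Z.of_nat k) * g (Z.of_nat k)) N
          + g (Z.of_nat (S N)) * g (Z.of_nat (S N)))%R end.
      rewrite Rmult_plus_distr_l, exp_plus, <- (Rmult_assoc (sz (-1)%Z)).
      apply Rmult_le_compat_r; [apply Rlt_le, exp_pos | exact IH]. }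
  set (B := (sz (-1)%Z * exp (L * (2 * Gt + 2 * Gp)))%R).
  assert (HG0 : (0 <= 2 * Gt + 2 * Gp)%R).
  { eapply Rle_trans; [| apply (HGg 0%nat)]. rewrite sum_O. apply Rmult_le_pos; apply Hg0. }
  assert (HB : forall k, (sz (Z.of_nat k - 1)%Z <= B)%R).
  { intros [|k].
    - change (Z.of_nat 0 - 1)%Z with (-1)%Z. unfold B. rewrite <- (Rmult_1_r (sz (-1)%Z)) at 1.
      apply Rmult_le_compat_l; [apply HS0 |].
      eapply Rle_trans; [| apply exp_ineq1_le]. assert (0 <= L * (2 * Gt + 2 * Gp))%R; [|lra].
      apply Rmult_le_pos; lra.
    - replace (Z.of_nat (S k) - 1)%Z with (Z.of_nat k) by lia.
      eapply Rle_trans; [apply HS |]. apply Rmult_le_compat_l; [apply HS0 |].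
      destruct (Rmult_le_compat_l L _ _ HL (HGg k)) as [Hlt | ->]; [apply Rlt_le,
          exp_increasing, Hlt | lra]. }
  exists (B * B * (2 * Gt + 2 * Gp) + 0 * 0)%R. intros N.
  eapply Rle_trans.
  - apply (sum_n_le_combination _ (fun k => g (Z.of_nat k) * g (Z.of_nat k))%R (fun _ => 0%R)
      (B * B) 0).
    intros k. specialize (Hwn (Z.of_nat k)). specialize (HB k).
    assert (H1 : (Cmod (w (Z.of_nat k)) <= B * g (Z.of_nat k))%R).
    { eapply Rle_trans; [exact Hwn |]. apply Rmult_le_compat_r; [apply Hg0 | exact HB]. }
    pose proof (Cmod_ge_0 (w (Z.of_nat k))). nra.
  - rewrite Rmult_0_l. apply Rplus_le_compat; [| lra].
    apply Rmult_le_compat_l; [|apply HGg]. pose proof (HB 0%nat). pose proof (HS0 (Z.of_nat 0 -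
        1)%Z). nra.
Qed.

Lemma wronskian_bounded a b z z' f g : solves a b z f -> solves a b z' g ->
  square_summable_near plus_infty f -> square_summable_near plus_infty g ->
  exists K, forall N : nat, (Cmod (wronskian a f g (Z.of_nat N)) <= K)%R.
Proof.
  intros Hf Hg Hsf Hsg.
  apply square_summable_iff in Hsf as [Gf HGf]. apply square_summable_iff in Hsg as [Gg HGg].
  set (L := Cmod (z' - z)).
  assert (HL : (0 <= L)%R) by apply Cmod_ge_0.
  exists (Cmod (wronskian a f g (-1)%Z) + L * (Gf + Gg))%R. intros N.
  assert (H : (Cmod (wronskian a f g (Z.of_nat N)) <= Cmod (wronskian a f g (-1)%Z) +
    L * (sum_n (fun k => Cmod (f (Z.of_nat k)) ^ 2)%R N + sum_n (fun k => Cmod (g (Z.of_nat k))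
        ^ 2)%R N))%R).
  { assert (Hone : forall n, (Cmod (wronskian a f g n) <= Cmod (wronskian a f g (n - 1)%Z) +
      L * (Cmod (f n) ^ 2 + Cmod (g n) ^ 2))%R).
    { intros n. rewrite (wronskian_step a b z z' f g n Hf Hg).
      eapply Rle_trans; [apply Cmod_triangle |]. rewrite !Cmod_mult.
      apply Rplus_le_compat_l, Rmult_le_compat_l; [exact HL |].
      pose proof (pow2_ge_0 (Cmod (f n) - Cmod (g n))).
      pose proof (Cmod_ge_0 (f n)). pose proof (Cmod_ge_0 (g n)). nra. }
    induction N as [|N IH].
    - rewrite !sum_O. apply Hone.
    - rewrite !sum_Sn. unfold plus; simpl plus. specialize (Hone (Z.of_nat (S N))).
      replace (Z.of_nat (S N) - 1)%Z with (Z.of_nat N) in Hone by lia. simpl in *. lra. }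
  eapply Rle_trans; [exact H |]. apply Rplus_le_compat_l, Rmult_le_compat_l; [exact HL |].
  apply Rplus_le_compat; auto.
Qed.

Lemma lim_at_eps e F l : lim_at e F l <->
  forall eps, (0 < eps)%R -> exists N, forall k, (N <= k)%nat -> (Cmod (F (toward e k) - l) <
      eps)%R.
Proof.
  unfold lim_at. split.
  - intros H eps Heps.
    pose proof (sqrt_lt_R0 2 ltac:(lra)) as H2.
    assert (He : (0 < eps / sqrt 2)%R) by (apply Rdiv_lt_0_compat; lra).
    destruct (proj1 (filterlim_locally _ _) H (mkposreal _ He)) as [N HN].
    exists N. intros k Hk. specialize (HN k Hk).
    apply (C_NormedModule_mixin_compat2 l) in HN. simpl in HN.
    replace (sqrt 2 * (eps / sqrt 2))%R with eps in HN by (field; lra). exact HN.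
  - intros H. apply filterlim_locally. intros eps.
    destruct (H eps (cond_pos eps)) as [N HN]. exists N. intros k Hk.
    apply C_NormedModule_mixin_compat1, HN, Hk.
Qed.

(** Limit circle case: [W(v,w) W(conj u, u)] is a combination of [W(v,u)] and
    its conjugate with bounded coefficients. *)
Lemma flux_small_of_boundary_condition a b (lambda : R) (v : Z -> R) w z u :
  solves a b lambda (fun n => RtoC (v n)) -> solves a b lambda w -> solves a b z u ->
  wronskian a (fun n => RtoC (v n)) w 0%Z <> 0 ->
  square_summable_near plus_infty w -> square_summable_near plus_infty u ->
  lim_at plus_infty (wronskian a (fun n => RtoC (v n)) u) 0 ->
  forall eps, (0 < eps)%R -> exists N, forall k, (N <= k)%nat ->
    (Rabs (flux a u (Z.of_nat k)) < eps)%R.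
Proof.
  intros Hv Hw Hu Hom Hsw Hsu Hlim eps Heps.
  set (vc := fun n => RtoC (v n)) in *.
  destruct (wronskian_bounded a b lambda z w u Hw Hu Hsw Hsu) as [K1 HK1].
  assert (Hsu' : square_summable_near plus_infty (conj_seq u)).
  { unfold square_summable_near, conj_seq in *.
    eapply ex_series_ext; [|exact Hsu]. intros k; simpl. rewrite Cmod_conj. reflexivity. }
  destruct (wronskian_bounded a b (Cconj z) lambda (conj_seq u) w (solves_conj _ _ _ _ Hu) Hw
      Hsu' Hsw)
    as [K2 HK2].
  set (om := wronskian a vc w 0%Z) in *.
  assert (Homp : (0 < Cmod om)%R) by (apply Cmod_gt_0; exact Hom).
  assert (HK1' : (0 <= K1)%R) by (eapply Rle_trans; [apply Cmod_ge_0 | apply (HK1 0%nat)]).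
  assert (HK2' : (0 <= K2)%R) by (eapply Rle_trans; [apply Cmod_ge_0 | apply (HK2 0%nat)]).
  set (K := (K1 + K2 + 1)%R).
  destruct (proj1 (lim_at_eps _ _ _) Hlim (Cmod om * eps / K)%R) as [N HN].
  { apply Rdiv_lt_0_compat; [apply Rmult_lt_0_compat; assumption | unfold K; lra]. }
  exists N. intros k Hk. specialize (HN k Hk). simpl toward in HN.
  set (n := Z.of_nat k) in *.
  replace (wronskian a vc u n - 0) with (wronskian a vc u n) in HN by ring.
  pose proof (wronskian_plucker a vc w (conj_seq u) u n) as P.
  rewrite (wronskian_constant a b lambda vc w n 0%Z Hv Hw) in P. fold om in P.
  rewrite wronskian_conj_self in P.
  assert (E : wronskian a vc (conj_seq u) n = Cconj (wronskian a vc u n)).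
  { rewrite <- wronskian_conj. unfold wronskian, conj_seq, vc. rewrite !Cconj_R. reflexivity. }
  rewrite E in P. apply (f_equal Cmod) in P.
  rewrite !Cmod_mult, Cmod_Ci, !Cmod_R in P.
  rewrite (Rabs_pos_eq 2), Rmult_1_r in P by lra.
  set (q := Rabs (flux a u n)) in *.
  assert (H1 : (Cmod om * (2 * q) <= Cmod (wronskian a vc u n) * (K1 + K2))%R).
  { rewrite P. eapply Rle_trans; [apply Cmod_triangle |]. rewrite !Cmod_mult, Cmod_conj.
    specialize (HK1 k). specialize (HK2 k). fold n in HK1, HK2.
    pose proof (Cmod_ge_0 (wronskian a vc u n)). nra. }
  assert (H2 : (Cmod (wronskian a vc u n) * K < Cmod om * eps)%R).
  { apply (Rmult_lt_compat_r K) in HN; [|unfold K; lra].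
    replace (Cmod om * eps / K * K)%R with (Cmod om * eps)%R in HN by (field; unfold K; lra).
        exact HN. }
  assert (H3 : (Cmod (wronskian a vc u n) * (K1 + K2) <= Cmod (wronskian a vc u n) * K)%R).
  { apply Rmult_le_compat_l; [apply Cmod_ge_0 | unfold K; lra]. }
  assert (Hq : (0 <= q)%R) by apply Rabs_pos.
  apply (Rmult_lt_reg_l (Cmod om)); [exact Homp |].
  assert (0 <= Cmod om * q)%R by (apply Rmult_le_pos; lra). lra.
Qed.

Lemma flux_nonpos (a b : Z -> R) (v : Z -> R) (theta phi : C -> Z -> C) z u :
  (forall n, (0 < a n)%R) -> fundamental_system a b theta phi -> Im z <> 0%R -> solves a b z u
      ->
  square_summable_near plus_infty u ->
  (limit_circle a b plus_infty -> exists lambda : R,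
     solves a b lambda (fun n => RtoC (v n)) /\ nontrivial (fun n => RtoC (v n))) ->
  (limit_circle a b plus_infty -> lim_at plus_infty (wronskian a (fun n => RtoC (v n)) u) 0) ->
  forall n, (Im z * flux a u n <= 0)%R.
Proof.
  intros Ha [Ht [Hp HW]] Hz Hu Hsu Hv Hbc n. apply Rnot_lt_le; intros Hpos.
  assert (Hlc : limit_circle a b plus_infty).
  { exists z. intros w Hw. apply (square_summable_of_flux a b z u w n); assumption. }
  destruct (Hv Hlc) as [lambda [Hv1 [k Hk]]]. specialize (Hbc Hlc).
  assert (Hall : forall w, solves a b lambda w -> square_summable_near plus_infty w).
  { destruct Hlc as [z0 Hz0]. intros w Hw.
    apply (square_summable_all a b lambda z0 (theta z0) (phi z0)); auto. }
  assert (Hex : exists w, solves a b lambda w /\ wronskian a (fun n => RtoC (v n)) w 0%Z <> 0).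
  { apply NNPP; intros Hno.
    assert (Hzero : forall w, solves a b lambda w -> wronskian a (fun n => RtoC (v n)) w k = 0).
    { intros w Hw. rewrite (wronskian_constant a b lambda _ w k 0%Z Hv1 Hw).
      apply NNPP; intros Hne. apply Hno. exists w; auto. }
    apply Hk.
    destruct (wronskian_expand a (theta lambda) (phi lambda) (fun n => RtoC (v n)) k (HW _ _))
        as [E _].
    rewrite E, wronskian_antisym, (wronskian_antisym a (phi lambda)), !Hzero by auto. ring. }
  destruct Hex as [w [Hw Hom]].
  destruct (flux_small_of_boundary_condition a b lambda v w z u Hv1 Hw Hu Hom (Hall w Hw) Hsu
      Hbc
    (Im z * flux a u n / Rabs (Im z))%R) as [N HN].
  { apply Rdiv_lt_0_compat; [exact Hpos | apply Rabs_pos_lt, Hz]. }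
  set (m := (N + Z.to_nat n)%nat). specialize (HN m ltac:(unfold m; lia)).
  pose proof (flux_monotone a b z u n (Z.of_nat m) Hu ltac:(unfold m; lia)) as Hmon.
  pose proof (Rabs_pos_lt _ Hz) as Hy.
  apply (Rmult_lt_compat_l (Rabs (Im z))) in HN; [|exact Hy].
  replace (Rabs (Im z) * (Im z * flux a u n / Rabs (Im z)))%R with (Im z * flux a u n)%R in HN
      by (field; lra).
  rewrite <- Rabs_mult in HN. pose proof (Rle_abs (Im z * flux a u (Z.of_nat m))). lra.
Qed.

Definition reflect {A : Type} (f : Z -> A) (n : Z) : A := f (- n)%Z.
(** [a n] is the weight of the edge from [n] to [n + 1], which the reflection
    takes to the edge from [- n - 1] to [- n]. *)
Definition reflect_a (a : Z -> R) (n : Z) : R := a (- n - 1)%Z.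

Lemma solves_reflect a b z u :
  solves (reflect_a a) (reflect b) z (reflect u) <-> solves a b z u.
Proof.
  assert (E : forall n, tau (reflect_a a) (reflect b) (reflect u) n = tau a b u (- n)%Z).
  { intros n. unfold tau, reflect_a, reflect.
    replace (- (n + 1))%Z with (- n - 1)%Z by lia.
    replace (- (n - 1) - 1)%Z with (- n)%Z by lia.
    replace (- (n - 1))%Z with (- n + 1)%Z by lia. ring. }
  split; intros H n.
  - specialize (H (- n)%Z). rewrite E in H. unfold reflect in H.
    rewrite Z.opp_involutive in H. exact H.
  - rewrite E. apply H.
Qed.

Lemma wronskian_reflect a f g n :
  wronskian (reflect_a a) (reflect f) (reflect g) n = - wronskian a f g (- n - 1)%Z.
Proof.
  unfold wronskian, reflect_a, reflect.
  replace (- (n + 1))%Z with (- n - 1)%Z by lia.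
  replace (- n - 1 + 1)%Z with (- n)%Z by lia. ring.
Qed.

Lemma flux_reflect a u n :
  flux (reflect_a a) (reflect u) n = (- flux a u (- n - 1)%Z)%R.
Proof.
  unfold flux, reflect_a, reflect.
  replace (- (n + 1))%Z with (- n - 1)%Z by lia.
  replace (- n - 1 + 1)%Z with (- n)%Z by lia.
  destruct (u (- n)%Z), (u (- n - 1)%Z); simpl; ring.
Qed.

Lemma limit_circle_reflect a b :
  limit_circle (reflect_a a) (reflect b) plus_infty -> limit_circle a b minus_infty.
Proof.
  intros [z H]. exists z. intros u Hu.
  apply (H (reflect u)). apply solves_reflect, Hu.
Qed.

Lemma flux_nonneg (a b : Z -> R) (v : Z -> R) (theta phi : C -> Z -> C) z u :
  (forall n, (0 < a n)%R) -> fundamental_system a b theta phi -> Im z <> 0%R -> solves a b z u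
      ->
  square_summable_near minus_infty u ->
  (limit_circle a b minus_infty -> exists lambda : R,
     solves a b lambda (fun n => RtoC (v n)) /\ nontrivial (fun n => RtoC (v n))) ->
  (limit_circle a b minus_infty -> lim_at minus_infty (wronskian a (fun n => RtoC (v n)) u) 0)
      ->
  forall n, (0 <= Im z * flux a u n)%R.
Proof.
  intros Ha [Ht [Hp HW]] Hz Hu Hsu Hv Hbc n.
  assert (H : (Im z * flux (reflect_a a) (reflect u) (- n - 1)%Z <= 0)%R).
  { apply (flux_nonpos (reflect_a a) (reflect b) (reflect v)
      (fun z => reflect (phi z)) (fun z => reflect (theta z))); auto.
    - intros k; apply Ha.
    - split; [|split]; intros w; try (apply solves_reflect; auto).
      intros k. rewrite wronskian_reflect, wronskian_antisym, HW. ring.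
    - apply solves_reflect, Hu.
    - intros Hlc%limit_circle_reflect. destruct (Hv Hlc) as [lambda [H1 [k Hk]]].
      exists lambda. split.
      + apply (solves_reflect a b lambda (fun n => RtoC (v n))), H1.
      + exists (- k)%Z. unfold reflect. rewrite Z.opp_involutive. exact Hk.
    - intros Hlc%limit_circle_reflect. specialize (Hbc Hlc).
      apply lim_at_eps. intros eps Heps.
      destruct (proj1 (lim_at_eps _ _ _) Hbc eps Heps) as [N HN].
      exists N. intros k Hk. specialize (HN (S k) ltac:(lia)). simpl toward in *.
      rewrite (wronskian_reflect a (fun n => RtoC (v n)) u).
      replace (- Z.of_nat k - 1)%Z with (- Z.of_nat (S k))%Z by lia.
      rewrite <- Cmod_opp. eapply Rle_lt_trans; [|exact HN]. right; f_equal; simpl; ring. }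
  rewrite flux_reflect in H. replace (- (- n - 1) - 1)%Z with n in H by lia. lra.
Qed.

(** * Bounds for the Green function *)

Definition left_solution (H : jacobi_operator) (theta phi : C -> Z -> C) : Prop :=
  fundamental_system (ja H) (jb H) theta phi /\
  forall z, in_domain_near H minus_infty (phi z).

Lemma left_flux H theta phi z n : left_solution H theta phi -> Im z <> 0%R ->
  (Im z ^ 2 * Cmod (phi z n) ^ 2 <= Im z * flux (ja H) (phi z) n)%R.
Proof.
  intros [HF Hdom] Hz. pose proof HF as [_ [Hp _]]. destruct (Hdom z) as [Hs Hbc].
  rewrite (flux_step (ja H) (jb H) z (phi z) n (Hp z)).
  pose proof (flux_nonneg (ja H) (jb H) (jv H minus_infty) theta phi z (phi z)
    (ja_pos H) HF Hz (Hp z) Hs (jv_spec H minus_infty) Hbc (n - 1)%Z). nra.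
Qed.

Lemma right_flux H theta phi u z n : left_solution H theta phi -> weyl_solution H u ->
  Im z <> 0%R ->
  (Im z * flux (ja H) (u z) n <= - (Im z ^ 2 * Cmod (u z (n + 1)%Z) ^ 2))%R.
Proof.
  intros [HF _] Hu Hz. destruct (Hu z Hz) as [Hsol [_ [Hs Hbc]]].
  pose proof (flux_nonpos (ja H) (jb H) (jv H plus_infty) theta phi z (u z)
    (ja_pos H) HF Hz Hsol Hs (jv_spec H plus_infty) Hbc (n + 1)%Z) as Hn.
  rewrite (flux_step (ja H) (jb H) z (u z) (n + 1)%Z Hsol) in Hn.
  replace (n + 1 - 1)%Z with n in Hn by lia. nra.
Qed.

Lemma Cmod_eq_0_of_sqr (y : R) (c : C) : y <> 0%R -> (y ^ 2 * Cmod c ^ 2 <= 0)%R -> c = 0.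
Proof.
  intros Hy H. apply Cmod_eq_0.
  assert (Hy2 : (0 < y ^ 2)%R) by (rewrite <- Rsqr_pow2; apply Rsqr_pos_lt, Hy).
  destruct (Rle_lt_or_eq_dec 0 (Cmod c) (Cmod_ge_0 c)) as [Hc | <-]; [|reflexivity].
  assert (0 < y ^ 2 * Cmod c ^ 2)%R; [|lra].
  apply Rmult_lt_0_compat; [exact Hy2 | apply pow_lt, Hc].
Qed.

Lemma left_solution_neq_0 H theta phi z n : left_solution H theta phi -> Im z <> 0%R ->
  phi z n <> 0.
Proof.
  intros HL Hz E. pose proof HL as [[_ [_ HW]] _].
  pose proof (left_flux H theta phi z (n - 1)%Z HL Hz) as Hf.
  unfold flux in Hf. replace (n - 1 + 1)%Z with n in Hf by lia. rewrite E in Hf.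
  rewrite Cmult_0_r in Hf. simpl (Im 0) in Hf. rewrite !Rmult_0_r in Hf.
  apply Cmod_eq_0_of_sqr in Hf; [|exact Hz].
  pose proof (HW z (n - 1)%Z) as HW1. unfold wronskian in HW1.
  replace (n - 1 + 1)%Z with n in HW1 by lia. rewrite E, Hf in HW1.
  apply (f_equal Re) in HW1. simpl in HW1. lra.
Qed.

Lemma weyl_solution_neq_0 H theta phi u z n : left_solution H theta phi -> weyl_solution H u ->
  Im z <> 0%R -> u z n <> 0.
Proof.
  intros HL Hu Hz E. pose proof HL as [[Ht [Hp HW]] _].
  pose proof (right_flux H theta phi u z n HL Hu Hz) as Hf.
  assert (E0 : flux (ja H) (u z) n = 0%R) by (unfold flux; rewrite E; simpl; ring).
  rewrite E0, Rmult_0_r in Hf.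
  assert (E1 : u z (n + 1)%Z = 0) by (apply (Cmod_eq_0_of_sqr (Im z)); [exact Hz | lra]).
  destruct (Hu z Hz) as [Hsol [[k Hk] _]]. apply Hk.
  destruct (wronskian_expand (ja H) (theta z) (phi z) (u z) k (HW z k)) as [-> _].
  rewrite (wronskian_constant (ja H) (jb H) z (theta z) (u z) k n (Ht z) Hsol).
  rewrite (wronskian_constant (ja H) (jb H) z (phi z) (u z) k n (Hp z) Hsol).
  unfold wronskian. rewrite E, E1. ring.
Qed.

(** The two logarithmic derivatives [a phi(n+1)/phi(n)] and [a u(n+1)/u(n)]
    have imaginary parts of opposite signs, and that of the first is at least
    [|Im z|] in absolute value. *)
Lemma wronskian_lower_bound H theta phi u z n : left_solution H theta phi -> weyl_solution H u
    ->
  Im z <> 0%R ->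
  (Rabs (Im z) * (Cmod (phi z n) * Cmod (u z n)) <= Cmod (wronskian (ja H) (phi z) (u z) n))%R.
Proof.
  intros HL Hu Hz.
  pose proof (left_flux H theta phi z n HL Hz) as Hf.
  pose proof (right_flux H theta phi u z n HL Hu Hz) as Hg.
  pose proof (proj1 (Cmod_gt_0 _) (left_solution_neq_0 H theta phi z n HL Hz)) as Hp0.
  pose proof (proj1 (Cmod_gt_0 _) (weyl_solution_neq_0 H theta phi u z n HL Hu Hz)) as Hu0.
  set (W := wronskian (ja H) (phi z) (u z) n).
  assert (E : Im (Cconj (phi z n) * Cconj (u z n) * W) =
    (Cmod (phi z n) ^ 2 * flux (ja H) (u z) n - Cmod (u z n) ^ 2 * flux (ja H) (phi z) n)%R).
  { unfold W, wronskian, flux. rewrite !Cmod2_alt.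
    destruct (phi z n) as [p1 p2], (u z n) as [u1 u2], (phi z (n + 1)%Z) as [p3 p4],
      (u z (n + 1)%Z) as [u3 u4]. simpl. ring. }
  assert (H1 : (Rabs (Im (Cconj (phi z n) * Cconj (u z n) * W)) <= Cmod (phi z n) * Cmod (u z
      n) * Cmod W)%R).
  { eapply Rle_trans; [eapply Rle_trans; [apply Rmax_r | apply Rmax_Cmod] |].
    rewrite !Cmod_mult, !Cmod_conj. apply Rle_refl. }
  rewrite E in H1. set (X := (_ - _)%R) in H1.
  set (p := Cmod (phi z n)) in *. set (q := Cmod (u z n)) in *.
  pose proof (Rabs_pos_lt _ Hz) as Hy.
  assert (H2 : (Im z ^ 2 * (p ^ 2 * q ^ 2) <= - (Im z * X))%R).
  { pose proof (pow2_ge_0 q). pose proof (pow2_ge_0 p).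
    assert (A1 : (q ^ 2 * (Im z ^ 2 * p ^ 2) <= q ^ 2 * (Im z * flux (ja H) (phi z) n))%R)
      by (apply Rmult_le_compat_l; lra).
    assert (A2 : (0 <= p ^ 2 * - (Im z * flux (ja H) (u z) n))%R).
    { apply Rmult_le_pos; [lra |]. pose proof (pow2_ge_0 (Im z * Cmod (u z (n + 1)%Z))). nra. }
    unfold X. lra. }
  assert (H3 : (- (Im z * X) <= Rabs (Im z) * (p * q * Cmod W))%R).
  { eapply Rle_trans; [apply Rle_abs |]. rewrite Rabs_Ropp, Rabs_mult.
    apply Rmult_le_compat_l; [lra | exact H1]. }
  assert (E2 : (Im z ^ 2 = Rabs (Im z) * Rabs (Im z))%R).
  { rewrite <- Rabs_mult, Rabs_pos_eq; [ring | nra]. }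
  rewrite E2 in H2.
  apply (Rmult_le_reg_l (Rabs (Im z) * (p * q))); [apply Rmult_lt_0_compat; [lra | nra] |].
  lra.
Qed.

(** The diagonal of the Green function is [phi (theta + M phi)], and it is
    bounded by [1 / |Im z|]; dividing by [phi^2] gives the asymptotics of
    the singular Weyl function. *)
Lemma singular_weyl_bound H theta phi u z n : left_solution H theta phi -> weyl_solution H u ->
  Im z <> 0%R ->
  (Cmod ((singular_weyl H theta phi u z + theta z n / phi z n) * (phi z n * phi z n))
     <= / Rabs (Im z))%R.
Proof.
  intros HL Hu Hz. pose proof HL as [[Ht [Hp HW]] _].
  destruct (Hu z Hz) as [Hsol _].
  pose proof (left_solution_neq_0 H theta phi z n HL Hz) as Hp0.
  pose proof (weyl_solution_neq_0 H theta phi u z n HL Hu Hz) as Hu0.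
  pose proof (wronskian_lower_bound H theta phi u z n HL Hu Hz) as Hlow.
  pose proof (proj1 (Cmod_gt_0 _) Hp0) as Hpp. pose proof (proj1 (Cmod_gt_0 _) Hu0) as Hup.
  pose proof (Rabs_pos_lt _ Hz) as Hy.
  assert (HWpos : (0 < Cmod (wronskian (ja H) (phi z) (u z) n))%R).
  { eapply Rlt_le_trans; [|exact Hlow]. apply Rmult_lt_0_compat; [lra |].
    apply Rmult_lt_0_compat; assumption. }
  assert (HWne : wronskian (ja H) (phi z) (u z) n <> 0) by (apply Cmod_gt_0; exact HWpos).
  unfold singular_weyl.
  rewrite (wronskian_constant (ja H) (jb H) z (theta z) (u z) 0 n (Ht z) Hsol).
  rewrite (wronskian_constant (ja H) (jb H) z (phi z) (u z) 0 n (Hp z) Hsol).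
  destruct (wronskian_expand (ja H) (theta z) (phi z) (u z) n (HW z n)) as [Eu _].
  set (A := wronskian (ja H) (theta z) (u z) n) in *.
  set (B := wronskian (ja H) (phi z) (u z) n) in *.
  replace ((- A / B + theta z n / phi z n) * (phi z n * phi z n)) with
    (- (A * phi z n - B * theta z n) * phi z n / B) by (field; split; assumption).
  rewrite <- Eu. rewrite Cmod_div by exact HWne. rewrite Cmod_mult, Cmod_opp.
  apply (Rmult_le_reg_r (Cmod B * Rabs (Im z))); [apply Rmult_lt_0_compat; assumption |].
  replace (Cmod (u z n) * Cmod (phi z n) / Cmod B * (Cmod B * Rabs (Im z)))%R with
    (Rabs (Im z) * (Cmod (phi z n) * Cmod (u z n)))%R by (field; lra).
  replace (/ Rabs (Im z) * (Cmod B * Rabs (Im z)))%R with (Cmod B) by (field; lra).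
  exact Hlow.
Qed.

Lemma left_ratio_bound H theta phi z n : left_solution H theta phi -> Im z <> 0%R ->
  (Rabs (Im z) * Cmod (phi z n) <= ja H n * Cmod (phi z (n + 1)%Z))%R.
Proof.
  intros HL Hz.
  pose proof (left_flux H theta phi z n HL Hz) as Hf.
  pose proof (proj1 (Cmod_gt_0 _) (left_solution_neq_0 H theta phi z n HL Hz)) as Hp0.
  pose proof (flux_bound (ja H) (phi z) n (ja_pos H n)) as Hb.
  pose proof (Rabs_pos_lt _ Hz) as Hy.
  assert (H1 : (Im z * flux (ja H) (phi z) n <= Rabs (Im z) * (ja H n * (Cmod (phi z n) * Cmod
      (phi z (n + 1)%Z))))%R).
  { eapply Rle_trans; [apply Rle_abs |]. rewrite Rabs_mult. apply Rmult_le_compat_l; lra. }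
  assert (E2 : (Im z ^ 2 = Rabs (Im z) * Rabs (Im z))%R).
  { rewrite <- Rabs_mult, Rabs_pos_eq; [ring | nra]. }
  rewrite E2 in Hf.
  apply (Rmult_le_reg_l (Rabs (Im z) * Cmod (phi z n))); [apply Rmult_lt_0_compat; lra |].
  lra.
Qed.

Lemma left_ratio_expansion H theta phi z n : left_solution H theta phi -> Im z <> 0%R ->
  (Cmod (ja H n * phi z (n + 1)%Z / phi z n - z) <=
   Rabs (jb H n) + ja H (n - 1)%Z * ja H (n - 1)%Z / Rabs (Im z))%R.
Proof.
  intros HL Hz. pose proof HL as [[_ [Hp _]] _].
  pose proof (left_solution_neq_0 H theta phi z n HL Hz) as Hp0.
  pose proof (proj1 (Cmod_gt_0 _) Hp0) as Hpp. pose proof (Rabs_pos_lt _ Hz) as Hy.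
  pose proof (left_ratio_bound H theta phi z (n - 1)%Z HL Hz) as Hb.
  replace (n - 1 + 1)%Z with n in Hb by lia.
  specialize (Hp z n). unfold tau in Hp.
  replace (ja H n * phi z (n + 1)%Z / phi z n - z) with
    (- (jb H n + ja H (n - 1)%Z * (phi z (n - 1)%Z / phi z n))).
  2:{ transitivity ((ja H n * phi z (n + 1)%Z - z * phi z n) / phi z n); [|field; exact Hp0].
      rewrite <- Hp. field; exact Hp0. }
  rewrite Cmod_opp. eapply Rle_trans; [apply Cmod_triangle |].
  rewrite Cmod_mult, !Cmod_R, Cmod_div by exact Hp0.
  rewrite (Rabs_pos_eq (ja H (n - 1)%Z)) by apply Rlt_le, ja_pos.
  apply Rplus_le_compat_l. unfold Rdiv at 2. rewrite Rmult_assoc.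
  apply Rmult_le_compat_l; [apply Rlt_le, ja_pos |].
  apply (Rmult_le_reg_l (Rabs (Im z) * Cmod (phi z n))); [apply Rmult_lt_0_compat; lra |].
  replace (Rabs (Im z) * Cmod (phi z n) * (Cmod (phi z (n - 1)%Z) / Cmod (phi z n)))%R
    with (Rabs (Im z) * Cmod (phi z (n - 1)%Z))%R by (field; lra).
  replace (Rabs (Im z) * Cmod (phi z n) * (ja H (n - 1)%Z * / Rabs (Im z)))%R
    with (ja H (n - 1)%Z * Cmod (phi z n))%R by (field; lra).
  exact Hb.
Qed.

(** * Asymptotics off the real axis *)

Lemma tends_in_const S c : tends_in S (fun _ => c) c.
Proof.
  intros eps Heps. exists 0%R. intros z _ _.
  replace (c - c) with (RtoC 0) by ring. rewrite Cmod_0; exact Heps.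
Qed.

Lemma tends_in_ext S r0 f g l :
  (forall z, S z -> (r0 < Cmod z)%R -> f z = g z) -> tends_in S f l -> tends_in S g l.
Proof.
  intros Hfg Hf eps Heps. destruct (Hf eps Heps) as [r Hr]. exists (Rmax r0 r). intros z Hz Hzr.
  rewrite <- (Hfg z Hz (Rle_lt_trans _ _ _ (Rmax_l _ _) Hzr)).
  apply Hr; [exact Hz | exact (Rle_lt_trans _ _ _ (Rmax_r _ _) Hzr)].
Qed.

Lemma tends_in_plus S f g l k : tends_in S f l -> tends_in S g k ->
  tends_in S (fun z => f z + g z) (l + k).
Proof.
  intros Hf Hg eps Heps.
  destruct (Hf (eps / 2)%R ltac:(lra)) as [r Hr], (Hg (eps / 2)%R ltac:(lra)) as [t Ht].
  exists (Rmax r t). intros z Hz Hzr.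
  specialize (Hr z Hz (Rle_lt_trans _ _ _ (Rmax_l _ _) Hzr)).
  specialize (Ht z Hz (Rle_lt_trans _ _ _ (Rmax_r _ _) Hzr)).
  replace (f z + g z - (l + k)) with ((f z - l) + (g z - k)) by ring.
  eapply Rle_lt_trans; [apply Cmod_triangle |]. lra.
Qed.

Lemma tends_in_mult S f g l k : tends_in S f l -> tends_in S g k ->
  tends_in S (fun z => f z * g z) (l * k).
Proof.
  intros Hf Hg eps Heps.
  pose proof (Cmod_ge_0 l) as Hl. pose proof (Cmod_ge_0 k) as Hk.
  set (e := Rmin 1 (eps / (Cmod l + Cmod k + 2))).
  assert (He : (0 < e)%R) by (apply Rmin_pos; [lra | apply Rdiv_lt_0_compat; lra]).
  assert (He1 : (e <= 1)%R) by apply Rmin_l.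
  assert (He2 : (e * (Cmod l + Cmod k + 2) <= eps)%R).
  { apply Rle_trans with (eps / (Cmod l + Cmod k + 2) * (Cmod l + Cmod k + 2))%R.
    - apply Rmult_le_compat_r; [lra | apply Rmin_r].
    - right; field; lra. }
  destruct (Hf e He) as [r Hr], (Hg e He) as [t Ht].
  exists (Rmax r t). intros z Hz Hzr.
  specialize (Hr z Hz (Rle_lt_trans _ _ _ (Rmax_l _ _) Hzr)).
  specialize (Ht z Hz (Rle_lt_trans _ _ _ (Rmax_r _ _) Hzr)).
  replace (f z * g z - l * k) with ((f z - l) * (g z - k) + (l * (g z - k) + k * (f z - l))) by
      ring.
  eapply Rle_lt_trans; [apply Cmod_triangle |].
  eapply Rle_lt_trans; [apply Rplus_le_compat_l, Cmod_triangle |]. rewrite !Cmod_mult.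
  pose proof (Cmod_ge_0 (f z - l)). pose proof (Cmod_ge_0 (g z - k)). nra.
Qed.

Lemma tends_in_minus S f g l k : tends_in S f l -> tends_in S g k ->
  tends_in S (fun z => f z - g z) (l - k).
Proof.
  intros Hf Hg. replace (l - k) with (l + (- (1)) * k) by ring.
  apply (tends_in_ext S 0 (fun z => f z + (- (1)) * g z)); [intros; ring |].
  apply tends_in_plus; [exact Hf |]. apply tends_in_mult; [apply tends_in_const | exact Hg].
Qed.

Lemma tends_in_inv S (f : C -> C) (l : C) : l <> 0 -> tends_in S f l -> tends_in S (fun z => /
    f z) (/ l).
Proof.
  intros Hl Hf eps Heps. pose proof (proj1 (Cmod_gt_0 l) Hl) as Hlp.
  set (e := Rmin (Cmod l / 2) (eps * (Cmod l * Cmod l) / 4)).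
  assert (He : (0 < e)%R).
  { apply Rmin_pos; [lra |]. apply Rdiv_lt_0_compat; [|lra].
    apply Rmult_lt_0_compat; [lra | apply Rmult_lt_0_compat; lra]. }
  assert (He1 : (e <= Cmod l / 2)%R) by apply Rmin_l.
  assert (He2 : (e <= eps * (Cmod l * Cmod l) / 4)%R) by apply Rmin_r.
  destruct (Hf e He) as [r Hr]. exists r. intros z Hz Hzr. specialize (Hr z Hz Hzr).
  assert (Hfz : (Cmod l / 2 <= Cmod (f z))%R).
  { pose proof (Cmod_triangle (f z) (l - f z)) as T. replace (f z + (l - f z)) with l in T by
      ring.
    replace (l - f z) with (- (f z - l)) in T by ring. rewrite Cmod_opp in T. lra. }
  assert (Hfne : f z <> 0) by (apply Cmod_gt_0; lra).
  replace (/ f z - / l) with (- (f z - l) / (f z * l)) by (field; split; assumption).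
  rewrite Cmod_div by (apply Cmult_neq_0; assumption). rewrite Cmod_opp, Cmod_mult.
  apply (Rmult_lt_reg_r (Cmod (f z) * Cmod l)); [apply Rmult_lt_0_compat; lra |].
  replace (Cmod (f z - l) / (Cmod (f z) * Cmod l) * (Cmod (f z) * Cmod l))%R with (Cmod (f z -
      l))
    by (field; lra).
  apply Rlt_le_trans with (eps * (Cmod l * Cmod l) / 4 * 2)%R.
  - assert (0 < eps * (Cmod l * Cmod l))%R by (apply Rmult_lt_0_compat; [lra | apply
      Rmult_lt_0_compat; lra]). lra.
  - apply Rle_trans with (eps * (Cmod l / 2 * Cmod l))%R; [right; field |].
    apply Rmult_le_compat_l; [lra |]. apply Rmult_le_compat_r; lra.
Qed.

Lemma tends_in_of_bound S f l K r0 :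
  (forall z, S z -> (r0 < Cmod z)%R -> (Cmod (f z - l) <= K / Cmod z)%R) -> tends_in S f l.
Proof.
  intros H eps Heps. exists (Rmax r0 (Rmax 1 (2 * K / eps))). intros z Hz Hzr.
  assert (H0 := Rle_lt_trans _ _ _ (Rmax_l _ _) Hzr).
  assert (Hzr' := Rle_lt_trans _ _ _ (Rmax_r _ _) Hzr).
  assert (H1 := Rle_lt_trans _ _ _ (Rmax_l _ _) Hzr').
  assert (H2 := Rle_lt_trans _ _ _ (Rmax_r _ _) Hzr').
  eapply Rle_lt_trans; [apply (H z Hz H0) |].
  apply (Rmult_lt_reg_r (Cmod z)); [lra |].
  replace (K / Cmod z * Cmod z)%R with K by (field; lra).
  apply (Rmult_lt_compat_l (eps / 2)) in H2; [|lra].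
  replace (eps / 2 * (2 * K / eps))%R with K in H2 by (field; lra). nra.
Qed.

Lemma tends_in_unique S f l k : (forall r, exists z, S z /\ (r < Cmod z)%R) ->
  tends_in S f l -> tends_in S f k -> l = k.
Proof.
  intros HS Hf Hg. replace l with ((l - k) + k) by ring.
  replace (l - k) with (RtoC 0); [ring |]. symmetry.
  apply Cmod_eq_0, Rle_antisym; [| apply Cmod_ge_0].
  apply le_epsilon. intros eps Heps. rewrite Rplus_0_l.
  destruct (Hf (eps / 2)%R ltac:(lra)) as [r Hr], (Hg (eps / 2)%R ltac:(lra)) as [t Ht].
  destruct (HS (Rmax r t)) as [z [Hz Hzr]].
  specialize (Hr z Hz (Rle_lt_trans _ _ _ (Rmax_l _ _) Hzr)).
  specialize (Ht z Hz (Rle_lt_trans _ _ _ (Rmax_r _ _) Hzr)).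
  replace (l - k) with (- (f z - l) + (f z - k)) by ring.
  eapply Rle_trans; [apply Cmod_triangle |]. rewrite Cmod_opp. lra.
Qed.

(** Non-real rays and the sectors of the theorem are both of this kind; it
    turns the bounds by [1 / |Im z|] into limits. *)
Definition off_axis (S : C -> Prop) : Prop :=
  exists kap, (0 < kap)%R /\ forall z, S z -> (kap * Cmod z <= Rabs (Im z))%R.

Lemma off_axis_Im S z : off_axis S -> S z -> (0 < Cmod z)%R -> Im z <> 0%R.
Proof.
  intros [kap [Hk H]] Hz Hzr E. specialize (H z Hz). rewrite E, Rabs_R0 in H.
  assert (0 < kap * Cmod z)%R by (apply Rmult_lt_0_compat; assumption). lra.
Qed.

Lemma Cmod_ray alpha z : ray alpha z ->
  exists r, (0 <= r)%R /\ z = ((r * cos alpha)%R, (r * sin alpha)%R) /\ Cmod z = r.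
Proof.
  intros [r [Hr ->]]. exists r. repeat split; [exact Hr |].
  unfold Cmod; simpl fst; simpl snd. rewrite <- (sqrt_Rsqr r) at 3 by exact Hr. f_equal.
  pose proof (sin2_cos2 alpha) as E. unfold Rsqr in *.
  replace ((r * cos alpha) ^ 2 + (r * sin alpha) ^ 2)%R with
    (r * r * (sin alpha * sin alpha + cos alpha * cos alpha))%R by ring.
  rewrite E; ring.
Qed.

Lemma off_axis_ray alpha : sin alpha <> 0%R -> off_axis (ray alpha).
Proof.
  intros Hs. exists (Rabs (sin alpha)). split; [apply Rabs_pos_lt, Hs |].
  intros z Hz. destruct (Cmod_ray alpha z Hz) as [r [Hr [-> ->]]]. simpl.
  rewrite Rabs_mult, (Rabs_pos_eq r) by exact Hr. lra.
Qed.

Lemma ray_unbounded alpha r : exists z, ray alpha z /\ (r < Cmod z)%R.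
Proof.
  exists (Cexp (ln (Rmax 1 r) + 1, alpha)%R). split; [apply ray_Cexp |].
  rewrite Cmod_Cexp. simpl. apply Rle_lt_trans with (Rmax 1 r); [apply Rmax_r |].
  rewrite <- (exp_ln (Rmax 1 r)) at 1 by (eapply Rlt_le_trans; [|apply Rmax_l]; lra).
  apply exp_increasing; lra.
Qed.

Lemma off_axis_sector delta : (0 < delta)%R -> off_axis (sector delta).
Proof.
  intros Hd. exists (delta / (1 + delta))%R. split; [apply Rdiv_lt_0_compat; lra |].
  intros z Hz. unfold sector in Hz. pose proof (Cmod_le_abs z).
  apply (Rmult_le_reg_r (1 + delta)); [lra |].
  replace (delta / (1 + delta) * Cmod z * (1 + delta))%R with (delta * Cmod z)%R by (field;
      lra). nra.
Qed.

Lemma ray_in_sector alpha delta z : (delta <= Rabs (sin alpha))%R -> (0 < delta)%R ->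
  ray alpha z -> sector delta z.
Proof.
  intros Hd Hd0 [r [Hr ->]]. unfold sector; simpl. rewrite !Rabs_mult, (Rabs_pos_eq r) by exact
      Hr.
  pose proof (COS_bound alpha).
  assert (Hc : (Rabs (cos alpha) <= 1)%R) by (apply Rabs_le; lra). pose proof (Rabs_pos (cos
      alpha)).
  assert (delta * Rabs (cos alpha) <= Rabs (sin alpha))%R by nra. nra.
Qed.

Lemma left_ratio_tends_0 H theta phi n S : left_solution H theta phi -> off_axis S ->
  tends_in S (fun z => phi z n / phi z (n + 1)%Z) 0.
Proof.
  intros HL HS. pose proof HS as [kap [Hk Hkap]].
  apply (tends_in_of_bound S _ 0 (ja H n / kap) 0). intros z Hz Hzr.
  pose proof (off_axis_Im S z HS Hz Hzr) as Him. specialize (Hkap z Hz).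
  pose proof (left_ratio_bound H theta phi z n HL Him) as Hb.
  pose proof (left_solution_neq_0 H theta phi z (n + 1)%Z HL Him) as Hne.
  pose proof (proj1 (Cmod_gt_0 _) Hne) as Hpos.
  replace (phi z n / phi z (n + 1)%Z - 0) with (phi z n / phi z (n + 1)%Z) by ring.
  rewrite Cmod_div by exact Hne.
  apply (Rmult_le_reg_r (kap * Cmod z * Cmod (phi z (n + 1)%Z)));
    [repeat apply Rmult_lt_0_compat; assumption |].
  replace (Cmod (phi z n) / Cmod (phi z (n + 1)%Z) * (kap * Cmod z * Cmod (phi z (n + 1)%Z)))%R
    with (kap * Cmod z * Cmod (phi z n))%R by (field; lra).
  replace (ja H n / kap / Cmod z * (kap * Cmod z * Cmod (phi z (n + 1)%Z)))%R
    with (ja H n * Cmod (phi z (n + 1)%Z))%R by (field; lra).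
  eapply Rle_trans; [|exact Hb]. apply Rmult_le_compat_r; [apply Cmod_ge_0 | exact Hkap].
Qed.

Lemma left_ratio_asymptotics H theta phi n S : left_solution H theta phi -> off_axis S ->
  tends_in S (fun z => ja H n * phi z (n + 1)%Z / (z * phi z n)) 1.
Proof.
  intros HL HS. pose proof HS as [kap [Hk Hkap]].
  set (a' := (ja H (n - 1)%Z * ja H (n - 1)%Z)%R).
  assert (Ha' : (0 <= a')%R) by (unfold a'; apply Rlt_le, Rmult_lt_0_compat; apply ja_pos).
  apply (tends_in_of_bound S _ 1 (Rabs (jb H n) + a' / kap) 1). intros z Hz Hzr.
  pose proof (off_axis_Im S z HS Hz ltac:(lra)) as Him. specialize (Hkap z Hz).
  pose proof (left_ratio_expansion H theta phi z n HL Him) as Hb. fold a' in Hb.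
  pose proof (left_solution_neq_0 H theta phi z n HL Him) as Hne.
  assert (Hz0 : z <> 0) by (apply Cmod_gt_0; lra).
  replace (ja H n * phi z (n + 1)%Z / (z * phi z n) - 1) with
    ((ja H n * phi z (n + 1)%Z / phi z n - z) / z) by (field; split; assumption).
  rewrite Cmod_div by exact Hz0. unfold Rdiv at 1 2.
  apply Rmult_le_compat_r; [apply Rlt_le, Rinv_0_lt_compat; lra |].
  eapply Rle_trans; [exact Hb |]. apply Rplus_le_compat_l.
  apply Rmult_le_compat_l; [exact Ha' |]. apply Rinv_le_contravar; [exact Hk |].
  apply Rle_trans with (kap * Cmod z)%R; [|exact Hkap]. nra.
Qed.

Lemma green_tends_0 H theta phi u n S : left_solution H theta phi -> weyl_solution H u ->
    off_axis S ->
  tends_in S (fun z => (singular_weyl H theta phi u z + theta z n / phi z n) * (phi z n * phi z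
      n)) 0.
Proof.
  intros HL HU HS. pose proof HS as [kap [Hk Hkap]].
  apply (tends_in_of_bound S _ 0 (/ kap) 0). intros z Hz Hzr.
  pose proof (off_axis_Im S z HS Hz Hzr) as Him. specialize (Hkap z Hz).
  replace (((singular_weyl H theta phi u z + theta z n / phi z n) * (phi z n * phi z n)) - 0)
    with ((singular_weyl H theta phi u z + theta z n / phi z n) * (phi z n * phi z n)) by ring.
  eapply Rle_trans; [apply (singular_weyl_bound H theta phi u z n HL HU Him) |].
  unfold Rdiv. rewrite <- Rinv_mult. apply Rinv_le_contravar; [|exact Hkap].
  apply Rmult_lt_0_compat; assumption.
Qed.

(** A ring for which membership of a quotient would need a factorization
    theorem; this is why the quotients below are written as polynomials. *)
Definition tame (s : R) (f : C -> C) : Prop := entire f /\ growth_order_le s f.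

Lemma tame_const s c : (0 < s)%R -> tame s (fun _ => c).
Proof. intros Hs; split; [apply entire_const | apply growth_order_le_const, Hs]. Qed.

Lemma tame_plus s f g : (0 < s)%R -> tame s f -> tame s g -> tame s (fun z => f z + g z).
Proof.
  intros Hs [] []; split; [apply entire_plus | apply growth_order_le_plus]; assumption.
Qed.

Lemma tame_minus s f g : (0 < s)%R -> tame s f -> tame s g -> tame s (fun z => f z - g z).
Proof.
  intros Hs [] []; split; [apply entire_minus | apply growth_order_le_minus]; assumption.
Qed.

Lemma tame_mult s f g : (0 < s)%R -> tame s f -> tame s g -> tame s (fun z => f z * g z).
Proof.
  intros Hs [] []; split; [apply entire_mult | apply growth_order_le_mult]; assumption.
Qed.

Lemma tame_wronskian s a f g n : (0 < s)%R ->
  (forall k, tame s (fun z => f z k)) -> (forall k, tame s (fun z => g z k)) ->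
  tame s (fun z => wronskian a (f z) (g z) n).
Proof.
  intros Hs Hf Hg. unfold wronskian. apply tame_mult; [exact Hs | apply tame_const, Hs |].
  apply tame_minus; [exact Hs | |]; apply tame_mult; auto.
Qed.

Lemma solution_tame s a b phi : (0 < s)%R -> (forall n, (0 < a n)%R) ->
  real_entire_solution a b phi -> solution_growth_order_le s phi ->
  forall n, tame s (fun z => phi z n).
Proof.
  intros Hs Ha [Hsol Hent] [n0 [G0 G1]].
  assert (Han : forall n, RtoC (a n) <> 0).
  { intros n E. apply (f_equal Re) in E. simpl in E. pose proof (Ha n). lra. }
  set (G := fun n => growth_order_le s (fun z => phi z n)).
  assert (Hup : forall n, G (n - 1)%Z -> G n -> G (n + 1)%Z).
  { intros n H1 H2.
    apply (growth_order_le_ext s (fun z => / a n * (z * phi z n - a (n - 1)%Z * phi z (n - 1)%Z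
        - b n * phi z n))).
    - intros z. rewrite <- (Hsol z n). unfold tau. field. apply Han.
    - apply growth_order_le_mult; [exact Hs | apply growth_order_le_const, Hs |].
      repeat apply growth_order_le_minus; try exact Hs; apply growth_order_le_mult;
        try exact Hs; try (apply growth_order_le_const, Hs); try (apply growth_order_le_id,
            Hs); assumption. }
  assert (Hdown : forall n, G n -> G (n + 1)%Z -> G (n - 1)%Z).
  { intros n H1 H2.
    apply (growth_order_le_ext s (fun z => / a (n - 1)%Z * (z * phi z n - a n * phi z (n + 1)%Z
        - b n * phi z n))).
    - intros z. rewrite <- (Hsol z n). unfold tau. field. apply Han.
    - apply growth_order_le_mult; [exact Hs | apply growth_order_le_const, Hs |].
      repeat apply growth_order_le_minus; try exact Hs; apply growth_order_le_mult;
        try exact Hs; try (apply growth_order_le_const, Hs); try (apply growth_order_le_id,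
            Hs); assumption. }
  assert (Hpos : forall k : nat, G (n0 + Z.of_nat k)%Z /\ G (n0 + Z.of_nat k + 1)%Z).
  { induction k as [|k [IH1 IH2]]; [rewrite Z.add_0_r; auto |].
    replace (n0 + Z.of_nat (S k))%Z with (n0 + Z.of_nat k + 1)%Z by lia. split; [exact IH2 |].
    apply Hup; [|exact IH2]. replace (n0 + Z.of_nat k + 1 - 1)%Z with (n0 + Z.of_nat k)%Z by
        lia. exact IH1. }
  assert (Hneg : forall k : nat, G (n0 - Z.of_nat k)%Z /\ G (n0 - Z.of_nat k + 1)%Z).
  { induction k as [|k [IH1 IH2]]; [rewrite Z.sub_0_r; auto |].
    replace (n0 - Z.of_nat (S k))%Z with (n0 - Z.of_nat k - 1)%Z by lia. split; [apply Hdown;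
        assumption |].
    replace (n0 - Z.of_nat k - 1 + 1)%Z with (n0 - Z.of_nat k)%Z by lia. exact IH1. }
  intros n. split; [apply Hent |]. change (G n).
  destruct (Z_le_dec n0 n).
  - replace n with (n0 + Z.of_nat (Z.to_nat (n - n0)))%Z by lia. apply Hpos.
  - replace n with (n0 - Z.of_nat (Z.to_nat (n0 - n)))%Z by lia. apply Hneg.
Qed.

(** * From the Weyl functions to the coefficients *)

Lemma Ceq_of_minus (x y : C) : x - y = 0 -> x = y.
Proof. intros H. replace x with ((x - y) + y) by ring. rewrite H; ring. Qed.

Lemma RtoC_neq_0 (x : R) : x <> 0%R -> RtoC x <> 0.
Proof. intros Hx E. apply Hx. apply (f_equal Re) in E. exact E. Qed.

Lemma ja_neq_0 H n : RtoC (ja H n) <> 0.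
Proof. apply RtoC_neq_0. pose proof (ja_pos H n). lra. Qed.

Lemma left_ratio_next H0 H1 theta0 phi0 theta1 phi1 n S :
  left_solution H0 theta0 phi0 -> left_solution H1 theta1 phi1 -> off_axis S ->
  tends_in S (fun z => phi0 z n / phi1 z n) 1 ->
  tends_in S (fun z => phi1 z (n + 1)%Z / phi0 z (n + 1)%Z) (ja H0 n / ja H1 n).
Proof.
  intros L0 L1 HS Hr.
  pose proof (left_ratio_asymptotics H0 theta0 phi0 n S L0 HS) as A0.
  pose proof (left_ratio_asymptotics H1 theta1 phi1 n S L1 HS) as A1.
  pose proof C1_nz as H1nz.
  replace (ja H0 n / ja H1 n) with (ja H0 n / ja H1 n * (1 * (/ 1 * / 1))) by (field; apply
      ja_neq_0).
  eapply tends_in_ext; [| apply (tends_in_mult S _ _ _ _ (tends_in_const S (ja H0 n / ja H1 n))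
    (tends_in_mult S _ _ _ _ A1 (tends_in_mult S _ _ _ _ (tends_in_inv S _ _ H1nz A0)
       (tends_in_inv S _ _ H1nz Hr))))].
  intros z Hz Hzr. pose proof (off_axis_Im S z HS Hz Hzr) as Him.
  pose proof (left_solution_neq_0 H0 theta0 phi0 z n L0 Him).
  pose proof (left_solution_neq_0 H1 theta1 phi1 z n L1 Him).
  pose proof (left_solution_neq_0 H0 theta0 phi0 z (n + 1)%Z L0 Him).
  assert (z <> 0) by (apply Cmod_gt_0; exact Hzr).
  pose proof (ja_neq_0 H0 n). pose proof (ja_neq_0 H1 n).
  cbv beta. field. repeat split; assumption.
Qed.

Ltac solve_tame :=
  lazymatch goal with
  | |- tame ?s (fun z => @?f z - @?g z) => apply (tame_minus s f g); solve_tame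
  | |- tame ?s (fun z => @?f z + @?g z) => apply (tame_plus s f g); solve_tame
  | |- tame ?s (fun z => @?f z * @?g z) => apply (tame_mult s f g); solve_tame
  | |- tame _ (fun _ => ?c) => apply tame_const; assumption
  | |- _ => auto
  end.

(** The heart of the converse.  Cross-multiplying the difference of the Weyl
    functions gives an entire function that tends to [0] on the rays, so the
    two quotients [theta/phi] at [n + 1] differ exactly by [f].  The quotients
    [phi0/phi1] at [n + 1] and [(phi0(n) - phi1(n))/phi0(n+1)] are then
    polynomials in the solutions and [f], because the Wronskian identity is a
    Bezout relation, so that their growth is under control without any division. *)
Lemma left_solutions_agree H0 H1 theta0 phi0 u0 theta1 phi1 u1 f n s m alpha :
  (0 < s)%R -> left_solution H0 theta0 phi0 -> left_solution H1 theta1 phi1 ->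
  weyl_solution H0 u0 -> weyl_solution H1 u1 ->
  (forall k, tame s (fun z => theta0 z k)) -> (forall k, tame s (fun z => phi0 z k)) ->
  (forall k, tame s (fun z => theta1 z k)) -> (forall k, tame s (fun z => phi1 z k)) ->
  tame s f -> dissecting_rays (PI / s) m alpha ->
  (forall i, (i < m)%nat -> tends_in (ray (alpha i)) (fun z => phi0 z n / phi1 z n) 1) ->
  (forall i, (i < m)%nat -> tends_in (ray (alpha i))
     (fun z => (singular_weyl H1 theta1 phi1 u1 z - singular_weyl H0 theta0 phi0 u0 z - f z)
               * (phi0 z (n + 1)%Z * phi0 z (n + 1)%Z)) 0) ->
  forall z, phi0 z n = phi1 z n /\
    ja H0 n * phi0 z (n + 1)%Z = ja H1 n * phi1 z (n + 1)%Z.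
Proof.
  intros Hs L0 L1 U0 U1 T0 P0 T1 P1 Tf Hrays Hphi HM.
  assert (Hoff : forall i, (i < m)%nat -> off_axis (ray (alpha i))).
  { intros i Hi. apply off_axis_ray, (proj2 Hrays i Hi). }
  pose proof L0 as [[_ [_ W0]] _]. pose proof L1 as [[_ [_ W1]] _].
  pose proof (ja_neq_0 H0 n) as Ha0. pose proof (ja_neq_0 H1 n) as Ha1.
  set (a0 := RtoC (ja H0 n)) in *. set (a1 := RtoC (ja H1 n)) in *.
  assert (Hr : forall i, (i < m)%nat ->
    tends_in (ray (alpha i)) (fun z => phi1 z (n + 1)%Z / phi0 z (n + 1)%Z) (a0 / a1)).
  { intros i Hi. apply (left_ratio_next H0 H1 theta0 phi0 theta1 phi1); auto. }
  assert (Hrne : a0 / a1 <> 0).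
  { intros E. apply Ha0. replace a0 with (a0 / a1 * a1) by (field; exact Ha1). rewrite E; ring.
      }
  set (E := fun z => theta1 z (n + 1)%Z * phi0 z (n + 1)%Z - theta0 z (n + 1)%Z * phi1 z (n +
      1)%Z
    + f z * (phi0 z (n + 1)%Z * phi1 z (n + 1)%Z)).
  assert (HE : forall z, E z = 0).
  { assert (TE : tame s E).
    { unfold E. solve_tame. }
    apply (entire_limit_on_rays E 0 s m alpha Hs (proj1 TE) (proj2 TE) Hrays).
    intros i Hi. specialize (Hr i Hi). specialize (HM i Hi). specialize (Hoff i Hi).
    set (S := ray (alpha i)) in *.
    pose proof (green_tends_0 H0 theta0 phi0 u0 (n + 1)%Z S L0 U0 Hoff) as G0.
    pose proof (green_tends_0 H1 theta1 phi1 u1 (n + 1)%Z S L1 U1 Hoff) as G1.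
    pose proof (tends_in_minus S _ _ _ _ (tends_in_mult S _ _ _ _ (tends_in_inv S _ _ Hrne Hr)
        G1)
      (tends_in_mult S _ _ _ _ Hr (tends_in_plus S _ _ _ _ G0 HM))) as L.
    replace (/ (a0 / a1) * 0 - a0 / a1 * (0 + 0)) with (RtoC 0) in L by ring.
    revert L. apply (tends_in_ext S 0). intros z Hz Hzr.
    pose proof (off_axis_Im S z Hoff Hz Hzr) as Him.
    pose proof (left_solution_neq_0 H0 theta0 phi0 z (n + 1)%Z L0 Him).
    pose proof (left_solution_neq_0 H1 theta1 phi1 z (n + 1)%Z L1 Him).
    unfold E. field. split; assumption. }
  set (t1' := fun z => theta1 z n + f z * phi1 z n).
  assert (Tt : tame s t1') by (unfold t1'; solve_tame).
  set (F := fun z => a1 * (t1' z * phi0 z (n + 1)%Z - phi1 z n * theta0 z (n + 1)%Z)).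
  assert (HW0 : forall z, a0 * (theta0 z n * phi0 z (n + 1)%Z - theta0 z (n + 1)%Z * phi0 z n)
      = 1)
    by (intros z; apply W0).
  assert (HW1 : forall z, a1 * (theta1 z n * phi1 z (n + 1)%Z - theta1 z (n + 1)%Z * phi1 z n)
      = 1)
    by (intros z; apply W1).
  assert (HF1 : forall z, F z * phi1 z (n + 1)%Z = phi0 z (n + 1)%Z).
  { intros z. apply Ceq_of_minus.
    transitivity (phi0 z (n + 1)%Z *
      (a1 * (theta1 z n * phi1 z (n + 1)%Z - theta1 z (n + 1)%Z * phi1 z n) - 1) + a1 * phi1 z
          n * E z).
    - unfold F, E, t1'. ring.
    - rewrite HW1, HE; ring. }
  assert (HF2 : forall z, F z * (theta1 z (n + 1)%Z + f z * phi1 z (n + 1)%Z) = theta0 z (n +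
      1)%Z).
  { intros z. apply Ceq_of_minus.
    transitivity (theta0 z (n + 1)%Z *
      (a1 * (theta1 z n * phi1 z (n + 1)%Z - theta1 z (n + 1)%Z * phi1 z n) - 1) + a1 * t1' z *
          E z).
    - unfold F, E, t1'. ring.
    - rewrite HW1, HE; ring. }
  assert (HF : forall z, F z = / (a0 / a1)).
  { assert (TF : tame s F) by (unfold F; solve_tame).
    apply (entire_limit_on_rays F _ s m alpha Hs (proj1 TF) (proj2 TF) Hrays).
    intros i Hi. specialize (Hr i Hi). specialize (Hoff i Hi).
    pose proof (tends_in_inv _ _ _ Hrne Hr) as L. revert L.
    apply (tends_in_ext _ 0). intros z Hz Hzr.
    pose proof (off_axis_Im _ z Hoff Hz Hzr) as Him.
    pose proof (left_solution_neq_0 H0 theta0 phi0 z (n + 1)%Z L0 Him).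
    pose proof (left_solution_neq_0 H1 theta1 phi1 z (n + 1)%Z L1 Him).
    transitivity (phi0 z (n + 1)%Z / phi1 z (n + 1)%Z); [field; split; assumption |].
    rewrite <- HF1. field; assumption. }
  assert (HP : forall z, a0 * phi0 z (n + 1)%Z = a1 * phi1 z (n + 1)%Z).
  { intros z. rewrite <- HF1, HF. field; split; assumption. }
  assert (HT : forall z, a0 * theta0 z (n + 1)%Z = a1 * (theta1 z (n + 1)%Z + f z * phi1 z (n +
      1)%Z)).
  { intros z. rewrite <- HF2, HF. field; split; assumption. }
  set (K := fun z => a0 * (phi0 z n * t1' z - theta0 z n * phi1 z n)).
  assert (HK1 : forall z, K z * phi0 z (n + 1)%Z = phi0 z n - phi1 z n).
  { intros z. apply Ceq_of_minus.
    transitivity (phi0 z n * (a1 * (theta1 z n * phi1 z (n + 1)%Z - theta1 z (n + 1)%Z * phi1 z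
        n) - 1)
      - phi1 z n * (a0 * (theta0 z n * phi0 z (n + 1)%Z - theta0 z (n + 1)%Z * phi0 z n) - 1)
      + phi0 z n * t1' z * (a0 * phi0 z (n + 1)%Z - a1 * phi1 z (n + 1)%Z)
      - phi0 z n * phi1 z n * (a0 * theta0 z (n + 1)%Z - a1 * (theta1 z (n + 1)%Z + f z * phi1
          z (n + 1)%Z))).
    - unfold K, t1'. ring.
    - rewrite HW1, HW0, HP, HT; ring. }
  assert (HK : forall z, K z = 0).
  { assert (TK : tame s K) by (unfold K; solve_tame).
    apply (entire_limit_on_rays K _ s m alpha Hs (proj1 TK) (proj2 TK) Hrays).
    intros i Hi. specialize (Hr i Hi). specialize (Hoff i Hi).
    pose proof (left_ratio_tends_0 H0 theta0 phi0 n _ L0 Hoff) as Q0.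
    pose proof (left_ratio_tends_0 H1 theta1 phi1 n _ L1 Hoff) as Q1.
    pose proof (tends_in_minus _ _ _ _ _ Q0 (tends_in_mult _ _ _ _ _ Q1 Hr)) as L.
    replace (0 - 0 * (a0 / a1)) with (RtoC 0) in L by ring. revert L.
    apply (tends_in_ext _ 0). intros z Hz Hzr.
    pose proof (off_axis_Im _ z Hoff Hz Hzr) as Him.
    pose proof (left_solution_neq_0 H0 theta0 phi0 z (n + 1)%Z L0 Him).
    pose proof (left_solution_neq_0 H1 theta1 phi1 z (n + 1)%Z L1 Him).
    transitivity ((phi0 z n - phi1 z n) / phi0 z (n + 1)%Z); [field; split; assumption |].
    rewrite <- HK1. field; assumption. }
  intros z. split; [| apply HP].
  apply Ceq_of_minus. rewrite <- HK1, HK. ring.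
Qed.

(** One step to the left: the asymptotics of [phi(n-1)/phi(n)] recover first
    [b n] and then the square of [a (n - 1)]. *)
Lemma coefficients_agree_step H0 H1 theta0 phi0 theta1 phi1 n S :
  left_solution H0 theta0 phi0 -> left_solution H1 theta1 phi1 ->
  off_axis S -> (forall r, exists z, S z /\ (r < Cmod z)%R) ->
  (forall z, phi0 z n = phi1 z n /\ ja H0 n * phi0 z (n + 1)%Z = ja H1 n * phi1 z (n + 1)%Z) ->
  jb H0 n = jb H1 n /\ ja H0 (n - 1)%Z = ja H1 (n - 1)%Z /\
  (forall z, phi0 z (n - 1)%Z = phi1 z (n - 1)%Z /\
     ja H0 (n - 1)%Z * phi0 z (n - 1 + 1)%Z = ja H1 (n - 1)%Z * phi1 z (n - 1 + 1)%Z).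
Proof.
  intros L0 L1 HS Hub Heq.
  pose proof L0 as [[_ [S0 _]] _]. pose proof L1 as [[_ [S1 _]] _].
  pose proof (ja_neq_0 H0 (n - 1)%Z) as Ha0. pose proof (ja_neq_0 H1 (n - 1)%Z) as Ha1.
  assert (Hdiff : forall z, ja H0 (n - 1)%Z * phi0 z (n - 1)%Z - ja H1 (n - 1)%Z * phi1 z (n -
      1)%Z =
    (jb H1 n - jb H0 n) * phi0 z n).
  { intros z. destruct (Heq z) as [E1 E2]. pose proof (S0 z n) as Q0. pose proof (S1 z n) as Q1.
    unfold tau in Q0, Q1. rewrite <- E1, <- E2 in Q1. apply Ceq_of_minus.
    transitivity ((ja H0 n * phi0 z (n + 1)%Z + ja H0 (n - 1)%Z * phi0 z (n - 1)%Z + jb H0 n *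
        phi0 z n)
      - (ja H0 n * phi0 z (n + 1)%Z + ja H1 (n - 1)%Z * phi1 z (n - 1)%Z + jb H1 n * phi0 z n)).
    - ring.
    - rewrite Q0, Q1. ring. }
  assert (Hb : jb H0 n = jb H1 n).
  { assert (E : RtoC (jb H1 n) - jb H0 n = 0).
    { apply (tends_in_unique S (fun _ => RtoC (jb H1 n) - jb H0 n) _ _ Hub (tends_in_const _
        _)).
      pose proof (left_ratio_tends_0 H0 theta0 phi0 (n - 1)%Z S L0 HS) as Q0.
      pose proof (left_ratio_tends_0 H1 theta1 phi1 (n - 1)%Z S L1 HS) as Q1.
      pose proof (tends_in_minus S _ _ _ _
        (tends_in_mult S _ _ _ _ (tends_in_const S (ja H0 (n - 1)%Z)) Q0)
        (tends_in_mult S _ _ _ _ (tends_in_const S (ja H1 (n - 1)%Z)) Q1)) as L.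
      replace (ja H0 (n - 1)%Z * 0 - ja H1 (n - 1)%Z * 0) with (RtoC 0) in L by ring.
      revert L. apply (tends_in_ext S 0). intros z Hz Hzr.
      pose proof (off_axis_Im S z HS Hz Hzr) as Him.
      replace (n - 1 + 1)%Z with n by lia. destruct (Heq z) as [E1 _]. rewrite <- E1.
      pose proof (left_solution_neq_0 H0 theta0 phi0 z n L0 Him) as Hne.
      transitivity ((ja H0 (n - 1)%Z * phi0 z (n - 1)%Z - ja H1 (n - 1)%Z * phi1 z (n - 1)%Z) /
          phi0 z n);
        [field; exact Hne |].
      rewrite Hdiff. field; exact Hne. }
    apply (f_equal Re) in E. simpl in E. lra. }
  assert (Hprop : forall z, ja H0 (n - 1)%Z * phi0 z (n - 1)%Z = ja H1 (n - 1)%Z * phi1 z (n -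
      1)%Z).
  { intros z. apply Ceq_of_minus. rewrite Hdiff, Hb. ring. }
  assert (Ha : ja H0 (n - 1)%Z = ja H1 (n - 1)%Z).
  { set (r := ja H0 (n - 1)%Z / ja H1 (n - 1)%Z).
    assert (E : r * r = 1).
    { apply (tends_in_unique S (fun _ => r * r) _ _ Hub (tends_in_const _ _)).
      pose proof (left_ratio_asymptotics H0 theta0 phi0 (n - 1)%Z S L0 HS) as A0.
      pose proof (left_ratio_asymptotics H1 theta1 phi1 (n - 1)%Z S L1 HS) as A1.
      pose proof (tends_in_mult S _ _ _ _ A0 (tends_in_inv S _ _ C1_nz A1)) as L.
      replace (1 * / 1) with (RtoC 1) in L by (field; apply C1_nz).
      revert L. apply (tends_in_ext S 0). intros z Hz Hzr.
      pose proof (off_axis_Im S z HS Hz Hzr) as Him.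
      replace (n - 1 + 1)%Z with n by lia. destruct (Heq z) as [E1 _]. rewrite <- E1.
      pose proof (left_solution_neq_0 H0 theta0 phi0 z n L0 Him) as Hne.
      pose proof (left_solution_neq_0 H1 theta1 phi1 z (n - 1)%Z L1 Him) as Hne1.
      assert (Hz0 : z <> 0) by (apply Cmod_gt_0; exact Hzr).
      replace (phi0 z (n - 1)%Z) with (ja H1 (n - 1)%Z * phi1 z (n - 1)%Z / ja H0 (n - 1)%Z).
      - unfold r. field. repeat split; assumption.
      - rewrite <- Hprop. field; exact Ha0. }
    assert (E2 : RtoC (ja H0 (n - 1)%Z) * ja H0 (n - 1)%Z = RtoC (ja H1 (n - 1)%Z) * ja H1 (n -
        1)%Z).
    { transitivity (r * r * (RtoC (ja H1 (n - 1)%Z) * ja H1 (n - 1)%Z)).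
      - unfold r. field; exact Ha1.
      - rewrite E; ring. }
    apply (f_equal Re) in E2. simpl in E2.
    pose proof (ja_pos H0 (n - 1)%Z). pose proof (ja_pos H1 (n - 1)%Z). nra. }
  split; [exact Hb | split; [exact Ha |]]. intros z.
  replace (n - 1 + 1)%Z with n by lia. split.
  - apply Ceq_of_minus.
    transitivity (/ ja H0 (n - 1)%Z * (ja H0 (n - 1)%Z * phi0 z (n - 1)%Z - ja H0 (n - 1)%Z *
        phi1 z (n - 1)%Z)).
    + field; exact Ha0.
    + rewrite Hprop, Ha. ring.
  - rewrite Ha. f_equal. apply Heq.
Qed.

Lemma coefficients_agree_left H0 H1 theta0 phi0 theta1 phi1 n S :
  left_solution H0 theta0 phi0 -> left_solution H1 theta1 phi1 ->
  off_axis S -> (forall r, exists z, S z /\ (r < Cmod z)%R) ->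
  (forall z, phi0 z n = phi1 z n /\ ja H0 n * phi0 z (n + 1)%Z = ja H1 n * phi1 z (n + 1)%Z) ->
  (forall k, (k < n)%Z -> ja H0 k = ja H1 k) /\ (forall k, (k <= n)%Z -> jb H0 k = jb H1 k) /\
  (forall z k, (k <= n)%Z -> phi0 z k = phi1 z k).
Proof.
  intros L0 L1 HS Hub Heq.
  assert (Hall : forall j : nat, forall z, phi0 z (n - Z.of_nat j)%Z = phi1 z (n - Z.of_nat
      j)%Z /\
    ja H0 (n - Z.of_nat j)%Z * phi0 z (n - Z.of_nat j + 1)%Z =
    ja H1 (n - Z.of_nat j)%Z * phi1 z (n - Z.of_nat j + 1)%Z).
  { induction j as [|j IH]; [rewrite Z.sub_0_r; exact Heq |].
    pose proof (coefficients_agree_step H0 H1 theta0 phi0 theta1 phi1 _ S L0 L1 HS Hub IH) as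
        [_ [_ E]].
    replace (n - Z.of_nat (Datatypes.S j))%Z with (n - Z.of_nat j - 1)%Z by lia. exact E. }
  assert (Hstep : forall k, (k <= n)%Z -> jb H0 k = jb H1 k /\ ja H0 (k - 1)%Z = ja H1 (k -
      1)%Z /\
    forall z, phi0 z k = phi1 z k).
  { intros k Hk. specialize (Hall (Z.to_nat (n - k))).
    replace (n - Z.of_nat (Z.to_nat (n - k)))%Z with k in Hall by lia.
    pose proof (coefficients_agree_step H0 H1 theta0 phi0 theta1 phi1 k S L0 L1 HS Hub Hall)
      as [Hb [Ha _]]. repeat split; auto. apply Hall. }
  split; [|split].
  - intros k Hk. destruct (Hstep (k + 1)%Z ltac:(lia)) as [_ [Ha _]].
    replace (k + 1 - 1)%Z with k in Ha by lia. exact Ha.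
  - intros k Hk. apply Hstep, Hk.
  - intros z k Hk. apply Hstep, Hk.
Qed.

(** * From the coefficients to the Weyl functions *)

(** The solutions [phi0] and [phi1] solve the same equation to the left of
    [n] and have vanishing Wronskian there, so they are proportional; the
    factor is a Wronskian, hence of controlled growth, and tends to [1]. *)
Lemma left_solutions_equal H0 H1 theta0 phi0 theta1 phi1 n s m alpha :
  (0 < s)%R -> left_solution H0 theta0 phi0 -> left_solution H1 theta1 phi1 ->
  (forall k, tame s (fun z => theta0 z k)) -> (forall k, tame s (fun z => phi1 z k)) ->
  dissecting_rays (PI / s) m alpha ->
  (forall i, (i < m)%nat -> tends_in (ray (alpha i)) (fun z => phi0 z n / phi1 z n) 1) ->
  (forall k, (k < n)%Z -> ja H0 k = ja H1 k) -> (forall k, (k <= n)%Z -> jb H0 k = jb H1 k) ->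
  (forall z, lim_at minus_infty (wronskian (ja H0) (phi0 z) (phi1 z)) 0) ->
  forall z, phi1 z (n - 1)%Z = phi0 z (n - 1)%Z /\ phi1 z n = phi0 z n.
Proof.
  intros Hs L0 L1 T0 P1 Hrays Hphi Ha Hb Hlim.
  pose proof L0 as [[_ [S0 W0]] _]. pose proof L1 as [[_ [S1 _]] _].
  assert (HW : forall z, wronskian (ja H0) (phi0 z) (phi1 z) (n - 1)%Z = 0).
  { intros z.
    assert (Hstep : forall k, (k < n)%Z -> wronskian (ja H0) (phi0 z) (phi1 z) k =
      wronskian (ja H0) (phi0 z) (phi1 z) (k - 1)%Z).
    { intros k Hk. specialize (S0 z k). specialize (S1 z k). unfold tau in S0, S1.
      rewrite <- (Ha k), <- (Ha (k - 1)%Z), <- (Hb k) in S1 by lia.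
      unfold wronskian. replace (k - 1 + 1)%Z with k by lia. apply Ceq_of_minus.
      transitivity (phi0 z k * ((ja H0 k * phi1 z (k + 1)%Z + ja H0 (k - 1)%Z * phi1 z (k -
          1)%Z + jb H0 k * phi1 z k) - z * phi1 z k)
        - phi1 z k * ((ja H0 k * phi0 z (k + 1)%Z + ja H0 (k - 1)%Z * phi0 z (k - 1)%Z + jb H0
            k * phi0 z k) - z * phi0 z k)).
      - ring.
      - rewrite S0, S1. ring. }
    assert (Hall : forall j : nat, wronskian (ja H0) (phi0 z) (phi1 z) (n - 1 - Z.of_nat j)%Z =
      wronskian (ja H0) (phi0 z) (phi1 z) (n - 1)%Z).
    { induction j as [|j IH]; [rewrite Z.sub_0_r; reflexivity |].
      replace (n - 1 - Z.of_nat (S j))%Z with (n - 1 - Z.of_nat j - 1)%Z by lia.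
      rewrite <- Hstep by lia. exact IH. }
    apply Cmod_eq_0, Rle_antisym; [| apply Cmod_ge_0].
    apply le_epsilon. intros eps Heps. rewrite Rplus_0_l.
    destruct (proj1 (lim_at_eps _ _ _) (Hlim z) eps Heps) as [N HN].
    specialize (HN (N + Z.to_nat (- (n - 1)))%nat ltac:(lia)). unfold toward in HN.
    rewrite <- (Hall (Z.to_nat (n - 1 + Z.of_nat (N + Z.to_nat (- (n - 1)))))).
    replace (n - 1 - Z.of_nat (Z.to_nat (n - 1 + Z.of_nat (N + Z.to_nat (- (n - 1))))))%Z
      with (- Z.of_nat (N + Z.to_nat (- (n - 1))))%Z by lia.
    apply Rlt_le. eapply Rle_lt_trans; [|exact HN]. right; f_equal; ring. }
  set (F := fun z => wronskian (ja H0) (theta0 z) (phi1 z) (n - 1)%Z).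
  assert (HF : forall z, phi1 z (n - 1)%Z = F z * phi0 z (n - 1)%Z /\ phi1 z n = F z * phi0 z
      n).
  { intros z. destruct (wronskian_expand (ja H0) (theta0 z) (phi0 z) (phi1 z) (n - 1) (W0 z _))
      as [E1 E2].
    rewrite HW in E1, E2. replace (n - 1 + 1)%Z with n in E2 by lia.
    split; [rewrite E1 | rewrite E2]; unfold F; ring. }
  assert (HF1 : forall z, F z = 1).
  { assert (TF : tame s F) by (apply (tame_wronskian s (ja H0) theta0 phi1); auto).
    apply (entire_limit_on_rays F _ s m alpha Hs (proj1 TF) (proj2 TF) Hrays).
    intros i Hi. pose proof (off_axis_ray (alpha i) (proj1 (proj2 Hrays i Hi))) as Hoff.
    pose proof (tends_in_inv _ _ _ C1_nz (Hphi i Hi)) as L.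
    replace (/ 1) with (RtoC 1) in L by (field; apply C1_nz).
    revert L. apply (tends_in_ext _ 0). intros z Hz Hzr.
    pose proof (off_axis_Im _ z Hoff Hz Hzr) as Him.
    pose proof (left_solution_neq_0 H0 theta0 phi0 z n L0 Him) as N0.
    pose proof (left_solution_neq_0 H1 theta1 phi1 z n L1 Him) as N1.
    transitivity (phi1 z n / phi0 z n); [field; split; assumption |].
    rewrite (proj2 (HF z)). field; exact N0. }
  intros z. destruct (HF z) as [E1 E2]. rewrite HF1 in E1, E2. rewrite E1, E2. split; ring.
Qed.

Lemma solutions_next H0 H1 f0 f1 z n : solves (ja H0) (jb H0) z f0 -> solves (ja H1) (jb H1) z
    f1 ->
  ja H0 (n - 1)%Z = ja H1 (n - 1)%Z -> jb H0 n = jb H1 n ->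
  f1 (n - 1)%Z = f0 (n - 1)%Z -> f1 n = f0 n ->
  ja H1 n * f1 (n + 1)%Z = ja H0 n * f0 (n + 1)%Z.
Proof.
  intros S0 S1 Ha Hb E1 E2. specialize (S0 n). specialize (S1 n). unfold tau in S0, S1.
  rewrite E1, E2, <- Ha, <- Hb, <- S0 in S1. apply Ceq_of_minus.
  transitivity ((ja H1 n * f1 (n + 1)%Z + ja H0 (n - 1)%Z * f0 (n - 1)%Z + jb H0 n * f0 n) -
    (ja H0 n * f0 (n + 1)%Z + ja H0 (n - 1)%Z * f0 (n - 1)%Z + jb H0 n * f0 n)).
  - ring.
  - rewrite S1. ring.
Qed.

(** Once [phi0] and [phi1] agree, [theta0] and [theta1] differ by a multiple
    [f] of [phi0], and [f] is the entire part of the difference of the Weyl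
    functions; the rest is a difference of Green functions. *)
Lemma weyl_difference H0 H1 theta0 phi0 u0 theta1 phi1 u1 n s S :
  (0 < s)%R -> left_solution H0 theta0 phi0 -> left_solution H1 theta1 phi1 ->
  weyl_solution H0 u0 -> weyl_solution H1 u1 ->
  (forall k, tame s (fun z => theta0 z k)) -> (forall k, tame s (fun z => theta1 z k)) ->
  ja H0 (n - 1)%Z = ja H1 (n - 1)%Z -> jb H0 n = jb H1 n ->
  (forall z, phi1 z (n - 1)%Z = phi0 z (n - 1)%Z /\ phi1 z n = phi0 z n) ->
  off_axis S ->
  exists f, tame s f /\ tends_in S
     (fun z => (singular_weyl H1 theta1 phi1 u1 z - singular_weyl H0 theta0 phi0 u0 z - f z)
               * (phi0 z (n + 1)%Z * phi0 z (n + 1)%Z)) 0.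
Proof.
  intros Hs L0 L1 U0 U1 T0 T1 Ha Hb Hphi Hoff.
  pose proof L0 as [[ST0 [S0 W0]] _]. pose proof L1 as [[ST1 [S1 W1]] _].
  set (f := fun z => wronskian (ja H0) (theta1 z) (theta0 z) (n - 1)%Z).
  exists f. split; [apply (tame_wronskian s (ja H0) theta1 theta0); auto |].
  assert (Hphi' : forall z, ja H1 n * phi1 z (n + 1)%Z = ja H0 n * phi0 z (n + 1)%Z).
  { intros z. apply (solutions_next H0 H1 (phi0 z) (phi1 z) z n); auto; apply Hphi. }
  set (g := fun z k => theta0 z k - f z * phi0 z k).
  assert (Sg : forall z, solves (ja H0) (jb H0) z (g z)).
  { intros z k. specialize (ST0 z k). specialize (S0 z k). unfold tau, g in *.
    transitivity (z * theta0 z k - f z * (z * phi0 z k)); [rewrite <- ST0, <- S0 |]; ring. }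
  assert (Hth : forall z, theta1 z (n - 1)%Z = g z (n - 1)%Z /\ theta1 z n = g z n).
  { intros z. destruct (wronskian_expand (ja H0) (theta0 z) (phi0 z) (theta1 z) (n - 1) (W0 z
      _)) as [E1 E2].
    assert (HW : wronskian (ja H0) (phi0 z) (theta1 z) (n - 1) = - (1)).
    { rewrite wronskian_antisym, <- (W1 z (n - 1)%Z). unfold wronskian.
      replace (n - 1 + 1)%Z with n by lia. destruct (Hphi z) as [-> ->]. rewrite Ha.
          reflexivity. }
    rewrite HW, wronskian_antisym in E1, E2. fold (f z) in E1, E2.
    replace (n - 1 + 1)%Z with n in E2 by lia. unfold g.
    split; [rewrite E1 | rewrite E2]; ring. }
  assert (Hth' : forall z, ja H1 n * theta1 z (n + 1)%Z = ja H0 n * g z (n + 1)%Z).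
  { intros z. apply (solutions_next H0 H1 (g z) (theta1 z) z n); auto; apply Hth. }
  pose proof (green_tends_0 H0 theta0 phi0 u0 (n + 1)%Z S L0 U0 Hoff) as G0.
  pose proof (green_tends_0 H1 theta1 phi1 u1 (n + 1)%Z S L1 U1 Hoff) as G1.
  pose proof (ja_neq_0 H0 n) as Ha0. pose proof (ja_neq_0 H1 n) as Ha1.
  set (r := ja H1 n / ja H0 n).
  pose proof (tends_in_minus S _ _ _ _ (tends_in_mult S _ _ _ _ (tends_in_const S (r * r)) G1)
      G0) as L.
  replace (r * r * 0 - 0) with (RtoC 0) in L by ring.
  revert L. apply (tends_in_ext S 0). intros z Hz Hzr.
  pose proof (off_axis_Im S z Hoff Hz Hzr) as Him.
  pose proof (left_solution_neq_0 H0 theta0 phi0 z (n + 1)%Z L0 Him) as N0.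
  pose proof (left_solution_neq_0 H1 theta1 phi1 z (n + 1)%Z L1 Him) as N1.
  replace (theta1 z (n + 1)%Z) with (ja H0 n * g z (n + 1)%Z / ja H1 n)
    by (rewrite <- Hth'; field; exact Ha1).
  replace (phi1 z (n + 1)%Z) with (ja H0 n * phi0 z (n + 1)%Z / ja H1 n)
    by (rewrite <- Hphi'; field; exact Ha1).
  unfold g, r. field. repeat split; assumption.
Qed.

Lemma asymp_in_ratio S (f g : C -> C) : asymp_in S f g ->
  (exists r, forall z, S z -> (r < Cmod z)%R -> g z <> 0) -> tends_in S (fun z => f z / g z) 1.
Proof.
  intros H [r0 Hr0] eps Heps.
  destruct (H (mkposreal (eps / 2) ltac:(lra))) as [r Hr].
  exists (Rmax r0 r). intros z Hz Hzr.
  specialize (Hr0 z Hz (Rle_lt_trans _ _ _ (Rmax_l _ _) Hzr)).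
  specialize (Hr z (Rle_lt_trans _ _ _ (Rmax_r _ _) Hzr) Hz).
  change (Cmod (g z - f z) <= eps / 2 * Cmod (g z))%R in Hr.
  pose proof (proj1 (Cmod_gt_0 _) Hr0) as Hg.
  replace (f z / g z - 1) with (- (g z - f z) / g z) by (field; exact Hr0).
  rewrite Cmod_div, Cmod_opp by exact Hr0.
  apply (Rmult_lt_reg_r (Cmod (g z))); [exact Hg |].
  replace (Cmod (g z - f z) / Cmod (g z) * Cmod (g z))%R with (Cmod (g z - f z)) by (field;
      lra).
  eapply Rle_lt_trans; [exact Hr |]. apply Rmult_lt_compat_r; lra.
Qed.

Lemma little_o_in_iff S (f g : C -> C) : (forall z, S z -> (0 < Cmod z)%R -> g z <> 0) ->
  (little_o_in S f (fun z => 1 / (g z) ^ 2) <-> tends_in S (fun z => f z * (g z * g z)) 0).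
Proof.
  intros Hg.
  assert (E : forall z, S z -> (0 < Cmod z)%R -> (0 < Cmod (g z) * Cmod (g z))%R /\
    Cmod (1 / (g z) ^ 2) = (/ (Cmod (g z) * Cmod (g z)))%R).
  { intros z Hz Hzr. specialize (Hg z Hz Hzr). pose proof (proj1 (Cmod_gt_0 _) Hg) as Hp.
    split; [apply Rmult_lt_0_compat; exact Hp |].
    replace (1 / (g z) ^ 2) with (/ (g z * g z)) by (simpl; field; exact Hg).
    rewrite Cmod_inv by (apply Cmult_neq_0; exact Hg). rewrite Cmod_mult. reflexivity. }
  split.
  - intros H eps Heps. destruct (H (mkposreal (eps / 2) ltac:(lra))) as [r Hr].
    exists (Rmax 0 r). intros z Hz Hzr.
    destruct (E z Hz (Rle_lt_trans _ _ _ (Rmax_l _ _) Hzr)) as [Hp E1].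
    specialize (Hr z (Rle_lt_trans _ _ _ (Rmax_r _ _) Hzr) Hz).
    change (Cmod (f z) <= eps / 2 * Cmod (1 / (g z) ^ 2))%R in Hr. rewrite E1 in Hr.
    replace (f z * (g z * g z) - 0) with (f z * (g z * g z)) by ring. rewrite !Cmod_mult.
    apply (Rmult_le_compat_r (Cmod (g z) * Cmod (g z))) in Hr; [|lra].
    rewrite Rmult_assoc, Rinv_l in Hr by lra. lra.
  - intros H eps. destruct (H eps (cond_pos eps)) as [r Hr].
    exists (Rmax 0 r). intros z Hzr Hz.
    destruct (E z Hz (Rle_lt_trans _ _ _ (Rmax_l _ _) Hzr)) as [Hp E1].
    specialize (Hr z Hz (Rle_lt_trans _ _ _ (Rmax_r _ _) Hzr)).
    change (Cmod (f z) <= eps * Cmod (1 / (g z) ^ 2))%R. rewrite E1.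
    replace (f z * (g z * g z) - 0) with (f z * (g z * g z)) in Hr by ring. rewrite !Cmod_mult
        in Hr.
    apply (Rmult_le_reg_r (Cmod (g z) * Cmod (g z))); [lra |].
    rewrite Rmult_assoc, Rinv_l by lra. lra.
Qed.

Lemma rays_in_a_sector (m : nat) (alpha : nat -> R) :
  (forall i, (i < m)%nat -> sin (alpha i) <> 0%R) ->
  exists delta, (0 < delta)%R /\ forall i z, (i < m)%nat -> ray (alpha i) z -> sector delta z.
Proof.
  intros Hs.
  assert (H : exists delta, (0 < delta)%R /\ forall i, (i < m)%nat -> (delta <= Rabs (sin
      (alpha i)))%R).
  { induction m as [|m IH].
    - exists 1%R; split; [lra | lia].
    - destruct IH as [d [Hd H]]; [intros i Hi; apply Hs; lia |].
      exists (Rmin d (Rabs (sin (alpha m)))). split.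
      + apply Rmin_pos; [exact Hd | apply Rabs_pos_lt, Hs; lia].
      + intros i Hi. destruct (Nat.eq_dec i m) as [-> | Hne]; [apply Rmin_r |].
        eapply Rle_trans; [apply Rmin_l | apply H; lia]. }
  destruct H as [d [Hd H]]. exists d. split; [exact Hd |].
  intros i z Hi. apply ray_in_sector; auto.
Qed.

Theorem theorem4p2
  (H0 H1 : jacobi_operator)
  (theta0 phi0 u0 theta1 phi1 u1 : C -> Z -> C)
  (theta0_sol : real_entire_solution (ja H0) (jb H0) theta0)
  (phi0_sol : real_entire_solution (ja H0) (jb H0) phi0)
  (theta1_sol : real_entire_solution (ja H1) (jb H1) theta1)
  (phi1_sol : real_entire_solution (ja H1) (jb H1) phi1)
  (W0 : forall (z : C) (n : Z), wronskian (ja H0) (theta0 z) (phi0 z) n = 1)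
  (W1 : forall (z : C) (n : Z), wronskian (ja H1) (theta1 z) (phi1 z) n = 1)
  (phi0_dom : forall z : C, in_domain_near H0 minus_infty (phi0 z))
  (phi1_dom : forall z : C, in_domain_near H1 minus_infty (phi1 z))
  (u0_weyl : weyl_solution H0 u0)
  (u1_weyl : weyl_solution H1 u1)
  (nt : Z) (s : R) (s_pos : (0 < s)%R)
  (theta0_growth : solution_growth_order_le s theta0)
  (theta1_growth : solution_growth_order_le s theta1)
  (phi0_growth : solution_growth_order_le s phi0)
  (phi1_growth : solution_growth_order_le s phi1)
  (m : nat) (alpha : nat -> R)
  (rays : dissecting_rays (PI / s) m alpha)
  (phi_asymp : forall i : nat, (i < m)%nat ->
     asymp_in (ray (alpha i)) (fun z => phi0 z nt) (fun z => phi1 z nt)) :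
  ((forall n : Z, (n < nt)%Z -> ja H0 n = ja H1 n) /\
   (forall n : Z, (n <= nt)%Z -> jb H0 n = jb H1 n) /\
   (forall z : C, lim_at minus_infty
      (fun n => ja H0 n * (phi0 z n * phi1 z (n + 1)%Z
                           - phi0 z (n + 1)%Z * phi1 z n)) 0))
  <->
  (forall delta : R, (0 < delta)%R ->
     exists f : C -> C,
       entire f /\ growth_order_le s f /\
       little_o_in (sector delta)
         (fun z => singular_weyl H1 theta1 phi1 u1 z
                   - singular_weyl H0 theta0 phi0 u0 z - f z)
         (fun z => 1 / (phi0 z (nt + 1)%Z) ^ 2)).
Proof.
  assert (L0 : left_solution H0 theta0 phi0).
  { split; [split; [apply theta0_sol | split; [apply phi0_sol | exact W0]] | exact phi0_dom]. }
  assert (L1 : left_solution H1 theta1 phi1).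
  { split; [split; [apply theta1_sol | split; [apply phi1_sol | exact W1]] | exact phi1_dom]. }
  pose proof (solution_tame s _ _ theta0 s_pos (ja_pos H0) theta0_sol theta0_growth) as T0.
  pose proof (solution_tame s _ _ phi0 s_pos (ja_pos H0) phi0_sol phi0_growth) as P0.
  pose proof (solution_tame s _ _ theta1 s_pos (ja_pos H1) theta1_sol theta1_growth) as T1.
  pose proof (solution_tame s _ _ phi1 s_pos (ja_pos H1) phi1_sol phi1_growth) as P1.
  assert (Hoff : forall i, (i < m)%nat -> off_axis (ray (alpha i))).
  { intros i Hi. apply off_axis_ray, (proj2 rays i Hi). }
  assert (Hratio : forall i, (i < m)%nat ->
    tends_in (ray (alpha i)) (fun z => phi0 z nt / phi1 z nt) 1).
  { intros i Hi. apply asymp_in_ratio; [apply phi_asymp, Hi |]. exists 0%R. intros z Hz Hzr.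
    apply (left_solution_neq_0 H1 theta1 phi1 z nt L1), (off_axis_Im _ z (Hoff i Hi) Hz Hzr). }
  assert (Hne : forall S, off_axis S -> forall z, S z -> (0 < Cmod z)%R -> phi0 z (nt + 1)%Z <>
      0).
  { intros S HS z Hz Hzr.
    apply (left_solution_neq_0 H0 theta0 phi0 z (nt + 1)%Z L0), (off_axis_Im S z HS Hz Hzr). }
  split.
  - intros [Ha [Hb Hlim]] delta Hdelta.
    pose proof (left_solutions_equal H0 H1 theta0 phi0 theta1 phi1 nt s m alpha s_pos L0 L1 T0
        P1
      rays Hratio Ha Hb Hlim) as Hphi.
    destruct (weyl_difference H0 H1 theta0 phi0 u0 theta1 phi1 u1 nt s (sector delta) s_pos L0
        L1
      u0_weyl u1_weyl T0 T1 (Ha (nt - 1)%Z ltac:(lia)) (Hb nt ltac:(lia)) Hphi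
      (off_axis_sector delta Hdelta)) as [f [[Hent Hgr] Hf]].
    exists f. split; [exact Hent | split; [exact Hgr |]].
    apply little_o_in_iff; [apply Hne, off_axis_sector, Hdelta | exact Hf].
  - intros Hii.
    destruct (rays_in_a_sector m alpha) as [delta [Hdelta Hsec]].
    { intros i Hi. apply (proj2 rays i Hi). }
    destruct (Hii delta Hdelta) as [f [Hent [Hgr Hf]]].
    apply little_o_in_iff in Hf; [|apply Hne, off_axis_sector, Hdelta].
    assert (Heq : forall z, phi0 z nt = phi1 z nt /\
      ja H0 nt * phi0 z (nt + 1)%Z = ja H1 nt * phi1 z (nt + 1)%Z).
    { apply (left_solutions_agree H0 H1 theta0 phi0 u0 theta1 phi1 u1 f nt s m alpha); auto.
      - split; assumption.
      - intros i Hi eps Heps. destruct (Hf eps Heps) as [r Hr]. exists r. intros z Hz.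
        apply Hr, (Hsec i z Hi Hz). }
    assert (Hm : (0 < m)%nat).
    { destruct m; [| lia]. destruct rays as [E _]. pose proof PI_RGT_0. lra. }
    destruct (coefficients_agree_left H0 H1 theta0 phi0 theta1 phi1 nt (ray (alpha 0%nat)) L0 L1
      (Hoff 0%nat Hm) (ray_unbounded (alpha 0%nat)) Heq) as [Ha [Hb Hphi]].
    split; [exact Ha | split; [exact Hb |]]. intros z.
    apply lim_at_eps. intros eps Heps. exists (Z.to_nat (1 - nt)). intros k Hk. unfold toward.
    rewrite (Hphi z (- Z.of_nat k)%Z), (Hphi z (- Z.of_nat k + 1)%Z) by lia.
    match goal with |- (Cmod ?c < _)%R => replace c with (RtoC 0) by ring end.
    rewrite Cmod_0; exact Heps.
Qed.
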